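(* Let $\mathcal T$ be a minimally complete abstract Newton tree at infinity. Assume that $|S(\mathcal T)|>1$ and that $|\Omega(\mathcal T)|\le1$. Choose $z\in\mathrm{In}(\mathcal T)$ and consider $\overline{\mathcal O}=\overline{\mathcal O}(\mathcal T,z)$. Then the following hold. (a) For each $C\in\overline{\mathcal O}$ we have $\widetilde\Delta(Y_C)=\widetilde\Delta\big(\bar V(u_C)\big)+\dot c(C)$, $\widetilde\Delta\big(\bar V(u_C)\big)\ge\max(1,\epsilon(u_C)-2)$ and $\dot c(C)\ge0$. (b) $\displaystyle\widetilde\Delta(\mathcal N)=\widetilde\Delta\big(\bar V(z)\big)+\sum_{C\in\overline{\mathcal O}}\widetilde\Delta(Y_C)=\widetilde\Delta\big(\bar V(u_0)\cup\mathcal N(u_0,e_{u_0})\big)+\sum_{C\in\overline{\mathcal O}\setminus\{C_0\}}\widetilde\Delta(Y_C)$.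
   Context: **Decorated rooted trees.** A rooted tree is a finite tree with set of cells $X_0$, edges (2-element subsets of $X_0$) and a root $v_0\in X_0$; $\delta_x$ is the valency of $x$, and $\gamma_{x,y}$ the unique path from $x$ to $y$. Arrows: $\mathcal A=\{x:\delta_x=1\}\setminus\{v_0\}$; vertices: $\mathcal V=X_0\setminus\mathcal A$. For distinct $x,y$, $x<y$ means that $x$ is on $\gamma_{v_0,y}$. In a decorated rooted tree, each arrow is decorated by $(0)$ or $(1)$ ($\mathcal A_0$ = set of arrows decorated by $(0)$), and each pair $(e,x)$ with $e$ an edge and $x\in e$ carries an integer $q(e,x)$ (decoration of $e$ near $x$). $Q(e,x)=\prod q(e',x)$ over edges $e'\ne e$ incident to $x$ (empty products are $1$). For an edge $e=\{x,y\}$ with $x,y\in\mathcal V$, $\det(e)=q(e,x)q(e,y)-Q(e,x)Q(e,y)$. A dead end is an edge incident to an element of $\mathcal A_0$. **Abstract Newton tree at infinity**: a decorated rooted tree such that (1) for each $v\in\mathcal V$ some $\alpha\in\mathcal A\setminus\mathcal A_0$ satisfies $\alpha>v$; (2) at most one dead end is incident to a given vertex; (3) $q(e,v_0)=1$ for all edges $e$ incident to $v_0$; (4) $q(e,\alpha)=1$ for every edge $e$ incident to an arrow $\alpha$; (5) for $v\in\mathcal V$ and distinct edges $e,e'$ incident to $v$, $q(e,v)$ and $q(e',v)$ are coprime; with $E_v^+$ the set of edges $\{v,x\}$ with $v<x$, $q(e,v)\ge1$ for all $e\in E_v^+$, at most one $e\in E_v^+$ has $q(e,v)>1$, and if a dead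 end $\epsilon$ is incident to $v$ then $q(\epsilon,v)=\max_{e\in E_v^+}q(e,v)$; (6) $\det(e)<0$ for every edge $e$ joining two vertices. For $v\in\mathcal V$, $\alpha\in\mathcal A\setminus\mathcal A_0$: $x_{v,\alpha}$ is the product of $q(\epsilon,u)$ over all edges $\epsilon$ not in $\gamma_{v,\alpha}$ but incident to a cell $u$ of $\gamma_{v,\alpha}$; $N_v=\sum_{\alpha\in\mathcal A\setminus\mathcal A_0}x_{v,\alpha}$. A dicritical vertex is a vertex with $N_v=0$. The tree is **minimally complete** if (i) $N_v\ge0$ for all $v\in\mathcal V$ and each arrow decorated by $(1)$ is adjacent to a dicritical vertex; (ii) a dead end is incident to each dicritical vertex; (iii) if a dead end $e$ incident to a vertex $v$ has $q(e,v)=1$ then $v$ is dicritical; (iv) every vertex $\ne v_0$ has valency $\ne2$. **Notation.** $\mathcal N=\{v\in\mathcal V:N_v>0\}$ (a subtree containing $v_0$; an edge of $\mathcal N$ is an edge with both endpoints in $\mathcal N$). $\mathcal D_v$: set of dicritical vertices adjacent to $v$. Degree $d_u$ of a dicritical $u$: number of $(1)$-arrows adjacent to $u$. For a dicritical $u$, $k_u=-\det(\{u,v\})$ where $v$ is the unique vertex adjacent to $u$ (one has $v\in\mathcal N$). $v\in\mathcal N$ is a node if $\mathcal D_v\neq\emptyset$. $a_v=q(e,v)$ if a dead end $e$ is incident to $v$, $a_v=1$ otherwise. $r_v=-1+$ (number of vertices adjacent to $v$). $\epsilon(v)$: number of elements of $\mathcal N$ adjacent to $v$. For $v\in\mathcal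 N$: $\widetilde\Delta(v)=(r_v-1)(N_v-1)+N_v(1-\frac1{a_v})-\sum_{u\in\mathcal D_v}(d_u-1)$, and $\widetilde\Delta(S)=\sum_{v\in S}\widetilde\Delta(v)$ for $S\subseteq\mathcal N$. $d(v)=N_v$ if $v$ is not a node, $d(v)=\gcd\{d_u:u\in\mathcal D_v\}$ if $v$ is a node. **Characteristic numbers.** $P$ is the set of pairs $(u,e)$ with $u\in\mathcal N$ and $e$ an edge of $\mathcal N$ incident to $u$; $(u',e')\prec(u,e)$ iff $\gamma_{u',u}$ contains $e$ but not $e'$. $\mathcal N(u,e)=\{x\in\mathcal N:e\text{ is in }\gamma_{u,x}\}$. Let $(u,e)\in P$, $e=\{u,y_0\}$. If $\epsilon(y_0)=1$, $c(u,e)=d(y_0)/a_{y_0}$. Otherwise, with $u,y_1,\dots,y_n$ the elements of $\mathcal N$ adjacent to $y_0$ and $e_i=\{y_0,y_i\}$, $c(u,e)=\gcd(d(y_0),c(y_0,e_1),\dots,c(y_0,e_n))/a_{y_0}$, where the gcd of rationals is the nonnegative generator of the $\mathbb Z$-module they generate. $M(u,e)=N_u/c(u,e)$. For $A$ a set of edges of $\mathcal N$ incident to $u$, $R(u,A)=\sum_{x\in\mathcal D_u}(1-\frac1{k_x})+(1-\frac1{a_u})+\sum_{e\in A}(1-\frac1{M(u,e)})$. **Teeth, skeleton.** A $\widetilde\Delta$-trivial path is a path $(z_1,\dots,z_n)$ in $\mathcal N$ with $n>1$, $\epsilon(z_1)=1$, and $\epsilon(z_i)=2$, $\widetilde\Delta(z_i)=0$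 for $1<i<n$. $Z=\{z\in\mathcal N:\epsilon(z)=1,\widetilde\Delta(z)\le0\}$. $\Gamma$: set of $\widetilde\Delta$-trivial paths with $\widetilde\Delta(z_1)\le0<\widetilde\Delta(\{z_1,\dots,z_n\})$ and $z_{n-1}>z_n$. $W$: set of last vertices $z_n$ of elements of $\Gamma$. For $w\in W$, $V(w)=\{v:\gamma_{v,w}\in\Gamma\}$ and $\bar V(w)$ is the set of all vertices on the paths $\gamma_{v,w}$, $v\in V(w)$; for $w\in\mathcal N\setminus W$, $V(w)=\emptyset$ and $\bar V(w)=\{w\}$. $(u,e)\in P$ is a tooth if there is $(z_1,\dots,z_n)\in\Gamma$ with $z_n=u$ and $\{z_n,z_{n-1}\}=e$. $\Omega(\mathcal T)=Z\setminus\bigcup_{w\in W}V(w)$. Skeleton: $S(\mathcal T)=\mathcal N\setminus\bigcup_{w\in W}(\bar V(w)\setminus\{w\})$, a subtree of $\mathcal N$. **Combs.** $(u,e)\in P$ is a comb over $(u',e')\in P$ if $(u,e)\succeq(u',e')$ and every $(v,f)\in P$ with $(u,e)\succ(v,f)\succeq(u',e')$ satisfies: $\epsilon(v)\in\{2,3\}$; if $\epsilon(v)=2$ then $R(v,\{f\})<1$; if $\epsilon(v)=3$ then $R(v,\{f\})=0$ and $(v,g)$ is a tooth, where $g$ is the unique edge of $\mathcal N$ incident to $v$, not in $\gamma_{u,v}$ and distinct from $f$. On $P_S=\{(u,e)\in P:u\in S(\mathcal T)\}$ the relation $\sim$ (''one of the two is a comb over the other'') is an equivalence relation whose classes are totally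 ordered by $\preceq$. **The decomposition.** $\delta^*(v)$: number of edges of $\mathcal N$ incident to $v$ that are contained in no $\gamma\in\Gamma$. $\mathrm{In}(\mathcal T)=\Omega(\mathcal T)$ if $\Omega(\mathcal T)\ne\emptyset$, and $\mathrm{In}(\mathcal T)=\{z\in S(\mathcal T):\delta^*(z)\le1\}$ otherwise; it is nonempty. Given $z\in\mathrm{In}(\mathcal T)$: for $u\in S(\mathcal T)\setminus\{z\}$ let $e_u$ be the edge of $\gamma_{u,z}$ incident to $u$; $\mathcal O(\mathcal T,z)=\{(u,e_u):u\in S(\mathcal T)\setminus\{z\}\}$; $\overline{\mathcal O}(\mathcal T,z)$ is the set of $\sim$-equivalence classes of $\mathcal O(\mathcal T,z)$. For $C\in\overline{\mathcal O}$ with greatest element $(u,e_u)$ and least element $(v,e_v)$: $u_C=u$, $\dot c(C)=c(v,e_v)-c(u,e_u)$ and $Y_C=\bar V(u)\cup\big(\mathcal N(u,e_u)\setminus\mathcal N(v,e_v)\big)$. If $|S(\mathcal T)|>1$, $z'$ is the unique element of $S(\mathcal T)$ adjacent to $z$, $C_0\in\overline{\mathcal O}$ is the class containing $(z',e_{z'})$, and $u_0=u_{C_0}$. *)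

(* Defs.v *)
From mathcomp Require Import all_boot all_order all_algebra.
From mathcomp Require Import ring.

Set Implicit Arguments.
Unset Strict Implicit.
Unset Printing Implicit Defensive.

Import Order.TTheory GRing.Theory Num.Theory.
Local Open Scope ring_scope.

Definition gcdq (x y : rat) : rat :=
  (gcdz (numq x * denq y) (numq y * denq x))%:~R / (denq x * denq y)%:~R.

Definition gcdq_seq (s : seq rat) : rat := foldr gcdq 0 s.

Lemma gcdq_ge0 x y : 0 <= gcdq x y.
Proof.
rewrite /gcdq divr_ge0 // ler0z ?mulr_ge0 //; exact: gcdz_ge0.
Qed.

Lemma gcdqP (x y z : rat) :
  (exists k : int, z = k%:~R * gcdq x y) <->
  (exists a b : int, z = a%:~R * x + b%:~R * y).
Proof.
have dx : (denq x)%:~R != 0 :> rat by rewrite intr_eq0 denq_eq0.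
have dy : (denq y)%:~R != 0 :> rat by rewrite intr_eq0 denq_eq0.
have ex : x = (numq x)%:~R / (denq x)%:~R by rewrite divq_num_den.
have ey : y = (numq y)%:~R / (denq y)%:~R by rewrite divq_num_den.
set m := numq x * denq y; set n := numq y * denq x.
have xE : x = m%:~R / (denq x * denq y)%:~R.
  by rewrite {1}ex /m !intrM; field; rewrite dx dy.
have yE : y = n%:~R / (denq x * denq y)%:~R.
  by rewrite {1}ey /n !intrM; field; rewrite dx dy.
have -> : gcdq x y = (gcdz m n)%:~R / (denq x * denq y)%:~R by [].
move: (denq x * denq y)%:~R xE yE => D xE yE.
rewrite {}xE {}yE {ex ey dx dy}; move: m n => m n.
split=> [[k ->]|[a [b ->]]].
  have [a [b <-]] := Bezoutz m n.
  by exists (k * a), (k * b); rewrite !(intrM, intrD); ring.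
have /dvdzP[m' mE] := dvdz_gcdl m n; have /dvdzP[n' nE] := dvdz_gcdr m n.
exists (a * m' + b * n'); move: (gcdz m n) mE nE => g -> ->.
by rewrite !(intrM, intrD); ring.
Qed.

Lemma gcdq_seq_ge0 s : 0 <= gcdq_seq s.
Proof. by case: s => [|x s] //=; exact: gcdq_ge0. Qed.

(* [gcdq_seq s] is the nonnegative generator of the Z-module spanned by [s]. *)
Lemma gcdq_seqP (s : seq rat) (z : rat) :
  (exists k : int, z = k%:~R * gcdq_seq s) <->
  (exists a : nat -> int, z = \sum_(i < size s) (a i)%:~R * s`_i).
Proof.
elim: s z => [|x s IH] z /=.
  split=> [[k ->]|[a ->]]; first by exists (fun=> 0); rewrite big_ord0 mulr0.
  by exists 0; rewrite big_ord0 mul0r.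
split.
  move=> /gcdqP[a [b ->]].
  have /IH[a' ->] : exists k : int, b%:~R * gcdq_seq s = k%:~R * gcdq_seq s
    by exists b.
  by exists (fun n => if n is n'.+1 then a' n' else a); rewrite big_ord_recl.
move=> [a ->]; apply/gcdqP; rewrite big_ord_recl /=.
have /IH[k ->] : exists a' : nat -> int,
    \sum_(i < size s) (a (bump 0 i))%:~R * s`_i
    = \sum_(i < size s) (a' i)%:~R * s`_i by exists (fun n => a n.+1).
by exists (a 0%N), k.
Qed.

Record rooted_tree := RootedTree {
  cell : finType;
  edges : {set {set cell}};
  root : cell;
  edges_card2 : forall e, e \in edges -> #|e| = 2%N;
  tree_connected : forall x y,
    connect (fun x y => [set x; y] \in edges) x y;
  tree_acyclic : forall c : seq cell, (2 < size c)%N ->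
    ~ ucycle (fun x y => [set x; y] \in edges) c
}.

Section RootedTree.
Variable T : rooted_tree.
Implicit Types (x y z v : cell T) (e : {set cell T}).

Definition adj x y : bool := [set x; y] \in edges T.

Definition incident v : {set {set cell T}} := [set e in edges T | v \in e].

Definition valency x : nat := #|incident x|.

Lemma gamma_subproof x y :
  exists p, [&& path adj x p, uniq (x :: p) & last x p == y].
Proof.
have /connectP[p pP ->] := tree_connected x y.
by case: (shortenP pP) => p' p'P Up' _; exists p'; rewrite p'P Up' eqxx.
Qed.

Definition gamma x y : seq (cell T) := x :: xchoose (gamma_subproof x y).

Definition path_edges (p : seq (cell T)) : seq {set cell T} :=
  [seq [set xy.1; xy.2] | xy <- zip p (behead p)].

Definition gamma_edges x y : seq {set cell T} := path_edges (gamma x y).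

Definition arrows : {set cell T} := [set x | valency x == 1%N] :\ root T.

Definition vertices : {set cell T} := ~: arrows.

Definition tlt x y : bool := (x != y) && (x \in gamma (root T) y).

(* The endpoint of [e] other than [x]. *)
Definition other_end x e : cell T := odflt x [pick y in e :\ x].

End RootedTree.

(* [arrows0] is the set of arrows decorated by (0), the other arrows being
   decorated by (1); [qdec e x] is only relevant when [e] is an edge and
   [x \in e]. *)
Record decorated_tree := DecoratedTree {
  dtree :> rooted_tree;
  arrows0 : {set cell dtree};
  arrows0_sub : arrows0 \subset arrows dtree;
  qdec : {set cell dtree} -> cell dtree -> int
}.

Section DecoratedTree.
Variable T : decorated_tree.
Implicit Types (u v w x y z : cell T) (e f g : {set cell T}).

Definition arrows1 : {set cell T} := arrows T :\: arrows0 T.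

Definition Qdec e x : int := \prod_(e' in incident x :\ e) qdec e' x.

Definition edge_det e : int :=
  \prod_(x in e) qdec e x - \prod_(x in e) Qdec e x.

Definition dead_ends : {set {set cell T}} :=
  [set e in edges T | [exists x in arrows0 T, x \in e]].

Definition dead_ends_at v : {set {set cell T}} := dead_ends :&: incident v.

Definition Eplus v : {set {set cell T}} :=
  [set e in edges T | [exists x, tlt v x && (e == [set v; x])]].

Record newton_tree : Prop := NewtonTree {
  newton_above : forall v, v \in vertices T ->
    exists2 alpha, alpha \in arrows1 & tlt v alpha;
  newton_dead_end : forall v, v \in vertices T -> (#|dead_ends_at v| <= 1)%N;
  newton_root : forall e, e \in incident (root T) -> qdec e (root T) = 1;
  newton_arrow : forall alpha e, alpha \in arrows T -> e \in incident alpha ->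
    qdec e alpha = 1;
  newton_coprime : forall v e e', v \in vertices T ->
    e \in incident v -> e' \in incident v -> e != e' ->
    coprimez (qdec e v) (qdec e' v);
  newton_Eplus_ge1 : forall v e, v \in vertices T -> e \in Eplus v ->
    1 <= qdec e v;
  newton_Eplus_gt1 : forall v, v \in vertices T ->
    (#|[set e in Eplus v | (1 < qdec e v)%R]| <= 1)%N;
  newton_dead_end_max : forall v eps, v \in vertices T ->
    eps \in dead_ends_at v ->
    (exists2 e, e \in Eplus v & qdec eps v = qdec e v) /\
    (forall e, e \in Eplus v -> qdec e v <= qdec eps v);
  newton_det : forall e, e \in edges T -> e \subset vertices T ->
    edge_det e < 0
}.

(* An edge that is not in [gamma v alpha] is incident to at most one cell of
   [gamma v alpha]. *)
Definition xprod v alpha : int :=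
  \prod_(u <- gamma v alpha)
    \prod_(e in incident u | e \notin gamma_edges v alpha) qdec e u.

Definition Nmult v : int := \sum_(alpha in arrows1) xprod v alpha.

Definition dicritical : {set cell T} := [set v in vertices T | Nmult v == 0].

Record minimally_complete : Prop := MinimallyComplete {
  mincomp_ge0 : forall v, v \in vertices T -> 0 <= Nmult v;
  mincomp_arrow : forall alpha, alpha \in arrows1 ->
    exists2 v, v \in dicritical & adj alpha v;
  mincomp_dicritical : forall v, v \in dicritical ->
    exists e, e \in dead_ends_at v;
  mincomp_dead_end : forall v e, v \in vertices T -> e \in dead_ends_at v ->
    qdec e v = 1 -> v \in dicritical;
  mincomp_valency : forall v, v \in vertices T -> v != root T ->
    valency v != 2%N
}.

Definition calN : {set cell T} := [set v in vertices T | 0 < Nmult v].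

Definition edgesN : {set {set cell T}} := [set e in edges T | e \subset calN].

Definition edgesN_at v : {set {set cell T}} := edgesN :&: incident v.

Definition dicriticals_at v : {set cell T} := [set u in dicritical | adj v u].

Definition degree u : nat := #|[set alpha in arrows1 | adj u alpha]|.

(* A dicritical vertex is adjacent to exactly one vertex. *)
Definition kdic u : int :=
  if [pick v in vertices T | adj u v] is Some v then - edge_det [set u; v]
  else 0.

Definition node v : bool := (v \in calN) && (dicriticals_at v != set0).

(* At most one dead end is incident to [v] in a Newton tree. *)
Definition adec v : int :=
  if [pick e in dead_ends_at v] is Some e then qdec e v else 1.

Definition rnum v : int := #|[set x in vertices T | adj v x]|%:Z - 1.

Definition epsN v : nat := #|[set x in calN | adj v x]|.

Definition Delta v : rat :=
  ((rnum v - 1) * (Nmult v - 1))%:~R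
  + (Nmult v)%:~R * (1 - 1 / (adec v)%:~R)
  - \sum_(u in dicriticals_at v) ((degree u)%:R - 1).

Definition DeltaS (S : {set cell T}) : rat := \sum_(v in S) Delta v.

Definition dnum v : int :=
  if node v then (\big[gcdn/0%N]_(u in dicriticals_at v) degree u)%:Z
  else Nmult v.

Definition Ppairs : {set cell T * {set cell T}} :=
  [set p | p.2 \in edgesN_at p.1].

Definition prec (p' p : cell T * {set cell T}) : bool :=
  (p.2 \in gamma_edges p'.1 p.1) && (p'.2 \notin gamma_edges p'.1 p.1).

Definition preceq (p' p : cell T * {set cell T}) : bool :=
  (p' == p) || prec p' p.

Definition calN_at u e : {set cell T} :=
  [set x in calN | e \in gamma_edges u x].

(* The recursion follows a simple path of the tree, so it visits at most
   [#|cell T|] cells: the bound [n] on its depth is harmless (lemma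
   [char_numE]). *)
Fixpoint char_num_rec (n : nat) u e : rat :=
  if n is n'.+1 then
    let y0 := other_end u e in
    (if epsN y0 == 1%N then (dnum y0)%:~R
     else gcdq_seq ((dnum y0)%:~R ::
       [seq char_num_rec n' y0 [set y0; y]
          | y <- enum [set y in calN | adj y0 y & y != u]]))
    / (adec y0)%:~R
  else 0.

Definition char_num u e : rat := char_num_rec #|cell T| u e.

Lemma adj_irr x : ~~ adj x x.
Proof.
apply/negP=> /(@edges_card2 T); rewrite setUid cards1; discriminate.
Qed.

Lemma other_endE u y : adj u y -> other_end u [set u; y] = y.
Proof.
move=> uy; rewrite /other_end; have y_u : y != u.
  by apply: contraL uy => /eqP->; exact: adj_irr.
case: pickP => [x|/(_ y)]; last by rewrite !inE eqxx y_u orbT.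
by rewrite !inE => /andP[/negPf->] /= /eqP.
Qed.

Lemma simple_path_extend x p u y z :
  path (@adj T) x (rcons (rcons p u) y) -> uniq (rcons (rcons p u) y) ->
  adj y z -> z != u -> z \notin rcons (rcons p u) y.
Proof.
move=> pP Up yz zu; apply/negP => zin.
have zy : z != y by apply: contraL yz => /eqP->; exact: adj_irr.
move: zin; rewrite mem_rcons inE (negPf zy) mem_rcons inE (negPf zu) /= => zin.
case/splitPr: zin pP Up => p1 p2 pP Up.
apply: (@tree_acyclic T (z :: rcons (rcons p2 u) y)).
  by rewrite /= !size_rcons.
have E : rcons (rcons (p1 ++ z :: p2) u) y
         = p1 ++ z :: rcons (rcons p2 u) y by rewrite !rcons_cat !rcons_cons.
rewrite E in pP Up; apply/andP; split; last first.
  by move: Up; rewrite cat_uniq => /and3P[].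
move: pP; rewrite cat_path /= => /and3P[_ _ pP].
by rewrite /= rcons_path pP last_rcons; exact: yz.
Qed.

Lemma char_num_rec_stable n m x p u y :
  path (@adj T) x (rcons (rcons p u) y) -> uniq (rcons (rcons p u) y) ->
  (#|cell T| < size (rcons (rcons p u) y) + n)%N -> (n <= m)%N ->
  char_num_rec m u [set u; y] = char_num_rec n u [set u; y].
Proof.
elim: n m p u y => [|n IH] m p u y pP Up.
  rewrite addn0 => lt_sz; have := leq_trans lt_sz (eq_leq (esym (card_uniqP Up))).
  by rewrite ltnNge max_card.
case: m => // m lt_sz; rewrite ltnS => le_nm /=.
have uy : adj u y.
  by move: pP; rewrite rcons_path last_rcons => /andP[].
rewrite other_endE //; congr (_ / _); case: ifP => // _.
congr (gcdq_seq (_ :: _)); apply/eq_in_map => z.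
rewrite mem_enum inE => /and3P[_ yz zu].
have zN := simple_path_extend pP Up yz zu.
apply: (IH m (rcons p u)) => //.
- by rewrite rcons_path pP last_rcons.
- by rewrite rcons_uniq zN.
- by rewrite size_rcons addSnnS.
Qed.

Lemma char_numE u y0 : adj u y0 ->
  char_num u [set u; y0] =
  (if epsN y0 == 1%N then (dnum y0)%:~R
   else gcdq_seq ((dnum y0)%:~R ::
     [seq char_num y0 [set y0; y]
        | y <- enum [set y in calN | adj y0 y & y != u]]))
  / (adec y0)%:~R.
Proof.
move=> uy; rewrite /char_num.
have uy0 : y0 != u by apply: contraL uy => /eqP->; exact: adj_irr.
have [n Tn] : exists n, #|cell T| = n.+1.
  by exists #|cell T|.-1; rewrite prednK //; apply/card_gt0P; exists u.
rewrite {1}Tn /= other_endE //; congr (_ / _); case: ifP => // _.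
congr (gcdq_seq (_ :: _)); apply/eq_in_map => z.
rewrite mem_enum inE => /and3P[_ yz zu].
have yu : adj y0 u by rewrite /adj setUC.
have zy : z != y0 by apply: contraL yz => /eqP->; exact: adj_irr.
symmetry; apply: (@char_num_rec_stable n #|cell T| y0 [:: u] y0 z) => /=.
- by rewrite yu uy yz.
- by rewrite !inE (eq_sym u y0) (eq_sym u z) (eq_sym y0 z) !negb_or uy0 zu zy.
- by rewrite Tn addSn ltnS ltnW // ltnS leqnSn.
- by rewrite Tn.
Qed.

Definition Mnum u e : rat := (Nmult u)%:~R / char_num u e.

Definition Rnum u (A : {set {set cell T}}) : rat :=
  \sum_(x in dicriticals_at u) (1 - 1 / (kdic x)%:~R)
  + (1 - 1 / (adec u)%:~R)
  + \sum_(e in A) (1 - 1 / Mnum u e).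

(* A path [(z_1, ..., z_n)] is the sequence [s] with [z_i = nth _ s i.-1]. *)
Definition trivial_path (s : seq (cell T)) : bool :=
  let z i := nth (root T) s i.-1 in
  let n := size s in
  [&& sorted (@adj T) s, uniq s, all (mem calN) s,
      (1 < n)%N, epsN (z 1%N) == 1%N
    & all (fun i => (epsN (z i) == 2%N) && (Delta (z i) == 0)) (index_iota 2 n)].

Definition Zset : {set cell T} :=
  [set z in calN | (epsN z == 1%N) && (Delta z <= 0)].

Definition Gamma (s : seq (cell T)) : bool :=
  let z i := nth (root T) s i.-1 in
  let n := size s in
  [&& trivial_path s, Delta (z 1%N) <= 0, 0 < DeltaS [set x in s]
    & tlt (z n) (z n.-1)].

(* Every element of [Gamma] is the path [gamma v w] joining its endpoints. *)
Definition Wset : {set cell T} := [set w | [exists v, Gamma (gamma v w)]].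

Definition Vset w : {set cell T} :=
  if w \in Wset then [set v | Gamma (gamma v w)] else set0.

Definition Vbar w : {set cell T} :=
  if w \in Wset then [set x | [exists v in Vset w, x \in gamma v w]]
  else [set w].

Definition tooth (p : cell T * {set cell T}) : bool :=
  (p \in Ppairs) &&
  [exists v, let s := gamma v p.1 in
     Gamma s && (p.2 == [set p.1; nth (root T) s (size s).-2])].

Definition Omega : {set cell T} := Zset :\: \bigcup_(w in Wset) Vset w.

Definition skel : {set cell T} :=
  calN :\: \bigcup_(w in Wset) (Vbar w :\ w).

(* [comb p p'] : [p] is a comb over [p']. *)
Definition comb (p p' : cell T * {set cell T}) : bool :=
  preceq p' p &&
  [forall q in Ppairs, (prec q p && preceq p' q) ==>
     let: (v, f) := q in
     [|| (epsN v == 2%N) && (Rnum v [set f] < 1)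
       | [&& epsN v == 3%N, Rnum v [set f] == 0
           & [exists g in edgesN_at v,
                [&& g \notin gamma_edges p.1 v, g != f & tooth (v, g)]]]]].

Definition csim (p p' : cell T * {set cell T}) : bool := comb p p' || comb p' p.

Definition delta_star v : nat :=
  #|[set e in edgesN_at v |
      ~~ [exists x, exists w, Gamma (gamma x w) && (e \in gamma_edges x w)]]|.

Definition In_set : {set cell T} :=
  if Omega != set0 then Omega else [set z in skel | (delta_star z <= 1)%N].

(* The edge of [gamma u z] incident to [u], for [u != z]. *)
Definition edge_to z u : {set cell T} := [set u; nth u (gamma u z) 1].

Definition calO z : {set cell T * {set cell T}} :=
  [set (u, edge_to z u) | u in skel :\ z].

Definition calObar z : {set {set cell T * {set cell T}}} :=
  equivalence_partition csim (calO z).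

(* The default values in the next definitions are irrelevant: a class is a
   nonempty totally ordered set. *)
Definition greatest (C : {set cell T * {set cell T}}) : cell T * {set cell T} :=
  odflt (root T, set0) [pick p in C | [forall q in C, preceq q p]].

Definition least (C : {set cell T * {set cell T}}) : cell T * {set cell T} :=
  odflt (root T, set0) [pick p in C | [forall q in C, preceq p q]].

Definition u_of (C : {set cell T * {set cell T}}) : cell T := (greatest C).1.

Definition cdot (C : {set cell T * {set cell T}}) : rat :=
  char_num (least C).1 (least C).2 - char_num (greatest C).1 (greatest C).2.

Definition Yset (C : {set cell T * {set cell T}}) : {set cell T} :=
  Vbar (u_of C) :|:
  (calN_at (greatest C).1 (greatest C).2 :\: calN_at (least C).1 (least C).2).

(* The unique element of the skeleton adjacent to [z], if [1 < #|skel|] and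
   [z \in In_set]. *)
Definition zprime z : cell T := odflt z [pick y in skel | adj z y].

Definition C0 z : {set cell T * {set cell T}} :=
  pblock (calObar z) (zprime z, edge_to z (zprime z)).

Definition u0 z : cell T := u_of (C0 z).

End DecoratedTree.

(* Main.v *)
Require Import Defs.
From mathcomp Require Import all_boot all_order all_algebra.
From mathcomp Require Import ring lra zify.
Import Order.TTheory GRing.Theory Num.Theory.
Local Open Scope ring_scope.

Set Implicit Arguments.
Unset Strict Implicit.
Unset Printing Implicit Defensive.

(** Let [q(v,y)] be the decoration near [v] of the edge [vy].  Cutting an edge
    [uy] splits [N_u] as [Q A + q B], where [A] (written [mass u y]) collects the
    arrows beyond the edge; eliminating [B] between [N_u] and [N_y] brings in
    [det] and shows that a dicritical vertex has no child vertex, that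
    [N_v = k_u d_u] for a dicritical child [u] of [v], and, by coprimality of the
    decorations, that [c(u,e)] divides [N_u].  Minimality
    (no vertex of valency 2) gives [c(u,e) <= N_u / 2] when [e] leads away from
    the root.

    In a sum of terms [1 - 1/n] that is smaller than 1 at most one [n] differs
    from 1, so [c(u,e)] can be read off [N] and [R].  This yields
    [Delta z = 1 - c] for the end of a tooth, and [Delta = c(v,f) - c(u,e)] for
    each step of a comb (teeth included).  Rooting the skeleton at [z], the
    equivalence classes are chains of such steps, so the sums telescope.  The
    lower bound at the top of a chain follows from [c <= N / 2] for the teeth,
    and from maximality of the chain when [epsilon = 2] and there is no tooth. *)

(** The definitions speak of edges lying on paths. An edge separates the tree into two sides, so
    each such condition is rewritten as membership in a [branch], and recursions become inductions
    on directed edges.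

    Classes are chains because [up] is injective on the steps of a comb: where epsilon is 2, or is 3
    with a tooth, only one neighbour of the vertex in the skeleton lies away from [z]. Transitivity
    of the relation between combs follows from this.

    The bound 1 has two further sources. [Delta] is integral, since [adec v] divides [Nmult v], so
    positivity suffices; and a leaf of [calN] in the skeleton with [Delta <= 0] belongs to [Omega],
    which under the assumption on its cardinality and by the choice of [z] can only contain [z].

    For the second equality of (b), the choice of [z] makes every neighbour of [z] in [calN] other
    than z' the start of a tooth. Hence [Vbar z] is the whole side of the edge zz' that contains
    [z]: it is the set removed in the definition of [Yset (C0 z)], and adding its sum restores the
    full side. *)

Local Notation root := Defs.root.
Local Notation char_num := Defs.char_num.

(** * Paths and branches of a tree *)

Arguments Defs.gamma : simpl never.

Section Paths.
Variable T : rooted_tree.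
Implicit Types (u v w x y z a b : cell T) (e : {set cell T}) (p : seq (cell T)).

Lemma adj_sym x y : adj x y = adj y x.
Proof. by rewrite /adj setUC. Qed.

Lemma adj_neq x y : adj x y -> x != y.
Proof.
by apply: contraL => /eqP ->; apply/negP=> /(@edges_card2 T);
  rewrite setUid cards1.
Qed.

Lemma simple_path_unique x p q :
  path (@adj T) x p -> uniq (x :: p) -> path (@adj T) x q -> uniq (x :: q) ->
  last x p = last x q -> p = q.
Proof.
elim: p x q => [|a p IH] x [|b q] //=.
- by move=> _ _ _ /andP[xq _] xl; rewrite xl mem_last in xq.
- by move=> _ /andP[xp _] _ _ xl; rewrite -xl mem_last in xp.
move=> /andP[xa pP] /andP[xp Up] /andP[xb qP] /andP[xq Uq] El.
have [ab|nab] := eqVneq a b.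
  by rewrite -ab in qP Uq El *; rewrite (IH a q).
exfalso.
(* Following [p] from [a] and coming back along the reverse of [b :: q] joins [a] to [b] while
   avoiding [x]. Shortened to a simple path and closed through [x], it is a cycle. *)
pose r := behead (rev (b :: q)).
have rE : rev (b :: q) = last b q :: r.
  by rewrite /r lastI rev_rcons.
have lr : last (last b q) r = b.
  by rewrite -[RHS](last_rcons (last b q) (rev q)) -rev_cons rE.
have rP : path (@adj T) (last b q) r.
  have: sorted (@adj T) (rev (b :: q)).
    by rewrite rev_sorted (eq_sorted (e' := @adj T)) // => ? ?; rewrite adj_sym.
  by rewrite rE.
have walk : path (@adj T) a (p ++ r) by rewrite cat_path pP El rP.
have lastb : last a (p ++ r) = b by rewrite last_cat El lr.
have xw : x \notin a :: p ++ r.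
  rewrite -cat_cons mem_cat negb_or xp /=.
  by apply: contra xq => xr; rewrite -mem_rev rE inE xr orbT.
case: (shortenP walk) lastb => w wP Uw sub_w lastb.
apply: (@tree_acyclic T (x :: a :: w)).
  by case: w {wP Uw sub_w} lastb nab => [/= -> /eqP|].
apply/andP; split.
  change (path (@adj T) x (rcons (a :: w) x)).
  by rewrite /= xa rcons_path wP lastb /= adj_sym.
rewrite cons_uniq Uw andbT; apply: contra xw;
  rewrite !inE => /orP[->//|/sub_w ->].
by rewrite orbT.
Qed.

Lemma gamma_prop x y :
  exists2 p, gamma x y = x :: p &
    [/\ path (@adj T) x p, uniq (x :: p) & last x p = y].
Proof.
exists (xchoose (gamma_subproof x y)) => //.
by have /and3P[pP Up /eqP lp] := xchooseP (gamma_subproof x y).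
Qed.

Lemma gamma_unique x p :
  path (@adj T) x p -> uniq (x :: p) -> gamma x (last x p) = x :: p.
Proof.
move=> pP Up; have [q -> [qP Uq lq]] := gamma_prop x (last x p).
by rewrite (simple_path_unique qP Uq pP Up lq).
Qed.

Lemma gamma_id x : gamma x x = [:: x].
Proof. exact: (@gamma_unique x [::]). Qed.

Lemma gamma_uniq x y : uniq (gamma x y).
Proof. by have [p -> []] := gamma_prop x y. Qed.

Lemma mem_gammal x y : x \in gamma x y.
Proof. by have [p -> _] := gamma_prop x y; rewrite mem_head. Qed.

Lemma mem_gammar x y : y \in gamma x y.
Proof. by have [p -> [_ _ <-]] := gamma_prop x y; rewrite mem_last. Qed.

Lemma gamma_sym x y : gamma y x = rev (gamma x y).
Proof.
have [p E [pP Up lp]] := gamma_prop x y; rewrite E.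
case: (lastP p) lp pP Up => [|q y'] /=; first by move=> -> _ _; rewrite gamma_id.
rewrite last_rcons => -> pP Up.
have revE : rev (x :: rcons q y) = y :: rcons (rev q) x.
  by rewrite rev_cons rev_rcons rcons_cons.
rewrite revE -{1}(last_rcons y (rev q) x); apply: gamma_unique.
  have: sorted (@adj T) (rev (x :: rcons q y)).
    by rewrite rev_sorted (eq_sorted (e' := @adj T)) // => ? ?; rewrite adj_sym.
  by rewrite revE.
by rewrite -revE rev_uniq.
Qed.

Lemma mem_gamma_sym x y w : (w \in gamma y x) = (w \in gamma x y).
Proof. by rewrite gamma_sym mem_rev. Qed.

Lemma gamma_split x y w : w \in gamma x y ->
  gamma x y = gamma x w ++ behead (gamma w y).
Proof.
have [p E [pP Up lp]] := gamma_prop x y; rewrite E.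
rewrite inE => /predU1P[->|wp].
  by rewrite gamma_id E.
case/splitPr: wp pP Up lp {E} => p1 p2.
rewrite -cat_rcons cat_path last_rcons last_cat last_rcons => /andP[p1P p2P].
rewrite -cat_cons cat_uniq => /and3P[U1 n12 U2] lp.
rewrite -lp gamma_unique //.
  by have := gamma_unique p1P U1; rewrite last_rcons => ->.
rewrite /= U2 andbT; apply: contra n12 => wp2; apply/hasP; exists w => //.
by rewrite inE mem_rcons mem_head orbT.
Qed.

(** * Directed edges and the branches beyond them *)

Definition toward z u : cell T := nth u (gamma u z) 1.

Arguments toward : simpl never.

Lemma toward_id x : toward x x = x.
Proof. by rewrite /toward gamma_id. Qed.

Definition nbs u : {set cell T} := [set y | adj u y].

Definition branch u y : {set cell T} := [set x | (x != u) && (toward x u == y)].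

Lemma mem_nbs u y : (y \in nbs u) = adj u y.
Proof. by rewrite inE. Qed.

Lemma gamma_cons u y x : adj u y -> u \notin gamma y x ->
  gamma u x = u :: gamma y x.
Proof.
have [p -> [pP Up lp]] := gamma_prop y x => uy u_p.
by rewrite -lp -[last y p]/(last u (y :: p)) gamma_unique //= ?uy ?u_p.
Qed.

Lemma gamma_toward u x : u != x ->
  [/\ adj u (toward x u), gamma u x = u :: gamma (toward x u) x
    & u \notin gamma (toward x u) x].
Proof.
rewrite /toward; have [[|y p] -> []] := gamma_prop u x => /=.
  by move=> _ _ -> /eqP.
move=> /andP[uy yp] /andP[up Up] lp _.
by rewrite -lp gamma_unique.
Qed.

Lemma toward_adj u x : u != x -> adj u (toward x u).
Proof. by case/gamma_toward. Qed.

Lemma branchE u y x : adj u y -> (x \in branch u y) = (u \notin gamma y x).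
Proof.
move=> uy; rewrite inE; apply/andP/idP => [[xu /eqP <-]|uN].
  by rewrite eq_sym in xu; have [] := gamma_toward xu.
split; first by apply: contraNneq uN => <-; rewrite mem_gammar.
by rewrite /toward (gamma_cons uy uN); have [p -> _] := gamma_prop y x.
Qed.

Lemma gamma_branch u y x : adj u y -> x \in branch u y ->
  gamma u x = u :: gamma y x.
Proof. by move=> uy; rewrite branchE // => /gamma_cons ->. Qed.

Lemma gamma_adj u y : adj u y -> gamma u y = [:: u; y].
Proof.
move=> uy; apply: (@gamma_unique u [:: y]); first by rewrite /= uy.
by rewrite /= inE (adj_neq uy).
Qed.

(** Of the two paths from [u] and from [y] to a given cell, exactly one uses the edge. This
    complement rule carries most later separation arguments. *)
Lemma branchC u y x : adj u y -> (x \in branch y u) = (x \notin branch u y).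
Proof.
move=> uy; have yu : adj y u by rewrite adj_sym.
rewrite !branchE // negbK; apply/idP/idP => [yN|uin].
  by apply: contraNT yN => uN; rewrite (gamma_cons uy uN) inE mem_gammal orbT.
have [p Ep _] := gamma_prop u x.
have := gamma_uniq y x; rewrite (gamma_split uin) (gamma_adj yu) Ep.
by rewrite cat_cons cons_uniq => /andP[].
Qed.

Lemma mem_branch u x : x != u -> x \in branch u (toward x u).
Proof. by move=> xu; rewrite inE xu eqxx. Qed.

Lemma toward_branch u y x : x \in branch u y -> toward x u = y.
Proof. by rewrite inE => /andP[_ /eqP]. Qed.

Lemma branch_neq u y x : x \in branch u y -> x != u.
Proof. by rewrite inE => /andP[]. Qed.

Lemma branch_self u y : adj u y -> y \in branch u y.
Proof. by move=> uy; rewrite branchE // gamma_id inE (adj_neq uy). Qed.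

Lemma branch_disj u y y' x : x \in branch u y -> x \in branch u y' -> y = y'.
Proof. by move=> /toward_branch <- /toward_branch. Qed.

Lemma branch_sub u y y' x : adj u y -> adj y y' -> y' != u ->
  x \in branch y y' -> x \in branch u y.
Proof.
move=> uy yy' y'u xb; rewrite branchC 1?adj_sym //.
by apply: contraNN y'u => xb'; rewrite (branch_disj xb xb').
Qed.

Lemma branch_next u y x : adj u y -> x \in branch u y -> x != y ->
  [/\ adj y (toward x y), toward x y != u & x \in branch y (toward x y)].
Proof.
move=> uy xb xy; split; last exact: mem_branch.
  by apply: toward_adj; rewrite eq_sym.
by apply: contraL xb => /eqP E; rewrite -branchC // -E mem_branch.
Qed.

Lemma card_branch_lt u y y' : adj u y -> adj y y' -> y' != u ->
  (#|branch y y'| < #|branch u y|)%N.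
Proof.
move=> uy yy' y'u; apply: proper_card; apply/properP; split.
  by apply/subsetP => x; exact: branch_sub.
by exists y; rewrite ?branch_self // inE eqxx.
Qed.

(** The branch shrinks strictly at each step away from the origin. This is the recursion pattern of
    both [mass] and [char_num]. *)
Lemma branch_ind (P : cell T -> cell T -> Prop) :
  (forall u y, adj u y ->
     (forall y', adj y y' -> y' != u -> P y y') -> P u y) ->
  forall u y, adj u y -> P u y.
Proof.
move=> H u y; have [n] := ubnP #|branch u y|.
elim: n u y => // n IH u y; rewrite ltnS => le_n uy.
apply: H => // y' yy' y'u; apply: IH => //.
exact: leq_trans (card_branch_lt uy yy' y'u) le_n.
Qed.

Lemma set2_eq_adj u y y' : adj u y -> ([set u; y] == [set u; y']) = (y == y').
Proof.
move=> uy; apply/eqP/eqP => [E|->//].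
have: y \in [set u; y'] by rewrite -E !inE eqxx orbT.
by rewrite !inE eq_sym (negPf (adj_neq uy)) /= => /eqP.
Qed.

Lemma gamma_edges_id x : gamma_edges x x = [::].
Proof. by rewrite /gamma_edges gamma_id. Qed.

Lemma gamma_edges_branch u y x : adj u y -> x \in branch u y ->
  gamma_edges u x = [set u; y] :: gamma_edges y x.
Proof.
move=> uy xb; rewrite /gamma_edges (gamma_branch uy xb) /path_edges /=.
by have [p -> _] := gamma_prop y x.
Qed.

Lemma path_edges_sub p e x : e \in path_edges p -> x \in e -> x \in p.
Proof.
elim: p e => // a [|b p] IH e //; rewrite -[path_edges _]/([set a;
  b] :: path_edges (b :: p)).
rewrite inE => /predU1P[->|/IH ep xe]; last by rewrite inE ep ?orbT.
by rewrite !inE => /orP[] ->; rewrite ?orbT.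
Qed.

Lemma branch_adj a b x y : adj a b -> adj x y -> [set x; y] != [set a; b] ->
  x \in branch a b -> y \in branch a b.
Proof.
move=> ab xy neq; rewrite !branchE // !(mem_gamma_sym _ b) => aN.
have [bx|] := boolP (b \in branch x y).
  by move: aN; rewrite (gamma_branch xy bx) inE negb_or => /andP[].
rewrite -branchC // => bx; have yx : adj y x by rewrite adj_sym.
rewrite (gamma_branch yx bx) inE negb_or aN andbT.
apply: contraNneq neq => ay; rewrite -{}ay in yx bx *.
by rewrite -(toward_branch bx) (toward_branch (branch_self ab)) setUC.
Qed.

Lemma branch_adjE a b x y : adj a b -> adj x y -> [set x; y] != [set a; b] ->
  (x \in branch a b) = (y \in branch a b).
Proof.
move=> ab xy neq; apply/idP/idP; first exact: branch_adj.
by apply: branch_adj; rewrite // 1?adj_sym // setUC.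
Qed.

(** This translates the path conditions in [prec], [calN_at] and [comb] into sides of an edge. *)
Lemma gamma_edgesE a b x y : adj a b ->
  ([set a; b] \in gamma_edges x y) = ((x \in branch a b) != (y \in branch a b)).
Proof.
move=> ab; have [n] := ubnP (size (gamma x y)).
elim: n x => // n IH x; rewrite ltnS => le_n.
have [->|xy] := eqVneq x y; first by rewrite gamma_edges_id eqxx.
have [xa gE xN] := gamma_toward xy.
move: (toward y x) xa gE xN => x' xx' gE xN.
have yb : y \in branch x x' by rewrite branchE.
rewrite (gamma_edges_branch xx' yb) inE IH; last by move: le_n; rewrite gE.
have [E|neq] /= := eqVneq [set a; b] [set x; x'].
  have: x \in [set a; b] by rewrite E !inE eqxx.
  rewrite in_set2 => /orP[] /eqP xE; rewrite -!xE in ab E *.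
    move/eqP: E; rewrite set2_eq_adj // => /eqP ->.
    by rewrite yb [x \in _]inE eqxx.
  move/eqP: E; rewrite (setUC _ [set x]) set2_eq_adj 1?adj_sym // => /eqP ->.
  by rewrite branch_self 1?adj_sym // branchC // yb.
by rewrite (@branch_adjE a b x x') // eq_sym.
Qed.

Lemma branch_convex a b x y w : adj a b -> x \in branch a b ->
  y \in branch a b -> w \in gamma x y -> w \in branch a b.
Proof.
move=> ab; have [n] := ubnP (size (gamma x y)).
elim: n x => // n IH x; rewrite ltnS => le_n xb yb.
have [->|xy] := eqVneq x y; first by rewrite gamma_id inE => /eqP ->.
have [xa gE xN] := gamma_toward xy.
move: (toward y x) xa gE xN => x' xx' gE xN.
have yb' : y \in branch x x' by rewrite branchE.
rewrite gE inE => /predU1P[->//|]; apply: IH => //; first by move: le_n;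
  rewrite gE.
have [E|neq] := eqVneq [set x; x'] [set a; b]; last by apply: branch_adj neq xb.
have: [set a; b] \in gamma_edges x y.
  by rewrite (gamma_edges_branch xx' yb') -E mem_head.
by rewrite gamma_edgesE // xb yb.
Qed.

(* The edge [ab] is a bridge. *)
Lemma gamma_bridge a b x y : adj a b -> x \in branch b a -> y \in branch a b ->
  gamma x y = gamma x a ++ gamma b y.
Proof.
move=> ab; rewrite branchC // => xb yb.
have ain : a \in gamma x y.
  by apply: path_edges_sub (set21 a b); rewrite gamma_edgesE // yb (negPf xb).
by rewrite (gamma_split ain) (gamma_branch ab yb).
Qed.

Lemma valencyE u : valency u = #|nbs u|.
Proof.
rewrite /valency -(@card_in_imset _ _ (fun y => [set u; y]) (nbs u)); last first.
  by move=> y y'; rewrite mem_nbs => uy _ /eqP; rewrite set2_eq_adj // => /eqP.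
congr #|pred_of_set _|; apply/setP => e; rewrite !inE; apply/andP/imsetP.
  case=> eT ue; have := edges_card2 eT => /eqP/cards2P[a [b [ab eE]]].
  move: eT ue; rewrite eE !inE => eT /orP[] /eqP uE; rewrite uE.
    by exists b; rewrite ?inE.
  by exists a; rewrite ?inE /adj setUC.
by case=> y; rewrite inE => uy ->; rewrite !inE eqxx.
Qed.

Lemma incidentE u : incident u = [set [set u; y] | y in nbs u].
Proof.
apply/setP => e; rewrite !inE; apply/andP/imsetP.
  case=> eT ue; have := edges_card2 eT => /eqP/cards2P[a [b [ab eE]]].
  move: eT ue; rewrite eE !inE => eT /orP[] /eqP uE; rewrite uE.
    by exists b; rewrite ?inE.
  by exists a; rewrite ?inE /adj setUC.
by case=> y; rewrite inE => uy ->; rewrite !inE eqxx.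
Qed.

Lemma nbs_edge_inj u : {in nbs u &, injective (fun y => [set u; y])}.
Proof.
by move=> y y'; rewrite mem_nbs => uy _ /eqP; rewrite set2_eq_adj // => /eqP.
Qed.

(** Cells beyond [y] are grouped by their first step from [y]. The recursions for masses and for
    sums of [Delta] are instances. *)
Lemma big_branch (R : Type) (idx : R) (op : Monoid.com_law idx) u y
    (P : pred (cell T)) (F : cell T -> R) : adj u y ->
  \big[op/idx]_(x in branch u y | P x) F x =
  op (if P y then F y else idx)
     (\big[op/idx]_(y' in nbs y :\ u) \big[op/idx]_(x in branch y y' | P x) F x).
Proof.
move=> uy; rewrite (bigID (pred1 y)) /=; congr (op _ _).
  case: ifP => Py.
    rewrite (big_pred1 y) // => x /=; have [->|] := eqVneq x y; rewrite ?andbF //.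
    by rewrite branch_self // Py.
  by apply: big_pred0 => x; have [->|] := eqVneq x y; rewrite ?Py ?andbF.
rewrite (partition_big (fun x => toward x y) (mem (nbs y :\ u))) /=.
  apply: eq_bigr => y'; rewrite !inE => /andP[y'u yy'].
  apply: eq_bigl => x; apply/idP/idP.
    move=> /andP[/andP[/andP[xb ->] xy] /eqP <-]; rewrite andbT.
    exact: mem_branch.
  move=> /andP[xb ->]; rewrite (branch_sub uy yy' y'u xb) (branch_neq xb).
  by rewrite (toward_branch xb) eqxx.
move=> x /andP[/andP[xb _] xy]; have [? ? _] := branch_next uy xb xy.
by rewrite !inE; apply/andP.
Qed.

Lemma big_cells_branch (R : Type) (idx : R) (op : Monoid.com_law idx) y
    (P : pred (cell T)) (F : cell T -> R) :
  \big[op/idx]_(x | P x) F x =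
  op (if P y then F y else idx)
     (\big[op/idx]_(y' in nbs y) \big[op/idx]_(x in branch y y' | P x) F x).
Proof.
rewrite (bigID (pred1 y)) /=; congr (op _ _).
  case: ifP => Py.
    by rewrite (big_pred1 y) // => x /=; have [->|] := eqVneq x y;
      rewrite ?andbF ?Py.
  by apply: big_pred0 => x; have [->|] := eqVneq x y; rewrite ?Py ?andbF.
rewrite (partition_big (fun x => toward x y) (mem (nbs y))) /=.
  apply: eq_bigr => y'; rewrite !inE => yy'.
  apply: eq_bigl => x; apply/idP/idP.
    move=> /andP[/andP[-> xy] /eqP <-]; rewrite andbT.
    exact: mem_branch.
  move=> /andP[xb ->]; rewrite (branch_neq xb).
  by rewrite (toward_branch xb) eqxx.
by move=> x /andP[_ xy]; rewrite mem_nbs toward_adj // eq_sym.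
Qed.

End Paths.

(** * Multiplicities *)

Section Weights.
Variable T : decorated_tree.
Implicit Types (u v w x y z : cell T).

Definition qn v y : int := qdec [set v; y] v.

Definition cof v y : int := \prod_(h in nbs v :\ y) qn v h.

Definition cof2 u y j : int := \prod_(h in nbs y :\ u :\ j) qn y h.

(* The contribution to the multiplicities [Nmult] of the arrows that lie
   beyond the edge [uy]. *)
Definition mass u y : int :=
  \sum_(alpha in branch u y | alpha \in arrows1 T)
    \prod_(w <- gamma y alpha)
       \prod_(e in incident w | e \notin gamma_edges u alpha) qdec e w.

Lemma prod_incident w (P : pred {set cell T}) :
  \prod_(e in incident w | P e) qdec e w =
  \prod_(h in nbs w | P [set w; h]) qn w h.
Proof.
rewrite incidentE big_mkcondr big_imset /=; last exact: nbs_edge_inj.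
by rewrite -big_mkcondr.
Qed.

Lemma notin_gamma_edges w x y (e : {set cell T}) :
  w \in e -> w \notin gamma x y -> e \notin gamma_edges x y.
Proof. by move=> we; apply: contraNN => /path_edges_sub; apply. Qed.

Lemma Nmult_branch v : v \notin arrows1 T ->
  Nmult v = \sum_(y in nbs v) cof v y * mass v y.
Proof.
move=> vN; rewrite /Nmult (big_cells_branch _ v) (negPf vN) /= add0r.
apply: eq_bigr => y; rewrite mem_nbs => vy.
rewrite /mass big_distrr /=; apply: eq_bigr => a /andP[ab _].
rewrite /xprod {1}(gamma_branch vy ab) big_cons prod_incident; congr (_ * _).
have vN' : v \notin gamma y a by rewrite -branchE.
apply: eq_bigl => h; rewrite !inE; have [vh|] := boolP (adj v h);
  rewrite ?andbF //.
rewrite andbT (gamma_edges_branch vy ab) inE negb_or set2_eq_adj // andbC.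
by rewrite (notin_gamma_edges (set21 v h) vN') !andbT.
Qed.

Lemma mass_rec u y : adj u y -> y \notin arrows1 T ->
  mass u y = \sum_(j in nbs y :\ u) cof2 u y j * mass y j.
Proof.
move=> uy yN; rewrite /mass (big_branch _ _ _ uy) (negPf yN) /= add0r.
apply: eq_bigr => j; rewrite in_setD1 mem_nbs => /andP[ju yj].
rewrite big_distrr /=; apply: eq_bigr => a /andP[ab _].
have ab' := branch_sub uy yj ju ab.
rewrite (gamma_branch yj ab) big_cons prod_incident; congr (_ * _).
  have yN' : y \notin gamma j a by rewrite -branchE.
  apply: eq_bigl => h; rewrite !inE; have [yh|] := boolP (adj y h);
    rewrite ?andbF //.
  rewrite andbT (gamma_edges_branch uy ab') (gamma_edges_branch yj ab) !inE
    !negb_or.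
  rewrite (setUC [set u]) !set2_eq_adj // (notin_gamma_edges (set21 y h) yN').
  by rewrite /= andbT andbC.
(* Starting the path at [u] instead of [y] only adds the edge [uy], which meets no cell of
   [gamma j a]. *)
apply: eq_big_seq => w wg; apply: eq_bigl => e.
have [|] := boolP (e \in incident w); rewrite // inE => /andP[_ we] /=.
rewrite (gamma_edges_branch uy ab') inE (gamma_edges_branch yj ab).
case: eqP => // eE; exfalso; move: we; rewrite {}eE in_set2 => /orP[] /eqP wE.
  rewrite {}wE in wg; have : u \in gamma y a by rewrite (gamma_branch yj ab)
    inE wg orbT.
  by apply/negP; rewrite -branchE.
by move: wg; rewrite {}wE; apply/negP; rewrite -branchE.
Qed.

Lemma mass_arrow u y : adj u y -> y \in arrows T ->
  mass u y = (y \in arrows1 T)%:R.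
Proof.
move=> uy ya; have nb0 : nbs y :\ u = set0.
  apply/eqP; rewrite -cards_eq0; move: ya; rewrite !inE => /andP[_].
  by rewrite valencyE (cardsD1 u) inE adj_sym uy eqSS.
rewrite /mass (big_branch _ _ _ uy) nb0 big_set0 /= addr0; case: ifP => // _.
rewrite gamma_id big_seq1 big1 // => e /andP[]; rewrite incidentE => /imsetP[h].
rewrite mem_nbs => yh ->; have [->|hu] := eqVneq h u.
  by rewrite (gamma_edges_branch uy (branch_self uy)) setUC mem_head.
by have := in_set0 h; rewrite -nb0 !inE hu yh.
Qed.

Lemma cof_cof2 u y y' : adj u y -> adj u y' -> y' != y ->
  cof u y' = qn u y * cof2 y u y'.
Proof.
move=> uy uy' ny; rewrite /cof (bigD1 y) /=; last by rewrite !inE eq_sym ny.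
congr (_ * _); apply: eq_bigl => h; rewrite !inE.
by case: (h == y'); rewrite ?andbF //= andbC.
Qed.

(** The terms of the neighbours of [u] other than [y] share the factor [qn u y], and what remains is
    the recursion for [mass y u]. *)
Lemma Nmult_edge u y : adj u y -> u \notin arrows1 T ->
  Nmult u = cof u y * mass u y + qn u y * mass y u.
Proof.
move=> uy uN; rewrite Nmult_branch // (bigD1 y) ?mem_nbs //=; congr (_ + _).
rewrite mass_rec 1?adj_sym // big_distrr /=.
rewrite (eq_bigl (mem (nbs u :\ y))); last by move=> h; rewrite !inE andbC.
apply: eq_bigr => h; rewrite !inE => /andP[hy uh].
by rewrite (cof_cof2 uy) // mulrA.
Qed.

Lemma edge_detE u y : adj u y ->
  edge_det [set u; y] = qn u y * qn y u - cof u y * cof y u.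
Proof.
move=> uy; have uy' := adj_neq uy.
have QE a b : adj a b -> Qdec [set a; b] a = cof a b.
  move=> ab; rewrite /Qdec /cof.
  transitivity (\prod_(e in incident a | e != [set a; b]) qdec e a).
    by apply: eq_bigl => e; rewrite in_setD1 andbC.
  rewrite prod_incident; apply: eq_bigl => h; rewrite !inE.
  by case ah: (adj a h); rewrite ?andbF //= set2_eq_adj ?andbT.
rewrite /edge_det !big_setU1 ?inE //= !big_set1 QE //
  (setUC [set u]) QE 1?adj_sym //.
by rewrite /qn (setUC [set y]).
Qed.

(* Eliminating [mass y u] between the two expressions given by [Nmult_edge]. *)
Lemma Nmult_det u y : adj u y -> u \notin arrows1 T -> y \notin arrows1 T ->
  qn u y * Nmult y - cof y u * Nmult u = mass u y * edge_det [set u; y].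
Proof.
move=> uy uN yN; have yu : adj y u by rewrite adj_sym.
by rewrite (Nmult_edge uy) // (Nmult_edge yu) // edge_detE //; ring.
Qed.

End Weights.

(** * Divisibility of rational numbers *)

Lemma big_disjointU (R : Type) (idx : R) (op : Monoid.com_law idx) (I : finType)
    (A B : {set I}) (F : I -> R) : [disjoint A & B] ->
  \big[op/idx]_(i in A :|: B) F i =
  op (\big[op/idx]_(i in A) F i) (\big[op/idx]_(i in B) F i).
Proof. by move=> dis; rewrite -bigU //; apply: eq_bigl => i; rewrite !inE. Qed.

Section RationalDivisibility.
Implicit Types (c x y : rat) (m n : int).

(** Divisibility is taken between rationals because the quotients by [adec] make characteristic
    numbers a priori non-integral. *)
Definition dvq c x := exists k : int, x = k%:~R * c.

Lemma dvq_refl c : dvq c c.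
Proof. by exists 1; rewrite mul1r. Qed.

Lemma dvq0 c : dvq c 0.
Proof. by exists 0; rewrite mul0r. Qed.

Lemma dvq_trans y c x : dvq c y -> dvq y x -> dvq c x.
Proof. by move=> [k ->] [l ->]; exists (l * k); rewrite intrM mulrA. Qed.

Lemma dvqD c x y : dvq c x -> dvq c y -> dvq c (x + y).
Proof. by move=> [k ->] [l ->]; exists (k + l); rewrite intrD mulrDl. Qed.

Lemma dvqN c x : dvq c x -> dvq c (- x).
Proof. by move=> [k ->]; exists (- k); rewrite mulrNz mulNr. Qed.

Lemma dvqMz c m x : dvq c x -> dvq c (m%:~R * x).
Proof. by move=> [k ->]; exists (m * k); rewrite intrM mulrA. Qed.

Lemma dvq_sum (I : Type) (r : seq I) (P : pred I) (F : I -> rat) c :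
  (forall i, P i -> dvq c (F i)) -> dvq c (\sum_(i <- r | P i) F i).
Proof. by move=> H; elim/big_ind: _ => //; [exact: dvq0|exact: dvqD]. Qed.

Lemma dvq_mul2l a c x : a != 0 -> dvq (a * c) (a * x) -> dvq c x.
Proof. by move=> a0 [k E]; exists k; apply: (mulfI a0); rewrite E mulrCA. Qed.

Lemma dvq_gt0 c x : 0 <= c -> 0 < x -> dvq c x ->
  0 < c /\ exists2 k : int, 1 <= k & x = k%:~R * c.
Proof.
move=> c0 x0 [k E]; have c_gt0 : 0 < c.
  by rewrite lt0r c0 andbT; apply: contraTneq x0 => c00; rewrite E c00 mulr0.
split=> //; exists k => //.
by move: x0; rewrite E pmulr_lgt0 // ltr0z gtz0_ge1.
Qed.

Lemma dvq_le c x : 0 <= c -> 0 < x -> dvq c x -> c <= x.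
Proof.
move=> c0 x0 /(dvq_gt0 c0 x0)[c1 [k k1 ->]].
by rewrite ler_peMl // ler1z.
Qed.

Lemma dvq_anti x y : 0 < x -> 0 < y -> dvq x y -> dvq y x -> x = y.
Proof.
move=> x0 y0 xy yx; apply/eqP; rewrite eq_le.
by rewrite (dvq_le (ltW x0) y0 xy) (dvq_le (ltW y0) x0 yx).
Qed.

Lemma dvq_bezout c m n x : coprimez m n ->
  dvq c (m%:~R * x) -> dvq c (n%:~R * x) -> dvq c x.
Proof.
move=> /coprimezP[[a b] /= E] cm cn.
have -> : x = (a * m + b * n)%:~R * x by rewrite E mul1r.
rewrite intrD !intrM mulrDl -!mulrA.
by apply: dvqD; apply: dvqMz.
Qed.

Lemma coprimez_prod (I : finType) (S : {set I}) (q : I -> int) m :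
  (forall i, i \in S -> coprimez m (q i)) -> coprimez m (\prod_(i in S) q i).
Proof.
move=> H; elim/big_ind: _ => // [|a b ma mb];
  first by rewrite coprimezE coprimen1.
by rewrite coprimezMr ma.
Qed.

(** The products of all but one of several pairwise coprime integers have no common factor. The
    induction removes one index [i] and applies Bezout to [q i] and the product of the others. *)
Lemma dvq_cofactors (I : finType) (S : {set I}) (q : I -> int) c x :
  S != set0 -> {in S &, forall i j, i != j -> coprimez (q i) (q j)} ->
  (forall j, j \in S -> dvq c ((\prod_(h in S :\ j) q h)%:~R * x)) -> dvq c x.
Proof.
have [n] := ubnP #|S|; elim: n S x => // n IH S x le_n /set0Pn[i iS] qS H.
have [S0|S'] := eqVneq (S :\ i) set0.
  by have := H i iS; rewrite S0 big_set0 mul1r.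
apply: (@dvq_bezout _ (q i) (\prod_(h in S :\ i) q h)); last exact: H.
  apply: coprimez_prod => j; rewrite !inE => /andP[ji jS].
  by apply: qS; rewrite // eq_sym.
apply: (IH (S :\ i)) => //.
- by move: le_n; rewrite (cardsD1 i) iS ltnS.
- move=> j h; rewrite !inE => /andP[_ jS] /andP[_ hS]; exact: qS.
move=> j; rewrite !inE => /andP[ji jS].
have := H j jS; rewrite (bigD1 i) ?inE ?(eq_sym i) ?ji ?iS //=.
rewrite [q i * _]mulrC intrM -mulrA; congr (dvq _ (_%:~R * _)).
by apply: eq_bigl => h; rewrite !inE; case: (h == i); rewrite ?andbF ?andbT.
Qed.

Lemma gcdq_seq_dvq (s : seq rat) x : x \in s -> dvq (gcdq_seq s) x.
Proof.
move=> xs; have /gcdq_seqP[k ->] : exists a : nat -> int,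
    x = \sum_(i < size s) (a i)%:~R * s`_i; last by exists k.
move/(nthP 0): xs => [i ilt <-]; exists (fun j => (j == i)%:R).
rewrite (bigD1 (Ordinal ilt)) //= eqxx mul1r big1 ?addr0 // => j.
by rewrite -val_eqE /= => /negPf ->; rewrite mul0r.
Qed.

Lemma dvq_gcdq_seq (s : seq rat) c :
  (forall x, x \in s -> dvq c x) -> dvq c (gcdq_seq s).
Proof.
move=> H; have /gcdq_seqP[a ->] : exists k : int, gcdq_seq s = k%:~R * gcdq_seq s.
  by exists 1; rewrite mul1r.
by apply: dvq_sum => i _; apply: dvqMz; apply: H; apply: mem_nth.
Qed.

Lemma gcdq_seq_gt0 (s : seq rat) x : x \in s -> x != 0 -> 0 < gcdq_seq s.
Proof.
move=> /gcdq_seq_dvq[k E] x0; rewrite lt0r gcdq_seq_ge0 andbT.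
by apply: contraNneq x0 => g0; rewrite E g0 mulr0.
Qed.

Lemma dvq_nat (m n : nat) : (m %| n)%N -> dvq m%:R n%:R.
Proof. by move=> /dvdnP[k ->]; exists k%:Z; rewrite natrM. Qed.

Lemma dvq_gcdn c (m n : nat) : dvq c m%:R -> dvq c n%:R -> dvq c (gcdn m n)%:R.
Proof.
move=> cm cn; have [a [b E]] := Bezoutz m%:Z n%:Z.
have -> : (gcdn m n)%:R = (gcdz m%:Z n%:Z)%:~R :> rat by [].
by rewrite -E intrD !intrM; apply: dvqD; apply: dvqMz.
Qed.

(** Two nontrivial terms thus already add up to 1, so a sum below 1 has at most one. *)
Lemma one_sub_inv_ge (k : int) : 1 <= k -> k != 1 -> 2^-1 <= 1 - 1 / k%:~R :> rat.
Proof.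
move=> k1 kn1; have k2 : 2 <= k by move: k1 kn1; lia.
have k2r : 2 <= k%:~R :> rat by rewrite (ler_int _ 2).
have : k%:~R^-1 <= 2^-1 :> rat by rewrite lef_pV2 ?posrE // (lt_le_trans _ k2r).
rewrite div1r; lra.
Qed.

Lemma one_sub_inv_ge0 (k : int) : 1 <= k -> 0 <= 1 - 1 / k%:~R :> rat.
Proof.
move=> k1; have [->|/(one_sub_inv_ge k1)] := eqVneq k 1;
  first by rewrite divr1 subrr.
exact: le_trans.
Qed.

(* At most one of the numbers [n_i = N / val i] can differ from 1, and then
   [val i] divides everything. *)
Lemma gcd_of_quotients (I : finType) (S : {set I}) (val : I -> rat) (N g : rat)
    (n : I -> int) :
  0 < N -> (forall i, i \in S -> 1 <= n i /\ val i = N / (n i)%:~R) ->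
  \sum_(i in S) (1 - 1 / (n i)%:~R) < 1 :> rat ->
  0 < g -> dvq g N -> (forall i, i \in S -> dvq g (val i)) ->
  (forall t, dvq t N -> (forall i, i \in S -> dvq t (val i)) -> dvq t g) ->
  g = N * (1 - \sum_(i in S) (1 - 1 / (n i)%:~R)).
Proof.
move=> N0 nS lt1 g0 gN gval great.
have [/existsP[i /andP[iS ni]]|/existsPn all1] := boolP [exists i,
  (i \in S) && (n i != 1)].
  have [ni1 vi] := nS i iS.
  have ni0 : (n i)%:~R != 0 :> rat by rewrite intr_eq0; move: ni1;
    case: (n i) => // -[].
  have v0 : 0 < val i by rewrite vi divr_gt0 // ltr0z (lt_le_trans _ ni1).
  have others j : j \in S -> j != i -> n j = 1.
    move=> jS ji; apply/eqP; apply: contraTT lt1 => nj; rewrite -leNgt.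
    rewrite (bigD1 i) //= (bigD1 j) /=; last by rewrite jS.
    have hi := one_sub_inv_ge ni1 ni; have hj := one_sub_inv_ge (nS j jS).1 nj.
    have rest : 0 <= \sum_(h in S | (h != i) && (h != j)) (1 - 1 / (n h)%:~R)
      :> rat.
      by apply: sumr_ge0 => h /andP[/nS[h1 _] _]; apply: one_sub_inv_ge0.
    under eq_bigl => h do rewrite -andbA.
    lra.
  rewrite (bigD1 i) //= big1 => [|j /andP[jS ji]];
    last by rewrite others // divr1 subrr.
  rewrite addr0 opprB addrCA subrr addr0 mulrA mulr1 -vi.
  apply: dvq_anti => //; first exact: gval.
  have vN : dvq (val i) N by exists (n i); rewrite vi mulrC divfK.
  apply: great => // j jS; have [->|ji] := eqVneq j i; first exact: dvq_refl.
  by have [_ ->] := nS j jS; rewrite others // divr1.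
have n1 i : i \in S -> n i = 1.
  by move=> iS; have := all1 i; rewrite iS negbK => /eqP.
rewrite big1 => [|j jS]; last by rewrite n1 // divr1 subrr.
rewrite subr0 mulr1; apply: dvq_anti => //; apply: great; first exact: dvq_refl.
by move=> i iS; have [_ ->] := nS i iS; rewrite n1 // divr1; apply: dvq_refl.
Qed.

End RationalDivisibility.

(** * Minimally complete Newton trees *)

Section Newton.
Variable T : decorated_tree.
Hypothesis hN : newton_tree T.
Hypothesis hmc : minimally_complete T.
Implicit Types (u v w x y z : cell T).

Definition child u y : bool := adj u y && (root T \in branch y u).

Lemma child_adj u y : child u y -> adj u y.
Proof. by case/andP. Qed.

Lemma adj_child u y : adj u y -> child u y = ~~ child y u.
Proof. by move=> uy; rewrite /child uy adj_sym uy /= branchC. Qed.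

Lemma child_parent u u' y : child u y -> child u' y -> u = u'.
Proof. by move=> /andP[_ /toward_branch <-] /andP[_ /toward_branch]. Qed.

Lemma child_next u y y' : child u y -> adj y y' -> y' != u -> child y y'.
Proof.
move=> cu yy' y'u; rewrite adj_child //; apply: contraNN y'u => cy.
by rewrite (child_parent cu cy).
Qed.

Lemma child_not_root u y : child u y -> y != root T.
Proof. by move=> /andP[_ /branch_neq]; rewrite eq_sym. Qed.

Lemma adj_tlt u y : adj u y -> tlt u y = child u y.
Proof.
move=> uy; rewrite /tlt /child uy (adj_neq uy) /= branchC // branchE // negbK.
by rewrite mem_gamma_sym.
Qed.

Lemma tlt_child v x : tlt v x -> child v (toward x v).
Proof.
move=> /andP[vx vg]; have va := toward_adj vx; rewrite /child va branchC //.
have xb : x \in branch v (toward x v) by apply: mem_branch; rewrite eq_sym.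
apply/negP => rb; have := branch_convex va rb xb vg.
by rewrite inE eqxx.
Qed.

Lemma mem_Eplus v y : adj v y -> ([set v; y] \in Eplus v) = child v y.
Proof.
move=> vy; rewrite inE -/(adj v y) vy; apply/existsP/idP => [[x]|cy].
  by rewrite set2_eq_adj // -adj_tlt // => /andP[+ /eqP ->].
by exists y; rewrite adj_tlt // cy eqxx.
Qed.

Lemma mem_vertices v : (v \in vertices T) = (v \notin arrows T).
Proof. by rewrite inE. Qed.

Lemma vertex_arrows1 v : v \in vertices T -> v \notin arrows1 T.
Proof. by rewrite mem_vertices; apply: contra; rewrite in_setD => /andP[]. Qed.

Lemma arrow0_arrow x : x \in arrows0 T -> x \in arrows T.
Proof. by apply/subsetP/arrows0_sub. Qed.

Lemma arrow1_arrow x : x \in arrows1 T -> x \in arrows T.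
Proof. by rewrite inE => /andP[]. Qed.

Lemma arrow_nbs x u u' : x \in arrows T -> adj x u -> adj x u' -> u = u'.
Proof.
rewrite !inE valencyE => /andP[_ /cards1P[w wE]].
by rewrite -!mem_nbs wE !inE => /eqP -> /eqP.
Qed.

Lemma arrow_child x u : x \in arrows T -> adj x u -> child u x.
Proof.
move=> xa xu; rewrite /child adj_sym xu /=.
have xr : x != root T by move: xa; rewrite !inE => /andP[].
rewrite -(arrow_nbs xa (toward_adj xr) xu); apply: mem_branch.
by rewrite eq_sym.
Qed.

Lemma child_vertex u y : child u y -> u \in vertices T.
Proof.
move=> cu; rewrite mem_vertices; apply/negP => ua.
have := arrow_child ua (child_adj cu); have := cu.
by rewrite adj_child 1?(child_adj cu) // => /negP.
Qed.

Lemma arrow_branch u y x : adj u y -> y \in arrows T -> x \in branch u y -> x = y.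
Proof.
move=> uy ya xb; apply/eqP; apply: contraT => xy.
have [yt tu _] := branch_next uy xb xy.
by rewrite (arrow_nbs ya yt (u' := u)) ?eqxx // adj_sym in tu.
Qed.

Lemma qn_child_ge1 u y : child u y -> 1 <= qn u y.
Proof.
move=> cu; apply: (newton_Eplus_ge1 hN) (child_vertex cu) _.
by rewrite mem_Eplus // child_adj.
Qed.

Lemma arrow1_above v : v \in vertices T ->
  exists2 y, child v y & exists2 a, a \in arrows1 T & a \in branch v y.
Proof.
move=> vV; have [a a1 va] := newton_above hN vV.
exists (toward a v); first exact: tlt_child.
by exists a => //; apply: mem_branch; case/andP: va; rewrite eq_sym.
Qed.

Lemma above_not_arrow0 v y a : adj v y -> a \in arrows1 T -> a \in branch v y ->
  y \notin arrows0 T.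
Proof.
move=> vy a1 ab; apply/negP => y0.
have ay := arrow_branch vy (arrow0_arrow y0) ab.
by move: a1; rewrite ay inE y0.
Qed.

(** Decorations pointing away from the root are at least 1, and above each vertex lies a (1)-arrow,
    so one term of the recursion is at least 1 and none is negative. The Boolean bound lets
    (0)-arrows, of mass 0, take part in the same induction. *)
Lemma mass_child u y : child u y -> (y \notin arrows0 T)%:R <= mass u y.
Proof.
move=> cu; have uy := child_adj cu; move: u y uy cu.
apply: branch_ind => u y uy IH cu.
have [yV|] := boolP (y \in vertices T); last first.
  by rewrite mem_vertices negbK => ya; rewrite mass_arrow // in_setD ya andbT.
have IHc j : j \in nbs y :\ u -> child y j /\ (j \notin arrows0 T)%:R <= mass y j.
  rewrite !inE => /andP[ju yj]; have cj := child_next cu yj ju.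
  by split=> //; apply: IH.
have prod_ge1 (S : {set cell T}) : S \subset nbs y :\ u ->
    1 <= \prod_(h in S) qn y h.
  move=> /subsetP SS; elim/big_ind: _ => // [a b a1 b1|h /SS /IHc[cy _]];
    last exact: qn_child_ge1.
  by rewrite -[1]mulr1 ler_pM.
rewrite mass_rec ?vertex_arrows1 //.
have [j cj [a a1 ab]] := arrow1_above yV.
have jn : j \in nbs y :\ u.
  rewrite !inE (child_adj cj) andbT; apply: contraL cj => /eqP ->.
  by rewrite adj_child 1?adj_sym // negbK.
have c1 h : 1 <= cof2 u y h by apply: prod_ge1; apply: subD1set.
rewrite (bigD1 j) //=.
have [_ mj] := IHc _ jn; rewrite (above_not_arrow0 (child_adj cj) a1 ab) in mj.
apply: (@le_trans _ _ (1 + 0)); first by rewrite addr0; case: (y \notin _).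
apply: lerD; first by rewrite -[1]mulr1 ler_pM.
apply: sumr_ge0 => h /andP[/IHc[_ mh] _]; apply: mulr_ge0.
  exact: le_trans (c1 h).
by apply: le_trans mh; rewrite ler0n.
Qed.

Lemma mass_child_ge0 u y : child u y -> 0 <= mass u y.
Proof. by move=> /mass_child; apply: le_trans; rewrite ler0n. Qed.

Lemma mass_child_gt0 u y : child u y -> y \notin arrows0 T -> 1 <= mass u y.
Proof. by move=> /mass_child + y0; rewrite y0. Qed.

Lemma prod_child_ge1 u (S : {set cell T}) : (forall h, h \in S -> child u h) ->
  1 <= \prod_(h in S) qn u h.
Proof.
move=> SS; elim/big_ind: _ => // [a b a1 b1|h /SS ch]; last exact: qn_child_ge1.
by rewrite -[1]mulr1 ler_pM.
Qed.

Lemma cof_parent_ge1 u y : child u y -> 1 <= cof y u.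
Proof.
move=> cu; apply: prod_child_ge1 => h; rewrite !inE => /andP[hu yh].
exact: child_next cu yh hu.
Qed.

Lemma vertex_dicriticalVcalN v : v \in vertices T ->
  (v \in dicritical T) = (v \notin calN T).
Proof.
move=> vV; rewrite [LHS]in_set [_ \in calN T]in_set vV /=.
by rewrite lt0r (mincomp_ge0 hmc) // andbT negbK.
Qed.

Lemma edge_subset u y : u \in vertices T -> y \in vertices T ->
  [set u; y] \subset vertices T.
Proof. by move=> uV yV; apply/subsetP => x;
  rewrite in_set2 => /orP[] /eqP ->. Qed.

Lemma det_lt0 u y : adj u y -> u \in vertices T -> y \in vertices T ->
  edge_det [set u; y] < 0.
Proof. by move=> uy uV yV; apply: (newton_det hN) => //; exact: edge_subset. Qed.

Lemma calN_vertex v : v \in calN T -> v \in vertices T.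
Proof. by rewrite inE => /andP[]. Qed.

Lemma calN_Nmult v : v \in calN T -> 0 < Nmult v.
Proof. by rewrite inE => /andP[]. Qed.

Lemma dic_vertex v : v \in dicritical T -> v \in vertices T.
Proof. by rewrite inE => /andP[]. Qed.

Lemma dic_Nmult v : v \in dicritical T -> Nmult v = 0.
Proof. by rewrite inE => /andP[_ /eqP]. Qed.

Lemma vertex_not_arrow0 v : v \in vertices T -> v \notin arrows0 T.
Proof. by rewrite mem_vertices; apply: contra; apply: arrow0_arrow. Qed.

(** If [Nmult u] were 0, [Nmult_det] would equate the nonnegative [qn u y * Nmult y] with a positive
    mass times a negative determinant. *)
Lemma child_calN u y : child u y -> y \in vertices T -> u \in calN T.
Proof.
move=> cu yV; have uV := child_vertex cu; rewrite inE uV.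
have uy := child_adj cu.
have E := Nmult_det uy (vertex_arrows1 uV) (vertex_arrows1 yV).
have m1 := mass_child_gt0 cu (vertex_not_arrow0 yV).
have d0 := det_lt0 uy uV yV; have q1 := qn_child_ge1 cu.
have c1 := cof_parent_ge1 cu; have Ny := mincomp_ge0 hmc yV.
have Nu := mincomp_ge0 hmc uV.
rewrite lt0r Nu andbT; apply: contraTneq isT => Nu0; move: E;
  rewrite Nu0 mulr0 subr0.
have : 0 <= qn u y * Nmult y by rewrite mulr_ge0 // (le_trans ler01).
by move=> + E; rewrite E leNgt nmulr_llt0 // (lt_le_trans ltr01).
Qed.

Lemma dic_child u y : u \in dicritical T -> child u y -> y \in arrows T.
Proof.
move=> ud cu; apply: contraT; rewrite -mem_vertices => yV.
by have := child_calN cu yV; rewrite inE dic_Nmult // ltxx andbF.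
Qed.

Lemma arrow1_dic a v : a \in arrows1 T -> adj a v -> v \in dicritical T.
Proof.
move=> a1 av; have [w wd aw] := mincomp_arrow hmc a1.
by rewrite (arrow_nbs (arrow1_arrow a1) av aw).
Qed.

Lemma calN_nbs v y : v \in calN T -> adj v y ->
  [\/ y \in calN T, (y \in dicritical T) && child v y | (y \in arrows0 T) &&
    child v y].
Proof.
move=> vN vy; have [cy|] := boolP (child v y); last first.
  rewrite adj_child // negbK => cv; apply: Or31.
  exact: child_calN cv (calN_vertex vN).
have [yV|] := boolP (y \in vertices T).
  have [|] := boolP (y \in calN T); first by move=> ?; apply: Or31.
  by rewrite -vertex_dicriticalVcalN // => yd; apply: Or32; rewrite yd.
rewrite mem_vertices negbK => ya; have [_|y0] := boolP (y \in arrows0 T);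
  first exact: Or33.
have : v \in dicritical T by apply: (@arrow1_dic y);
  rewrite 1?adj_sym // in_setD y0.
by rewrite vertex_dicriticalVcalN ?vN // calN_vertex.
Qed.

Lemma dic_nb u v : u \in dicritical T -> adj u v -> v \in vertices T -> child v u.
Proof.
move=> ud uv vV; rewrite adj_child 1?adj_sym //; apply/negP => /(dic_child ud).
by apply/negP; rewrite -mem_vertices.
Qed.

Lemma dead_endE v e : v \in vertices T -> e \in dead_ends_at v ->
  exists2 x, x \in arrows0 T & adj v x /\ e = [set v; x].
Proof.
move=> vV; rewrite !inE => /andP[/andP[eT /existsP[x /andP[x0 xe]]] /andP[_ ve]].
have := edges_card2 eT => /eqP/cards2P[a [b [ab eE]]].
have vx : v != x by apply: contraNneq (vertex_not_arrow0 vV) => ->.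
have eE' : e = [set v; x].
  move: ve xe; rewrite eE !in_set2 => /orP[] /eqP va /orP[] /eqP xb; subst.
  - by rewrite eqxx in vx.
  - by [].
  - by rewrite setUC.
  - by rewrite eqxx in vx.
by exists x => //; rewrite /adj -eE'.
Qed.

Lemma mem_dead_end v x : x \in arrows0 T -> adj v x -> [set v;
  x] \in dead_ends_at v.
Proof.
move=> x0 vx; rewrite !inE -/(adj v x) vx eqxx /= andbT.
by apply/existsP; exists x; rewrite x0 !inE eqxx orbT.
Qed.

Lemma dead_end_unique v x x' : v \in vertices T -> x \in arrows0 T -> adj v x ->
  x' \in arrows0 T -> adj v x' -> x' = x.
Proof.
move=> vV x0 vx x0' vx'.
have := newton_dead_end hN vV => /card_le1_eqP/(_ _ _ (mem_dead_end x0' vx')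
  (mem_dead_end x0 vx)).
by move/eqP; rewrite set2_eq_adj // => /eqP.
Qed.

Lemma adec_dead_end v x : v \in vertices T -> x \in arrows0 T -> adj v x ->
  adec v = qn v x.
Proof.
move=> vV x0 vx; rewrite /adec; case: pickP => [e|/(_ [set v; x])].
  move/(dead_endE vV) => [x' x0' [vx' ->]].
  by rewrite (dead_end_unique vV x0 vx x0' vx').
by rewrite mem_dead_end.
Qed.

Lemma adec_no_dead_end v : v \in vertices T ->
  (forall x, x \in arrows0 T -> ~~ adj v x) -> adec v = 1.
Proof.
move=> vV H; rewrite /adec; case: pickP => // e /(dead_endE vV)[x x0 [vx _]].
by have := H _ x0; rewrite vx.
Qed.

Lemma dead_end_dec v : (exists2 x, x \in arrows0 T & adj v x) \/
  (forall x, x \in arrows0 T -> ~~ adj v x).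
Proof.
have [/exists_inP|] := boolP [exists x in arrows0 T, adj v x]; first by left.
by rewrite negb_exists_in => /forall_inP; right.
Qed.

Lemma dead_end_child v x : x \in arrows0 T -> adj v x -> child v x.
Proof. by move=> x0 vx; apply: arrow_child;
  rewrite 1?adj_sym // arrow0_arrow. Qed.

Lemma adec_ge1 v : v \in vertices T -> 1 <= adec v.
Proof.
move=> vV; have [[x x0 vx]|/adec_no_dead_end -> //] := dead_end_dec v.
by rewrite (adec_dead_end vV x0 vx) qn_child_ge1 // dead_end_child.
Qed.

Lemma child_qn1 v y y' : child v y -> child v y' -> y' != y ->
  qn v y <= qn v y' ->
  qn v y = 1.
Proof.
move=> cy cy' ny le; apply/eqP; rewrite eq_le qn_child_ge1 // andbT leNgt.
apply/negP => gt1; have := newton_Eplus_gt1 hN (child_vertex cy).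
move/card_le1_eqP/(_ [set v; y'] [set v; y]); rewrite !in_set.
have := mem_Eplus (child_adj cy); have := mem_Eplus (child_adj cy').
rewrite !in_set => -> ->; rewrite cy cy' -!/(qn _ _) gt1 (lt_le_trans gt1 le).
move=> /(_ isT isT)/eqP; rewrite set2_eq_adj ?child_adj // => /eqP E.
by rewrite E eqxx in ny.
Qed.

(** The dead end carries the largest decoration, and at most one decoration exceeds 1. *)
Lemma dead_end_qn1 v x y : x \in arrows0 T -> adj v x -> child v y -> y != x ->
  qn v y = 1.
Proof.
move=> x0 vx cy yx; apply: (child_qn1 cy (dead_end_child x0 vx)).
  by rewrite eq_sym.
have [_] := newton_dead_end_max hN (child_vertex cy) (mem_dead_end x0 vx).
by apply; rewrite mem_Eplus // child_adj.
Qed.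

(** * Masses around a dicritical vertex *)

Lemma dic_dead_end u : u \in dicritical T -> exists2 x, x \in arrows0 T & adj u x.
Proof.
move=> ud; have [e /(dead_endE (dic_vertex ud))[x x0 [ux _]]] :=
  mincomp_dicritical hmc ud.
by exists x.
Qed.

Lemma dic_cof v u : child v u -> u \in dicritical T -> cof u v = adec u.
Proof.
move=> cv ud; have [x x0 ux] := dic_dead_end ud; have uV := dic_vertex ud.
have cx := dead_end_child x0 ux.
have xv : x != v.
  by apply: contraTneq cx => ->; rewrite adj_child 1?adj_sym ?child_adj // negbK.
rewrite /cof (bigD1 x) /=; last by rewrite !inE xv.
rewrite big1 ?mulr1 -?adec_dead_end // => h;
  rewrite !inE => /andP[/andP[hv uh] hx].
by apply: dead_end_qn1 x0 ux _ hx; apply: child_next cv uh hv.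
Qed.

(** All children of [u] are arrows. A (0)-arrow has mass 0, and each (1)-arrow has mass 1 with
    cofactor [adec u], coming from the dead end. *)
Lemma dic_mass v u : child v u -> u \in dicritical T ->
  mass v u = adec u * (degree u)%:Z.
Proof.
move=> cv ud; have [x x0 ux] := dic_dead_end ud; have uV := dic_vertex ud.
have cx := dead_end_child x0 ux; have vV := child_vertex cv.
rewrite mass_rec ?vertex_arrows1 ?child_adj // /degree -sum1_card -natz.
rewrite natr_sum /= big_distrr /= [LHS](bigID (mem (arrows1 T))) /=.
rewrite addrC big1 ?add0r.
  apply: eq_big => j.
    rewrite in_set in_setD1 mem_nbs; have [j1|] := boolP (j \in arrows1 T);
      rewrite ?andbF //.
    rewrite andbT andTb; have [E|//] := eqVneq j v.
    by rewrite E (negPf (vertex_arrows1 vV)) in j1.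
  move=> /andP[]; rewrite !in_setD1 mem_nbs => /andP[jv uj] j1.
  rewrite mass_arrow // ?arrow1_arrow // j1; congr (_ * _).
  rewrite -(dic_cof cv ud) /cof [RHS](bigD1 j) ?inE ?jv //=.
  rewrite (@dead_end_qn1 u x j) ?mul1r //.
  - by apply: eq_bigl => h; rewrite !inE andbC.
  - exact: child_next cv uj jv.
  - by apply: contraTneq x0 => <-; move: j1; rewrite inE => /andP[].
move=> j /andP[]; rewrite !in_setD1 mem_nbs => /andP[jv uj] j1.
have ja := dic_child ud (child_next cv uj jv).
by rewrite mass_arrow // (negPf j1) mulr0.
Qed.

(** Solved from [Nmult u = 0], where the common factor [adec u] cancels. *)
Lemma dic_mass_parent v u : child v u -> u \in dicritical T ->
  mass u v = - (qn u v * (degree u)%:Z).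
Proof.
move=> cv ud; have uV := dic_vertex ud; have uv := child_adj cv;
  rewrite adj_sym in uv.
have := Nmult_edge uv (vertex_arrows1 uV).
rewrite dic_Nmult // (dic_cof cv ud) (dic_mass cv ud).
have a0 : adec u != 0 by rewrite gt_eqF // (lt_le_trans ltr01) ?adec_ge1.
move=> E; apply: (mulfI a0); apply/eqP; rewrite -subr_eq0; apply/eqP.
by rewrite [RHS]E; ring.
Qed.

Lemma kdicE v u : child v u -> u \in dicritical T ->
  kdic u = - edge_det [set v; u].
Proof.
move=> cv ud; rewrite /kdic; case: pickP => [w /andP[wV uw]|/(_ v)].
  by rewrite (child_parent cv (dic_nb ud uw wV)) setUC.
by rewrite (child_vertex cv) adj_sym child_adj.
Qed.

Lemma kdic_ge1 v u : child v u -> u \in dicritical T -> 1 <= kdic u.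
Proof.
move=> cv ud; rewrite (kdicE cv ud) -gtz0_ge1 oppr_gt0.
by rewrite det_lt0 ?child_adj ?(child_vertex cv) ?dic_vertex.
Qed.

(** Once the two masses are inserted, the splitting of [Nmult v] along the edge becomes [degree u]
    times the negative of its determinant. *)
Lemma Nmult_kdic v u : child v u -> u \in dicritical T ->
  Nmult v = kdic u * (degree u)%:Z.
Proof.
move=> cv ud; have uv := child_adj cv; rewrite (kdicE cv ud) edge_detE //.
rewrite (Nmult_edge uv) ?vertex_arrows1 ?(child_vertex cv) //.
by rewrite (dic_mass cv ud) (dic_mass_parent cv ud) (dic_cof cv ud); ring.
Qed.

Lemma mem_dicriticals_at v u : v \in calN T ->
  (u \in dicriticals_at v) = (u \in dicritical T) && child v u.
Proof.
move=> vN; rewrite inE; case: (boolP (u \in dicritical T)) => // ud /=.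
apply/idP/idP => [vu|]; last exact: child_adj.
by apply: dic_nb; rewrite // 1?adj_sym // calN_vertex.
Qed.

(** * Characteristic numbers *)

Lemma prod_dead_end y (S : {set cell T}) : y \in vertices T -> S \subset nbs y ->
  (forall x, x \in arrows0 T -> adj y x -> x \in S) ->
  \prod_(h in S) qn y h = adec y * \prod_(h in S :\: arrows0 T) qn y h.
Proof.
move=> yV /subsetP Sn S0; have [[x x0 yx]|no] := dead_end_dec y.
  rewrite (bigD1 x) ?S0 //= -adec_dead_end //; congr (_ * _).
  apply: eq_bigl => h; rewrite !inE andbC; case hS: (h \in S);
    rewrite ?andbF //= !andbT.
  have yh : adj y h by rewrite -mem_nbs Sn.
  apply/idP/idP; apply: contraNN; last by move=> /eqP ->.
  by move=> h0; rewrite (dead_end_unique yV x0 yx h0).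
rewrite adec_no_dead_end // mul1r; apply: eq_bigl => h; rewrite !inE.
case hS: (h \in S); rewrite ?andbF ?andbT //; apply/esym.
by apply: contraL (Sn _ hS) => /no; rewrite mem_nbs.
Qed.

Lemma calN_arrow0 v y : v \in calN T -> adj v y -> y \notin arrows0 T ->
  y \in calN T \/ (y \in dicritical T /\ child v y).
Proof.
by move=> vN /(calN_nbs vN)[|/andP[]|/andP[->]] //; [left|right].
Qed.

Lemma dvdn_degree v x : x \in dicriticals_at v ->
  (\big[gcdn/0%N]_(u in dicriticals_at v) degree u %| degree x)%N.
Proof. by move=> xD; rewrite (bigD1 x) //= dvdn_gcdl. Qed.

Lemma node_set v : v \in calN T -> node v = (dicriticals_at v != set0).
Proof. by rewrite /node => ->. Qed.

Lemma dnum_degree v x : v \in calN T -> x \in dicriticals_at v ->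
  dvq (dnum v)%:~R (degree x)%:R.
Proof.
move=> vN xD; rewrite /dnum node_set //.
have -> : dicriticals_at v != set0 by apply/set0Pn; exists x.
by apply: dvq_nat; exact: dvdn_degree.
Qed.

Lemma dvq_degree_Nmult v x : v \in calN T -> x \in dicriticals_at v ->
  dvq (degree x)%:R (Nmult v)%:~R.
Proof.
move=> vN; rewrite mem_dicriticals_at // => /andP[xd cx].
by exists (kdic x); rewrite (Nmult_kdic cx xd) intrM.
Qed.

Lemma dnum_Nmult v : v \in calN T -> dvq (dnum v)%:~R (Nmult v)%:~R.
Proof.
move=> vN; have [/set0Pn[x xD]|D0] := boolP (dicriticals_at v != set0).
  exact: dvq_trans (dnum_degree vN xD) (dvq_degree_Nmult vN xD).
by rewrite /dnum node_set // (negPf D0); exact: dvq_refl.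
Qed.

(** Whether or not [v] is a node, [dnum v] is the gcd of [Nmult v] and the degrees of the adjacent
    dicriticals, because these degrees divide [Nmult v]. This removes the case distinction from what
    follows. *)
Lemma dnum_great v t : v \in calN T -> dvq t (Nmult v)%:~R ->
  (forall x, x \in dicriticals_at v -> dvq t (degree x)%:R) -> dvq t (dnum v)%:~R.
Proof.
move=> vN tN tD; rewrite /dnum; case: ifP => // _.
have -> (n : nat) : (n%:Z)%:~R = n%:R :> rat by [].
elim/big_ind: _ => //; [exact: dvq0|exact: dvq_gcdn].
Qed.

Lemma dnum_gt0 v : v \in calN T -> 0 < dnum v.
Proof.
move=> vN; have d0 : 0 <= dnum v by rewrite /dnum; case: ifP => // _;
  apply/ltW/calN_Nmult.
rewrite lt0r d0 andbT; apply/negP => /eqP E; have [k] := dnum_Nmult vN.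
rewrite E mulr0 => /eqP; rewrite intr_eq0 => /eqP N0.
by have := calN_Nmult vN; rewrite N0.
Qed.

Notation chr u y := (char_num u [set u; y]).

Lemma edgeN u y : u \in calN T -> y \in calN T -> adj u y -> [set u;
  y] \in edgesN T.
Proof.
move=> uN yN uy; rewrite inE -/(adj u y) uy /=.
by apply/subsetP => x; rewrite in_set2 => /orP[] /eqP ->.
Qed.

Definition nbsN v : {set cell T} := [set x in calN T | adj v x].

Lemma mem_nbsN v x : (x \in nbsN v) = (x \in calN T) && adj v x.
Proof. by rewrite inE. Qed.

Lemma epsNE v : epsN v = #|nbsN v|.
Proof. by []. Qed.

(** The case where epsilon is 1 is absorbed: no other neighbour remains, and the gcd of the single
    positive number [dnum y] is that number. *)
Lemma adec_chr u y : y \in calN T -> u \in calN T -> adj u y ->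
  (adec y)%:~R * chr u y =
  gcdq_seq ((dnum y)%:~R :: [seq chr y y' | y' <- enum (nbsN y :\ u)]).
Proof.
move=> yN uN uy; have a1 := adec_ge1 (calN_vertex yN).
rewrite char_numE // mulrCA divff ?mulr1; last first.
  by rewrite intr_eq0 gt_eqF // (lt_le_trans ltr01).
have -> : [set y' in calN T | adj y y' & y' != u] = nbsN y :\ u.
  by apply/setP => h; rewrite !inE andbA andbC.
case: ifP => // /eqP e1.
have -> : nbsN y :\ u = set0.
  apply/eqP; rewrite -cards_eq0; move: e1; rewrite epsNE (cardsD1 u).
  by rewrite mem_nbsN uN adj_sym uy => /eqP; rewrite eqSS.
rewrite enum_set0 /= -[LHS]/((dnum y)%:~R).
have d0 : 0 < (dnum y)%:~R :> rat by rewrite ltr0z dnum_gt0.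
have mem : (dnum y)%:~R \in [:: (dnum y)%:~R : rat] by rewrite mem_head.
apply: dvq_anti => //.
- exact: (gcdq_seq_gt0 mem (lt0r_neq0 d0)).
- by apply: (@dvq_gcdq_seq [:: _]) => t; rewrite inE => /eqP ->; apply: dvq_refl.
- exact: gcdq_seq_dvq mem.
Qed.

Section CharNum.
Variables u y : cell T.
Hypotheses (uN : u \in calN T) (yN : y \in calN T) (uy : adj u y).
Let g := (adec y)%:~R * chr u y.

Lemma adec_chr_gt0 : 0 < g.
Proof.
rewrite /g adec_chr //; apply: gcdq_seq_gt0 (mem_head _ _) _.
by rewrite intr_eq0 gt_eqF // dnum_gt0.
Qed.

Lemma adecr_ge1 : 1 <= (adec y)%:~R :> rat.
Proof. by rewrite ler1z adec_ge1 // calN_vertex. Qed.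

Lemma chr_gt0 : 0 < chr u y.
Proof. by have := adec_chr_gt0; rewrite pmulr_rgt0 //
  (lt_le_trans ltr01) ?adecr_ge1. Qed.

Lemma chr_dvq_adec : dvq (chr u y) g.
Proof. by exists (adec y). Qed.

Lemma adec_chr_dnum : dvq g (dnum y)%:~R.
Proof. by rewrite /g adec_chr //; apply: gcdq_seq_dvq; apply: mem_head. Qed.

Lemma adec_chr_Nmult : dvq g (Nmult y)%:~R.
Proof. exact: dvq_trans adec_chr_dnum (dnum_Nmult yN). Qed.

Lemma adec_chr_degree x : x \in dicriticals_at y -> dvq g (degree x)%:R.
Proof. by move=> xD; exact: dvq_trans adec_chr_dnum (dnum_degree yN xD). Qed.

Lemma adec_chr_chr y' : y' \in nbsN y -> y' != u -> dvq g (chr y y').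
Proof.
move=> y'n y'u; rewrite /g adec_chr //; apply: gcdq_seq_dvq.
by rewrite in_cons; apply/orP; right; apply/mapP; exists y';
  rewrite // mem_enum in_setD1 y'u.
Qed.

Lemma adec_chr_great t : dvq t (Nmult y)%:~R ->
  (forall x, x \in dicriticals_at y -> dvq t (degree x)%:R) ->
  (forall y', y' \in nbsN y :\ u -> dvq t (chr y y')) -> dvq t g.
Proof.
move=> tN tD tc; rewrite /g adec_chr //; apply: dvq_gcdq_seq => x.
rewrite inE => /predU1P[->|/mapP[y']]; first exact: dnum_great.
by rewrite mem_enum => /tc ? ->.
Qed.

End CharNum.

(** The gcd [g] divides both masses across every other edge at [y] that is not a dead end, by
    induction or by the formulas for dicriticals. Going out, [mass u y] is a combination of these;
    coming back, [mass y u] has to be recovered from its multiples inside the various [mass j y],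
    which needs the coprimality of the decorations. *)
Lemma chr_dvq_mass u y : adj u y -> u \in calN T -> y \in calN T ->
  dvq (chr u y) (mass u y)%:~R /\ dvq (chr u y) (mass y u)%:~R.
Proof.
move: u y; apply: branch_ind => u y uy IH uN yN.
set g := (adec y)%:~R * chr u y.
have yV := calN_vertex yN; have uV := calN_vertex uN.
have gmass j : j \in nbs y :\ u -> dvq g (mass y j)%:~R.
  rewrite !inE => /andP[ju yj].
  have [j0|j0] := boolP (j \in arrows0 T).
    by rewrite mass_arrow ?arrow0_arrow // in_setD j0 /=; exact: dvq0.
  have [jN|[jd cj]] := calN_arrow0 yN yj j0.
    have [m1 _] := IH j yj ju yN jN; apply: dvq_trans m1.
    by apply: adec_chr_chr; rewrite ?mem_nbsN ?jN.
  rewrite (dic_mass cj jd) intrM; apply: dvqMz.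
  by apply: adec_chr_degree; rewrite // mem_dicriticals_at // jd.
have gmass' j : j \in nbs y :\ u -> j \notin arrows0 T -> dvq g (mass j y)%:~R.
  rewrite !inE => /andP[ju yj] j0.
  have [jN|[jd cj]] := calN_arrow0 yN yj j0.
    have [_ m1] := IH j yj ju yN jN; apply: dvq_trans m1.
    by apply: adec_chr_chr; rewrite ?mem_nbsN ?jN.
  rewrite (dic_mass_parent cj jd) mulrNz intrM; apply: dvqN; apply: dvqMz.
  by apply: adec_chr_degree; rewrite // mem_dicriticals_at // jd.
have gchr := chr_dvq_adec u y; rewrite -/g in gchr.
have yu : adj y u by rewrite adj_sym.
have uy1 : dvq g (mass u y)%:~R.
  rewrite mass_rec ?vertex_arrows1 // rmorph_sum /=.
  by apply: dvq_sum => j jn; rewrite intrM; apply: dvqMz; exact: gmass.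
split; first exact: dvq_trans gchr uy1.
have a0 : (adec y)%:~R != 0 :> rat.
  by rewrite intr_eq0 gt_eqF // (lt_le_trans ltr01) // adec_ge1.
set J := (nbs y :\ u) :\: arrows0 T.
have in0 x : x \in arrows0 T -> adj y x -> x != u.
  by move=> x0 _; apply: contraTneq x0 => ->; apply: vertex_not_arrow0.
(* If only dead ends remain, there is no [mass j y] to exploit; then [mass u y] vanishes and
   [Nmult y] is [adec y * mass y u]. *)
have [J0|Jn0] := eqVneq J set0.
  have Ny := Nmult_edge yu (vertex_arrows1 yV).
  have muy0 : mass u y = 0.
    rewrite mass_rec ?vertex_arrows1 // big1 // => j jn.
    have j0 : j \in arrows0 T by apply: contraT => j0; have := in_set0 j;
      rewrite -J0 in_setD j0 jn.
    rewrite mass_arrow ?arrow0_arrow // ?in_setD ?j0 ?mulr0 //.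
    by move: jn; rewrite !inE => /andP[].
  have cofE : cof y u = adec y.
    rewrite /cof prod_dead_end // ?subD1set //; last first.
      by move=> x x0 yx; rewrite in_setD1 mem_nbs yx in0.
    by rewrite -/J J0 big_set0 mulr1.
  apply: (dvq_mul2l a0); rewrite -intrM -cofE -[X in dvq _ X%:~R]addr0.
  by rewrite -[0](mulr0 (qn y u)) -muy0 -Ny cofE; exact: adec_chr_Nmult.
apply: (@dvq_cofactors _ J (qn y)) => //.
  move=> i j; rewrite !inE => /andP[_ /andP[_ yi]] /andP[_ /andP[_ yj]] ij.
  by apply: (newton_coprime hN yV);
    rewrite ?set2_eq_adj // !inE -/(adj _ _) ?yi ?yj eqxx.
move=> j; rewrite in_setD => /andP[j0 jn].
have [ju yj] : j != u /\ adj y j by move: jn; rewrite !inE => /andP[].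
(* The term of [u] in [mass j y] contains the decoration of the dead end, since neither [u] nor [j]
   is a (0)-arrow. Cancelling this factor turns divisibility by [g] into divisibility by
   [chr u y]. *)
apply: (dvq_mul2l a0); rewrite -intrM -intrM mulrA.
have -> : adec y * \prod_(h in J :\ j) qn y h = cof2 j y u.
  rewrite /cof2 (@prod_dead_end y (nbs y :\ j :\ u)) //; first 1 last.
  - exact: subset_trans (subD1set _ _) (subD1set _ _).
  - move=> x x0 yx; rewrite !inE yx in0 // andbT /=.
    by apply: contraNneq j0 => <-.
  congr (_ * _); apply: eq_bigl => h; rewrite !inE.
  by case: (h == j); case: (h == u); rewrite ?andbF ?andbT.
have := gmass' j jn j0; rewrite mass_rec 1?adj_sym // ?vertex_arrows1 //.
rewrite (bigD1 u) /=; last by rewrite !inE yu eq_sym ju.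
rewrite rmorphD /= => H.
have -> : (cof2 j y u * mass y u)%:~R = (cof2 j y u * mass y u)%:~R
   + (\sum_(i in nbs y :\ j | i != u) cof2 j y i * mass y i)%:~R
   - (\sum_(i in nbs y :\ j | i != u) cof2 j y i * mass y i)%:~R :> rat by
     rewrite addrK.
apply: dvqD => //; apply: dvqN; rewrite rmorph_sum /=; apply: dvq_sum => i.
rewrite in_setD1 mem_nbs => /andP[/andP[ij yi] iu].
by rewrite intrM; apply: dvqMz; apply: gmass; rewrite in_setD1 iu mem_nbs.
Qed.

Lemma chr_dvq_Nmult u y : adj u y -> u \in calN T -> y \in calN T ->
  dvq (chr u y) (Nmult u)%:~R.
Proof.
move=> uy uN yN; have [m1 m2] := chr_dvq_mass uy uN yN.
rewrite (Nmult_edge uy) ?vertex_arrows1 ?calN_vertex // intrD !intrM.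
by apply: dvqD; apply: dvqMz.
Qed.

Lemma Nmultr_gt0 v : v \in calN T -> 0 < (Nmult v)%:~R :> rat.
Proof. by move=> vN; rewrite ltr0z calN_Nmult. Qed.

Lemma Mnum_int u y : adj u y -> u \in calN T -> y \in calN T ->
  exists2 m : int, 1 <= m &
    Mnum u [set u; y] = m%:~R /\ chr u y = (Nmult u)%:~R / m%:~R.
Proof.
move=> uy uN yN; have c0 := chr_gt0 uN yN uy.
have [_ [m m1 E]] := dvq_gt0 (ltW c0) (Nmultr_gt0 uN) (chr_dvq_Nmult uy uN yN).
have m0 : m%:~R != 0 :> rat by rewrite intr_eq0 gt_eqF // (lt_le_trans ltr01).
exists m => //; rewrite /Mnum E mulfK ?gt_eqF //; split=> //.
by rewrite mulrC mulKf.
Qed.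

(** No (1)-arrow lies beyond the dead end, so its decoration is a factor of every nonzero term of
    [Nmult v]. *)
Lemma adec_dvd_Nmult v : v \in calN T -> exists k : int, Nmult v = adec v * k.
Proof.
move=> vN; have vV := calN_vertex vN; rewrite Nmult_branch ?vertex_arrows1 //.
exists (\sum_(y in nbs v | y \notin arrows0 T)
   \prod_(h in (nbs v :\ y) :\: arrows0 T) qn v h * mass v y).
rewrite big_distrr /= [LHS](bigID (mem (arrows0 T))) /= big1 ?add0r.
  apply: eq_bigr => y /andP[yn y0]; rewrite mulrA /cof prod_dead_end ?subD1set //.
  by move=> x x0 vx; rewrite !inE vx andbT; apply: contraNneq y0 => <-.
move=> y /andP[]; rewrite mem_nbs => vy y0.
by rewrite mass_arrow ?arrow0_arrow // in_setD y0 mulr0.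
Qed.

(** * Estimates for [Delta] and the characteristic numbers *)

Lemma card_nbs_ge2 u y : child u y -> y \in vertices T -> (2 <= #|nbs y :\ u|)%N.
Proof.
move=> cu yV; have yr := child_not_root cu; have uy := child_adj cu.
have := mincomp_valency hmc yV yr; have := yV.
rewrite mem_vertices !inE yr /= valencyE (cardsD1 u) mem_nbs adj_sym uy.
by case: #|_| => [|[|]].
Qed.

(** As [y] has valency neither 1 nor 2, at least two edges lead up from it. At most one is a dead
    end, at most one has decoration above 1, and a dead end has the largest decoration. *)
Lemma exists_child_qn1 u y : child u y -> y \in vertices T ->
  exists2 j, j \in nbs y :\ u & (j \notin arrows0 T) /\ qn y j = 1.
Proof.
move=> cu yV; have uy := child_adj cu; rewrite adj_sym in uy.
have ch j : j \in nbs y :\ u -> child y j.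
  by rewrite !inE => /andP[ju yj]; exact: child_next cu yj ju.
have [i [j [ii jj ij]]] : exists i j, [/\ i \in nbs y :\ u, j \in nbs y :\ u &
  i != j].
  by have /card_gt1P[i [j [? ? ?]]] := card_nbs_ge2 cu yV; exists i, j.
have [i0|i0] := boolP (i \in arrows0 T).
  exists j => //; rewrite (dead_end_qn1 i0) ?child_adj ?ch // 1?eq_sym //;
    split=> //.
  apply: contraNN ij => j0; apply/eqP.
  exact: dead_end_unique yV j0 (child_adj (ch _ jj)) i0 (child_adj (ch _ ii)).
have [j0|j0] := boolP (j \in arrows0 T).
  by exists i => //; rewrite (dead_end_qn1 j0) ?child_adj ?ch.
have [le|/ltW le] := leP (qn y i) (qn y j).
  by exists i => //; split=> //; apply: child_qn1 le; rewrite ?ch // eq_sym.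
by exists j => //; split=> //; apply: child_qn1 le; rewrite ?ch.
Qed.

(** An edge of decoration 1 can be omitted from the cofactor for free, so the corresponding term
    alone yields the bound. *)
Lemma mass_lower u y (t : rat) : child u y -> y \in vertices T ->
  (forall j, j \in nbs y :\ u -> j \notin arrows0 T -> t <= (mass y j)%:~R) ->
  (cof y u)%:~R * t <= (mass u y)%:~R.
Proof.
move=> cu yV H; have [j jn [j0 qj1]] := exists_child_qn1 cu yV.
have ch i : i \in nbs y :\ u -> child y i.
  by rewrite !inE => /andP[iu yi]; exact: child_next cu yi iu.
rewrite mass_rec ?vertex_arrows1 ?child_adj // (bigD1 j) //=.
have -> : cof2 u y j = cof y u.
  rewrite /cof (bigD1 j) //= qj1 mul1r; apply: eq_bigl => h.
  by rewrite !inE andbC.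
rewrite intrD intrM -[leLHS]addr0 lerD //.
  by rewrite ler_wpM2l ?H // ler0z (le_trans ler01) // cof_parent_ge1.
rewrite ler0z; apply: sumr_ge0 => i /andP[/ch ci _];
  rewrite mulr_ge0 ?mass_child_ge0 //.
apply: (le_trans ler01); apply: prod_child_ge1 => h.
by rewrite in_setD1 => /andP[_ /ch].
Qed.

(** By [Nmult_det], [cof y u * Nmult u] exceeds [mass u y], which is at least [cof y u * t]; the
    cofactor cancels and leaves a strict inequality. *)
Lemma Nmult_lower u y (t : rat) : child u y -> y \in calN T ->
  (forall j, j \in nbs y :\ u -> j \notin arrows0 T -> t <= (mass y j)%:~R) ->
  t < (Nmult u)%:~R.
Proof.
move=> cu yN H; have yV := calN_vertex yN; have uV := child_vertex cu.
have low := mass_lower cu yV H; have uy := child_adj cu.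
have E := Nmult_det uy (vertex_arrows1 uV) (vertex_arrows1 yV).
have m1 := mass_child_gt0 cu (vertex_not_arrow0 yV).
have d0 := det_lt0 uy uV yV; have q1 := qn_child_ge1 cu.
have c1 := cof_parent_ge1 cu; have Ny := calN_Nmult yN.
have lt : mass u y < cof y u * Nmult u.
  have : 0 < qn u y * Nmult y by rewrite mulr_gt0 // (lt_le_trans ltr01).
  (* A negative integral determinant is at most -1. *)
  have : mass u y * edge_det [set u; y] <= - mass u y.
    by rewrite -mulrN1 ler_wpM2l ?(le_trans ler01) // -ltzD1 addNr.
  lia.
have c0 : 0 < (cof y u)%:~R :> rat by rewrite ltr0z (lt_le_trans ltr01).
rewrite -(ltr_pM2l c0); apply: le_lt_trans low _.
by rewrite -intrM ltr_int.
Qed.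

Lemma Nmult_child_ge2 u y : child u y -> y \in calN T -> 2 <= Nmult u.
Proof.
move=> cu yN; have : 1 < (Nmult u)%:~R :> rat.
  apply: (Nmult_lower cu yN) => j; rewrite !inE => /andP[ju yj] j0.
  by rewrite ler1z mass_child_gt0 //; exact: child_next cu yj ju.
by rewrite ltr1z; lia.
Qed.

(** [chr u y] divides the positive masses beyond [y], so it bounds them from below and is strictly
    smaller than [Nmult u]. As it divides [Nmult u], the quotient is at least 2. *)
Lemma chr_child_half u y : child u y -> y \in calN T ->
  2 * chr u y <= (Nmult u)%:~R.
Proof.
move=> cu yN; have uy := child_adj cu; have yV := calN_vertex yN.
have uN := child_calN cu yV.
have lt : chr u y < (Nmult u)%:~R.
  apply: (Nmult_lower cu yN) => j; rewrite !inE => /andP[ju yj] j0.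
  have cj := child_next cu yj ju; apply: dvq_le.
  - by rewrite ltW ?chr_gt0.
  - by rewrite ltr0z (lt_le_trans ltr01) // mass_child_gt0.
  apply: dvq_trans (chr_dvq_adec u y) _.
  have [jN|[jd _]] := calN_arrow0 yN yj j0.
    have [m1 _] := chr_dvq_mass yj yN jN; apply: dvq_trans m1.
    by apply: adec_chr_chr; rewrite ?mem_nbsN ?jN.
  rewrite (dic_mass cj jd) intrM; apply: dvqMz.
  by apply: adec_chr_degree; rewrite // mem_dicriticals_at // jd.
have c0 := chr_gt0 uN yN uy.
have [_ [m m1 E]] := dvq_gt0 (ltW c0) (Nmultr_gt0 uN) (chr_dvq_Nmult uy uN yN).
rewrite E ler_pM2r // (ler_int _ 2).
have : m != 1 by apply: contraTneq lt => m1'; rewrite E m1' mul1r ltxx.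
by move: m1; lia.
Qed.

(** * Reading [Delta] and characteristic numbers off [Rnum] *)

Definition R0 v : rat := Rnum v set0.

Lemma R0E v : R0 v = \sum_(x in dicriticals_at v) (1 - 1 / (kdic x)%:~R)
  + (1 - 1 / (adec v)%:~R).
Proof. by rewrite /R0 /Rnum big_set0 addr0. Qed.

Lemma Rnum_set1 v f : Rnum v [set f] = R0 v + (1 - 1 / Mnum v f).
Proof. by rewrite R0E /Rnum big_set1. Qed.

Lemma kdic_at_ge1 v x : v \in calN T -> x \in dicriticals_at v -> 1 <= kdic x.
Proof. by move=> vN; rewrite mem_dicriticals_at // => /andP[xd cx];
  exact: kdic_ge1 cx xd. Qed.

Lemma R0_ge0 v : v \in calN T -> 0 <= R0 v.
Proof.
move=> vN; rewrite R0E addr_ge0 ?one_sub_inv_ge0 ?adec_ge1 ?calN_vertex //.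
by apply: sumr_ge0 => x xD; rewrite one_sub_inv_ge0 // (kdic_at_ge1 vN).
Qed.

Lemma degree_kdic v x : v \in calN T -> x \in dicriticals_at v ->
  (degree x)%:R = (Nmult v)%:~R / (kdic x)%:~R :> rat.
Proof.
move=> vN xD; have k1 := kdic_at_ge1 vN xD; move: xD.
rewrite mem_dicriticals_at // => /andP[xd cx]; rewrite (Nmult_kdic cx xd) intrM.
by rewrite mulrC mulKf // intr_eq0 gt_eqF // (lt_le_trans ltr01).
Qed.

Lemma dicriticals_at_nbsN v x : x \in dicriticals_at v -> x \notin nbsN v.
Proof.
rewrite inE => /andP[xd _]; rewrite mem_nbsN negb_and.
by rewrite -vertex_dicriticalVcalN ?dic_vertex // xd.
Qed.

Lemma rnumE v : v \in calN T -> rnum v = #|dicriticals_at v|%:Z + (epsN v)%:Z - 1.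
Proof.
move=> vN; rewrite /rnum epsNE -PoszD -cardsUI.
have -> : dicriticals_at v :&: nbsN v = set0.
  apply/setP => x; rewrite in_setI in_set0; apply/negbTE/negP => /andP[xD].
  by rewrite (negPf (dicriticals_at_nbsN xD)).
rewrite cards0 addn0; congr (#|pred_of_set _|%:Z - 1); apply/setP => x.
rewrite in_setU mem_nbsN in_set [_ \in dicriticals_at v]in_set.
have [xV|xV] /= := boolP (x \in vertices T).
  by rewrite vertex_dicriticalVcalN //; case: (x \in calN T); rewrite ?orbF.
have /negPf -> : x \notin dicritical T by apply: contraNN xV; exact: dic_vertex.
by have /negPf -> : x \notin calN T by apply: contraNN xV; exact: calN_vertex.
Qed.

(** A dicritical [x] contributes N - 1 through [rnum] and 1 - d through the last sum. Together this
    is N - d, which equals N(1 - 1/k) as N = kd. *)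
Lemma DeltaE v : v \in calN T ->
  Delta v = ((epsN v)%:R - 2) * ((Nmult v)%:~R - 1) + (Nmult v)%:~R * R0 v.
Proof.
move=> vN; rewrite /Delta rnumE // R0E [X in _ = _ + X]mulrDr.
have -> : (Nmult v)%:~R * \sum_(x in dicriticals_at v) (1 - 1 / (kdic x)%:~R) =
    \sum_(x in dicriticals_at v) ((Nmult v)%:~R - (degree x)%:R) :> rat.
  rewrite big_distrr; apply: eq_bigr => x xD /=.
  by rewrite (degree_kdic vN xD) mulrBr mulr1 mul1r.
rewrite !sumrB !sumr_const -[_%:~R *+ _]mulr_natr !(intrM, intrD,
  mulrNz) -!pmulrn.
ring.
Qed.

Lemma Delta_int v : v \in calN T -> exists k : int, Delta v = k%:~R.
Proof.
move=> vN; have [k E] := adec_dvd_Nmult vN.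
have a0 : (adec v)%:~R != 0 :> rat.
  by rewrite intr_eq0 gt_eqF // (lt_le_trans ltr01) // adec_ge1 // calN_vertex.
exists ((rnum v - 1) * (Nmult v - 1) + (Nmult v - k)
  - \sum_(u in dicriticals_at v) ((degree u)%:Z - 1)).
rewrite /Delta 2!intrD [(- \sum_(u in _) _)%:~R]mulrNz [(\sum_(u in
  dicriticals_at v) _)%:~R]rmorph_sum /=.
congr (_ + _ - _).
  by rewrite intrD mulrNz E intrM; field.
by apply: eq_bigr => x _; rewrite intrD mulrNz.
Qed.

(** Dicriticals and further neighbours in [calN] are treated as one family: degrees and
    characteristic numbers are both of the form N/n with n integral, and the gcd is governed by
    [gcd_of_quotients]. The dead end enters separately, through the division by [adec v]. *)
Lemma chr_small u v : u \in calN T -> v \in calN T -> adj u v ->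
  R0 v + \sum_(w in nbsN v :\ u) (1 - 1 / Mnum v [set v; w]) < 1 ->
  chr u v = (Nmult v)%:~R *
    (1 - (R0 v + \sum_(w in nbsN v :\ u) (1 - 1 / Mnum v [set v; w]))).
Proof.
move=> uN vN uv; set D := dicriticals_at v; set O := nbsN v :\ u.
(* [Mnum] is an integer by [Mnum_int], stored as a rational; [numq] recovers it. *)
pose n x := if x \in D then kdic x else numq (Mnum v [set v; x]).
pose val x := if x \in D then (degree x)%:R else chr v x.
have OD x : x \in O -> (x \in D) = false.
  rewrite in_setD1 => /andP[_]; apply: contraTF; exact: dicriticals_at_nbsN.
have ON x : x \in O -> x \in calN T /\ adj v x.
  by rewrite in_setD1 mem_nbsN => /and3P[].
have dis : [disjoint D & O].
  rewrite disjoint_sym disjoint_subset; apply/subsetP => x /OD xD.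
  by change (x \notin D); rewrite xD.
have nO x : x \in O -> [/\ 1 <= n x, chr v x = (Nmult v)%:~R / (n x)%:~R
    & Mnum v [set v; x] = (n x)%:~R].
  move=> xO; have [xN vx] := ON x xO; rewrite /n OD //.
  by have [m m1 [-> ->]] := Mnum_int vx vN xN; rewrite numq_int.
have sumE : \sum_(x in D :|: O) (1 - 1 / (n x)%:~R) =
   \sum_(x in D) (1 - 1 / (kdic x)%:~R) + \sum_(w in O) (1 - 1 / Mnum v [set v;
     w]) :> rat.
  rewrite big_disjointU //=; congr (_ + _); apply: eq_bigr => x xS;
    first by rewrite /n xS.
  by have [_ _ ->] := nO x xS.
have nS x : x \in D :|: O -> 1 <= n x /\ val x = (Nmult v)%:~R / (n x)%:~R.
  rewrite in_setU; have [xD _|xD /= xO] := boolP (x \in D).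
    by rewrite /n /val xD (kdic_at_ge1 vN) // (degree_kdic vN).
  by have [n1 E _] := nO x xO; rewrite /val (negPf xD).
have valD x : x \in D -> val x = (degree x)%:R by rewrite /val => ->.
have valO x : x \in O -> val x = chr v x by rewrite /val => /OD ->.
rewrite R0E addrAC -sumE => lt1.
have a1 := adec_ge1 (calN_vertex vN).
have a_ge0 := one_sub_inv_ge0 a1.
have n_ge0 x : x \in D :|: O -> 0 <= 1 - 1 / (n x)%:~R :> rat.
  by move=> /nS[n1 _]; apply: one_sub_inv_ge0.
have lt1' : \sum_(x in D :|: O) (1 - 1 / (n x)%:~R) < 1 :> rat by lra.
have gE : (adec v)%:~R * chr u v =
    (Nmult v)%:~R * (1 - \sum_(x in D :|: O) (1 - 1 / (n x)%:~R)).
  apply: (gcd_of_quotients (val := val)) => //.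
  - exact: Nmultr_gt0.
  - exact: adec_chr_gt0.
  - exact: adec_chr_Nmult.
  - move=> x; rewrite in_setU; have [xD _|xD /= xO] := boolP (x \in D).
      by rewrite valD //; exact: adec_chr_degree.
    rewrite valO //; move: xO; rewrite in_setD1 => /andP[xu xn].
    exact: adec_chr_chr.
  - move=> t tN tS; apply: adec_chr_great => // x xS.
      by rewrite -valD //; apply: tS; rewrite in_setU xS.
    by rewrite -valO //; apply: tS; rewrite in_setU xS orbT.
(* A nontrivial dead end uses up at least 1/2 of the allowance, so all the [n x] equal 1 and the gcd
   is [Nmult v]; dividing by [adec v] matches the remaining term of [R0]. *)
have [a_eq1|a_ne1] := eqVneq (adec v) 1.
  by move: gE; rewrite a_eq1 mulr1z mul1r div1r invr1 subrr addr0.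
have a_half := one_sub_inv_ge a1 a_ne1.
have n1 x : x \in D :|: O -> n x = 1.
  move=> xS; apply/eqP; apply: contraTT lt1 => nx; rewrite -leNgt (bigD1 x) //=.
  have := one_sub_inv_ge (nS x xS).1 nx.
  have : 0 <= \sum_(i in D :|: O | i != x) (1 - 1 / (n i)%:~R) :> rat.
    by apply: sumr_ge0 => i /andP[iS _]; apply: n_ge0.
  lra.
have sum0 : \sum_(x in D :|: O) (1 - 1 / (n x)%:~R) = 0 :> rat.
  by rewrite big1 // => x xS; rewrite n1 // divr1 subrr.
have a0 : (adec v)%:~R != 0 :> rat by rewrite intr_eq0 gt_eqF //
  (lt_le_trans ltr01).
move: gE; rewrite sum0 subr0 mulr1 => <-.
by rewrite add0r opprB addrC subrK div1r mulrAC mulfV ?mul1r.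
Qed.

Section SmallCases.
Variables u v : cell T.
Hypotheses (uN : u \in calN T) (vN : v \in calN T) (uv : adj u v).

Lemma u_nbsN : u \in nbsN v.
Proof. by rewrite mem_nbsN uN adj_sym. Qed.

(** Here [Delta v = 1 - N(1 - R0)], so [Delta v <= 0] forces [R0 v < 1] and [chr_small] applies. *)
Lemma chr_leaf : epsN v = 1%N -> Delta v <= 0 -> Delta v = 1 - chr u v.
Proof.
move=> e1 D0; have O0 : nbsN v :\ u = set0.
  apply/eqP; rewrite -cards_eq0; move: e1; rewrite epsNE (cardsD1 u) u_nbsN.
  by move=> /eqP; rewrite eqSS.
move: (D0); rewrite DeltaE // e1 => D0'.
have N0 := Nmultr_gt0 vN.
have R1 : R0 v < 1.
  have : 0 < (Nmult v)%:~R * (1 - R0 v) by lra.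
  by rewrite pmulr_rgt0 // subr_gt0.
by rewrite (chr_small uN vN uv) O0 big_set0 addr0 //; ring.
Qed.

Lemma nbsN_set2 w : epsN v = 2%N -> w \in nbsN v -> w != u ->
  nbsN v :\ u = [set w].
Proof.
move=> e2 wn wu; have w1 : w \in nbsN v :\ u by rewrite in_setD1 wu.
apply/esym/eqP; rewrite eqEcard sub1set w1 cards1.
by move: e2; rewrite epsNE (cardsD1 u) u_nbsN => /eqP; rewrite eqSS => /eqP ->.
Qed.

Lemma chr_pass w : epsN v = 2%N -> w \in nbsN v -> w != u ->
  Rnum v [set [set v; w]] < 1 -> Delta v = chr v w - chr u v.
Proof.
move=> e2 wn wu; rewrite Rnum_set1 => R1; have O1 := nbsN_set2 e2 wn wu.
rewrite (chr_small uN vN uv) O1 big_set1 // DeltaE // e2.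
move: wn; rewrite mem_nbsN => /andP[wN vw].
have [m m1 [-> ->]] := Mnum_int vw vN wN.
by rewrite subrr mul0r add0r div1r; ring.
Qed.

Lemma Delta_eps2_ge0 : epsN v = 2%N -> 0 <= Delta v.
Proof.
move=> e2; rewrite DeltaE // e2 subrr mul0r add0r.
by rewrite mulr_ge0 ?R0_ge0 // ltW // Nmultr_gt0.
Qed.

(** [Delta v = N * R0 v] gives [R0 v = 0]. The bound on [Rnum] then reads 1 - 1/M < 1 and holds by
    itself. *)
Lemma chr_pass_trivial w : epsN v = 2%N -> w \in nbsN v -> w != u ->
  Delta v = 0 -> chr u v = chr v w.
Proof.
move=> e2 wn wu D0; have R00 : R0 v = 0.
  move: D0; rewrite DeltaE // e2 subrr mul0r add0r => /eqP; rewrite mulf_eq0.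
  by rewrite gt_eqF ?Nmultr_gt0 //= => /eqP.
apply/eqP; rewrite eq_sym -subr_eq0 -chr_pass // ?D0 // Rnum_set1 R00 add0r.
move: wn; rewrite mem_nbsN => /andP[wN vw].
have [m m1 [-> _]] := Mnum_int vw vN wN.
by rewrite gtrBl div1r invr_gt0 ltr0z (lt_le_trans ltr01).
Qed.

(** Both parts of [Rnum] vanish, so [R0 v = 0] and [chr v w] is all of [Nmult v]. The gcd therefore
    reduces to [chr v t], and [Delta v = N - 1]; the summand [1 - chr v t] is what a tooth at [t]
    will contribute. *)
Lemma chr_fork w t : epsN v = 3%N -> w \in nbsN v -> t \in nbsN v ->
  w != u -> t != u -> w != t -> Rnum v [set [set v; w]] = 0 ->
  Delta v + (1 - chr v t) = chr v w - chr u v /\ chr u v <= chr v w.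
Proof.
move=> e3 wn tn wu tu wt; rewrite Rnum_set1 => R1.
have O2 : nbsN v :\ u = [set w; t].
  apply/esym/eqP; rewrite eqEcard subUset !sub1set !in_setD1 wu wn tu tn cards2
    wt.
  by move: e3; rewrite epsNE (cardsD1 u) u_nbsN => /eqP; rewrite eqSS => /eqP ->.
move: (wn) (tn); rewrite !mem_nbsN => /andP[wN vw] /andP[tN vt].
have [m m1 [Mw cw]] := Mnum_int vw vN wN;
  have [l l1 [Mt ct]] := Mnum_int vt vN tN.
have m0 := one_sub_inv_ge0 m1; have R00 := R0_ge0 vN; rewrite Mw in R1.
have R0E' : R0 v = 0 by lra.
have mE : 1 / m%:~R = 1 :> rat by lra.
have lpos : 0 < l%:~R :> rat by rewrite ltr0z (lt_le_trans ltr01).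
have cuv : chr u v = chr v t.
  rewrite (chr_small uN vN uv) O2 big_setU1 ?inE //= big_set1 Mw Mt R0E' mE
    subrr !add0r.
    by rewrite ct div1r opprB addrC subrK.
  by rewrite gtrBl div1r invr_gt0.
have cvw : chr v w = (Nmult v)%:~R by rewrite cw -[_^-1]div1r mE mulr1.
split; first by rewrite cvw cuv DeltaE // e3 R0E'; ring.
rewrite cvw cuv; apply: dvq_le (chr_dvq_Nmult vt vN tN); last exact: Nmultr_gt0.
by rewrite ltW // chr_gt0.
Qed.

End SmallCases.

(** * Teeth and skeleton *)

(** An interior cell is left in two different directions, and only one of them can lead to the
    parent. The other leads up to a vertex, so [child_calN] applies. *)
Lemma calN_convex x y w : x \in calN T -> y \in calN T -> w \in gamma x y ->
  w \in calN T.
Proof.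
move=> xN yN wg; have [->//|wx] := eqVneq w x; have [->//|wy] := eqVneq w y.
have wa := toward_adj wx; have wb := toward_adj wy.
have xb : x \in branch w (toward x w) by apply: mem_branch; rewrite eq_sym.
have yb : y \in branch w (toward y w) by apply: mem_branch; rewrite eq_sym.
have use t : child w (toward t w) -> t \in branch w (toward t w) ->
  t \in calN T -> w \in calN T.
  move=> ct tb tN; apply: (child_calN ct); rewrite mem_vertices.
  apply/negP => ta; have E := arrow_branch (child_adj ct) ta tb.
  by have := calN_vertex tN; rewrite mem_vertices E ta.
have [ca|] := boolP (child w (toward x w)); first exact: use ca xb xN.
rewrite adj_child // negbK => pa.
have [cb|] := boolP (child w (toward y w)); first exact: use cb yb yN.
rewrite adj_child // negbK => pb; have ab := child_parent pa pb.
have := branch_convex wa xb _ wg; rewrite {1}ab => /(_ yb).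
by rewrite inE eqxx.
Qed.

Definition nbr u y : {set cell T} := calN T :&: branch u y.

Lemma mem_nbr u y x : (x \in nbr u y) = (x \in calN T) && (x \in branch u y).
Proof. by rewrite inE. Qed.

Lemma calN_branch u y x : u \in calN T -> adj u y -> x \in nbr u y ->
  y \in calN T.
Proof.
move=> uN uy; rewrite mem_nbr => /andP[xN xb]; apply: calN_convex uN xN _.
by rewrite (gamma_branch uy xb) inE mem_gammal orbT.
Qed.

Lemma calN_atE u y : adj u y -> calN_at u [set u; y] = nbr u y.
Proof.
move=> uy; apply/setP => x; rewrite in_set mem_nbr gamma_edgesE //;
  congr (_ && _).
have -> : (u \in branch u y) = false by rewrite inE eqxx.
by case: (x \in branch u y).
Qed.

Lemma nbr_next u y x : adj u y -> u \in calN T -> x \in nbr u y -> x != y ->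
  [/\ toward x y \in nbsN y, toward x y != u & x \in nbr y (toward x y)].
Proof.
move=> uy uN xb xy; have yN := calN_branch uN uy xb.
move: xb; rewrite mem_nbr => /andP[xN xb];
  have [yt tu tb] := branch_next uy xb xy.
have xn : x \in nbr y (toward x y) by rewrite mem_nbr xN.
by split; rewrite // mem_nbsN yt (calN_branch yN yt xn).
Qed.

Lemma DeltaS_nbr u y : adj u y -> y \in calN T ->
  DeltaS (nbr u y) = Delta y + \sum_(j in nbsN y :\ u) DeltaS (nbr y j).
Proof.
move=> uy yN; rewrite /DeltaS.
under eq_bigl => x do rewrite mem_nbr andbC.
rewrite (big_branch _ _ _ uy) /= yN; congr (_ + _).
rewrite [LHS](bigID (mem (calN T))) /= [X in _ + X]big1 ?addr0.
  apply: eq_big => [j|j _]; first by rewrite !inE -andbA (andbC (adj y j)).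
  by apply: eq_bigl => x; rewrite mem_nbr andbC.
move=> j /andP[]; rewrite in_setD1 mem_nbs => /andP[_ yj] jN.
apply: big_pred0 => x; apply/negbTE; apply: contraNN jN => /andP[xb xN].
by apply: (calN_branch (x := x) yN yj); rewrite mem_nbr xN.
Qed.

Lemma gamma_rcons v w : v != w -> gamma v w = rcons (gamma v (toward v w)) w.
Proof.
rewrite eq_sym => wv; have [_ E _] := gamma_toward wv.
by rewrite gamma_sym E rev_cons -gamma_sym.
Qed.

(** Vertices with epsilon 2 and [Delta] 0 have a single continuation and leave the characteristic
    number unchanged, so the value at the leaf is transported to [u]. *)
Lemma chain_facts v u y : adj u y -> u \in calN T -> v \in nbr u y ->
  epsN v = 1%N -> Delta v <= 0 ->
  (forall x, x \in gamma v y -> x != v -> epsN x = 2%N /\ Delta x = 0) ->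
  [/\ nbr u y \subset gamma v y, DeltaS (nbr u y) = Delta v &
    Delta v = 1 - char_num u [set u; y]].
Proof.
move=> uy uN vn e1 D0; move: u y uy uN vn;
  apply: branch_ind => u y uy IH uN vn mid.
have yN := calN_branch uN uy vn.
have un : u \in nbsN y by rewrite mem_nbsN uN adj_sym.
have [vy|vy] := eqVneq v y.
  rewrite -{}vy in uy IH vn mid yN un *.
  have O0 : nbsN v :\ u = set0.
    apply/eqP; rewrite -cards_eq0; move: e1; rewrite epsNE (cardsD1 u) un.
    by move=> /eqP; rewrite eqSS.
  split.
  - apply/subsetP => x xn; rewrite gamma_id inE; apply: contraT => xv.
    have [xt tu _] := nbr_next uy uN xn xv.
    by have := in_set0 (toward x v); rewrite -O0 in_setD1 tu xt.
  - by rewrite DeltaS_nbr // O0 big_set0 addr0.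
  - exact: chr_leaf.
have [tn tu vb] := nbr_next uy uN vn vy.
have [e2 Dy] : epsN y = 2%N /\ Delta y = 0 by apply: mid;
  rewrite ?mem_gammar // eq_sym.
have O1 := nbsN_set2 uN uy e2 tn tu.
have yt : adj y (toward v y) by move: tn; rewrite mem_nbsN => /andP[].
have [|sub DS Dv] := IH _ yt tu yN vb.
  by move=> x xg; apply: mid; rewrite (gamma_rcons vy) mem_rcons inE xg orbT.
split.
- apply/subsetP => x xn; rewrite (gamma_rcons vy) mem_rcons inE.
  have [//|xy] := eqVneq x y; have [xt xu xb] := nbr_next uy uN xn xy.
  have tE : toward x y = toward v y.
    by have := in_setD1 (toward x y) (nbsN y) u; rewrite xu xt O1 inE => /eqP.
  by apply: (subsetP sub); rewrite -tE.
- by rewrite DeltaS_nbr // O1 big_set1 DS Dy add0r.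
- by rewrite (chr_pass_trivial uN yN uy e2 tn tu Dy).
Qed.

Lemma Gamma_facts v w : Gamma (gamma v w) ->
  [/\ v \in calN T, w \in calN T, v != w, child w (toward v w) & epsN v = 1%N] /\
  [/\ Delta v <= 0, 0 < Delta v + Delta w &
     forall x, x \in gamma v w -> x != v -> x != w ->
       epsN x = 2%N /\ Delta x = 0].
Proof.
move=> /and4P[/and5P[_ _ /allP aN n1 /andP[e1 /allP mid]] Dv DS tl].
have z1 : nth (root T) (gamma v w) 0 = v by have [p -> _] := gamma_prop v w.
rewrite -[1.-1]/0%N z1 in e1 Dv.
have vw : v != w by apply: contraTneq n1 => ->; rewrite gamma_id.
have vN : v \in calN T by apply: aN; exact: mem_gammal.
have wN : w \in calN T by apply: aN; exact: mem_gammar.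
have mid' x : x \in gamma v w -> x != v -> x != w -> epsN x = 2%N /\ Delta x = 0.
  move=> xg xv xw; have ilt : (index x (gamma v w) < size (gamma v w))%N by
    rewrite index_mem.
  have i0 : (0 < index x (gamma v w))%N.
    rewrite lt0n; apply: contraNneq xv => i0; have := nth_index (root T) xg.
    by rewrite i0 z1 => ->.
  have il : (index x (gamma v w)).+1 != size (gamma v w).
    apply: contraNneq xw => E; have := nth_index (root T) xg.
    have -> : index x (gamma v w) = (size (gamma v w)).-1 by rewrite -E.
    have [p gE [_ _ lp]] := gamma_prop v w.
    by rewrite nth_last gE [last _ _]lp => ->.
  (* Positions in [trivial_path] are counted from 1, hence the shift of the index. *)
  have := mid (index x (gamma v w)).+1; rewrite mem_index_iota /= nth_index //.
  rewrite ltnS i0 ltn_neqAle il ilt => /(_ isT)/andP[/eqP -> /eqP ->] //.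
have cw : child w (toward v w).
  rewrite -adj_tlt; last by rewrite toward_adj // eq_sym.
  have [p gE [_ _ lp]] := gamma_prop v (toward v w).
  move: tl; rewrite (gamma_rcons vw) gE size_rcons /= nth_rcons ltnn eqxx.
  by rewrite -rcons_cons nth_rcons /= ltnSn nth_last /= lp.
split; split=> //; first by apply/eqP.
move: DS; rewrite /DeltaS (bigD1 v) /=; last by rewrite inE mem_gammal.
rewrite (bigD1 w) /=; last by rewrite inE mem_gammar eq_sym vw.
rewrite big1 ?addr0 // => x /andP[/andP[]]; rewrite inE => xg xv xw.
by have [] := mid' x xg xv xw.
Qed.

(* [y] is the neighbour of [w] in a tooth [(w, {w, y})]. *)
Definition tooth_nb w y : bool := [exists v,
  Gamma (gamma v w) && (toward v w == y)].

Lemma tooth_nbP w y : tooth_nb w y -> exists2 v, Gamma (gamma v w) &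
  [/\ v \in nbr w y, nbr w y \subset gamma v y, epsN v = 1%N &
     forall x, x \in nbr w y -> x != v -> epsN x = 2%N /\ Delta x = 0] /\
  [/\ child w y, y \in nbsN w, w \in calN T, DeltaS (nbr w y) =
    1 - char_num w [set w; y]
    & Delta v = 1 - char_num w [set w; y]].
Proof.
move=> /existsP[v /andP[Gv /eqP <-]]; exists v => //.
have [[vN wN vw cw e1] [Dv DS mid]] := Gamma_facts Gv.
have wt := child_adj cw; have vb : v \in nbr w (toward v w) by rewrite mem_nbr
  vN mem_branch.
have wN' : w \notin gamma v (toward v w).
  have := gamma_uniq v w; rewrite (gamma_rcons vw) rcons_uniq => /andP[] //.
have mid' x : x \in gamma v (toward v w) -> x != v -> epsN x = 2%N /\ Delta x = 0.
  move=> xg xv; apply: mid => //; first by rewrite (gamma_rcons vw) mem_rcons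
    inE xg orbT.
  by apply: contraNneq wN' => xw; rewrite -{1}xw.
have [sub DSv Dvc] := chain_facts wt wN vb e1 Dv mid'.
split; split=> //; first by move=> x /(subsetP sub); exact: mid'.
  by rewrite mem_nbsN wt (calN_branch wN wt vb).
by rewrite DSv.
Qed.

Lemma tooth_nb_nbsN w y : tooth_nb w y -> y \in nbsN w.
Proof. by move=> /tooth_nbP[v _ [_ []]]. Qed.

Lemma tooth_nb_calN w y : tooth_nb w y -> w \in calN T.
Proof. by move=> /tooth_nbP[v _ [_ []]]. Qed.

Lemma tooth_nb_child w y : tooth_nb w y -> child w y.
Proof. by move=> /tooth_nbP[v _ [_ []]]. Qed.

Lemma tooth_nb_adj w y : tooth_nb w y -> adj w y.
Proof. by move=> /tooth_nb_child/child_adj. Qed.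

Lemma tooth_nb_self w y : tooth_nb w y -> y \in nbr w y.
Proof.
move=> t; have := tooth_nb_nbsN t; rewrite mem_nbsN mem_nbr => /andP[-> wy].
exact: branch_self.
Qed.

Lemma tooth_nb_DeltaS w y : tooth_nb w y ->
  DeltaS (nbr w y) = 1 - char_num w [set w; y].
Proof. by move=> /tooth_nbP[v _ [_ []]]. Qed.

Lemma Gamma_nbr v w x : Gamma (gamma v w) -> x \in gamma v w -> x != w ->
  x \in nbr w (toward v w).
Proof.
move=> Gv xg xw; have [[vN wN vw cw _] _] := Gamma_facts Gv.
rewrite mem_nbr (calN_convex vN wN xg) /=.
move: xg; rewrite (gamma_rcons vw) mem_rcons inE (negPf xw) /=.
exact: branch_convex (child_adj cw) (mem_branch vw) (branch_self (child_adj cw)).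
Qed.

Lemma Gamma_tooth_nb v w : Gamma (gamma v w) -> tooth_nb w (toward v w).
Proof. by move=> Gv; apply/existsP; exists v; rewrite Gv eqxx. Qed.

Lemma Wset_tooth_nb w : (w \in Wset T) = [exists y, tooth_nb w y].
Proof.
rewrite inE; apply/existsP/existsP => [[v Gv]|[y /existsP[v /andP[Gv _]]]].
  by exists (toward v w); exact: Gamma_tooth_nb.
by exists v.
Qed.

Lemma mem_Vset w v : (v \in Vset w) = Gamma (gamma v w).
Proof.
rewrite /Vset; case: ifP => [_|wW]; first by rewrite in_set.
by rewrite in_set0; apply/esym/negP => Gv; case/negP: wW; rewrite in_set;
  apply/existsP; exists v.
Qed.

(** This description holds for every [w]: outside [Wset] there is no tooth and only [w] remains. *)
Lemma mem_Vbar w x : (x \in Vbar w) =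
  (x == w) || [exists y, tooth_nb w y && (x \in nbr w y)].
Proof.
rewrite /Vbar; case: ifP => [wW|wW]; last first.
  rewrite in_set1; case: eqP => //= _;
    apply/esym/negbTE/existsP => -[y /andP[t _]].
  by move: wW; rewrite Wset_tooth_nb => /negbT/existsP; apply; exists y.
rewrite in_set; apply/exists_inP/orP => [[v]|].
  rewrite mem_Vset => Gv xg; have [->|xw] := eqVneq x w; [by left | right].
  by apply/existsP; exists (toward v w); rewrite Gamma_tooth_nb // Gamma_nbr.
case=> [/eqP ->|/existsP[y /andP[t xn]]].
  have [v Gv] : exists v, Gamma (gamma v w) by move: wW;
    rewrite in_set => /existsP.
  by exists v; rewrite ?mem_Vset // mem_gammar.
have [v Gv [[vn sub _ _] _]] := tooth_nbP t; exists v; first by rewrite mem_Vset.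
have [[_ _ vw _ _] _] := Gamma_facts Gv.
rewrite (gamma_rcons vw) mem_rcons inE (_ : toward v w =
  y) ?(subsetP sub) ?orbT //.
by move: vn; rewrite mem_nbr => /andP[_ /toward_branch].
Qed.

Lemma mem_skel x : (x \in skel T) =
  (x \in calN T) && [forall w, forall y, tooth_nb w y ==> (x \notin nbr w y)].
Proof.
rewrite in_setD andbC; congr (_ && _); apply/idP/forallP => [xN w|H].
  apply/forallP => y; apply/implyP => t; apply: contraNN xN => xn.
  apply/bigcupP; exists w; first by rewrite Wset_tooth_nb; apply/existsP;
    exists y.
  rewrite in_setD1 mem_Vbar; apply/andP; split.
    by move: xn; rewrite mem_nbr => /andP[_ /branch_neq].
  by apply/orP; right; apply/existsP; exists y; rewrite t.
apply/bigcupP => -[w _]; rewrite in_setD1 mem_Vbar => /andP[xw].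
rewrite (negPf xw) => /existsP[y /andP[t xn]].
by have /forallP/(_ y) := H w; rewrite t xn.
Qed.

Lemma skel_calN x : x \in skel T -> x \in calN T.
Proof. by rewrite mem_skel => /andP[]. Qed.

Lemma skel_notin x w y : x \in skel T -> tooth_nb w y -> x \notin nbr w y.
Proof. by rewrite mem_skel => /andP[_ /forallP/(_ w)/forallP/(_ y)/implyP H]
  /H. Qed.

Lemma notin_skel x : x \in calN T -> x \notin skel T ->
  exists w y, tooth_nb w y /\ x \in nbr w y.
Proof.
move=> xN; rewrite mem_skel xN /= negb_forall => /existsP[w].
rewrite negb_forall => /existsP[y]; rewrite negb_imply negbK => /andP[t xn].
by exists w, y.
Qed.

Lemma skel_notin_branch x w y : x \in skel T -> tooth_nb w y -> x \in branch y w.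
Proof.
move=> xS t; have := skel_notin xS t; rewrite mem_nbr (skel_calN xS) /=.
by rewrite (branchC _ (tooth_nb_adj t)).
Qed.

(** A tooth based inside another one would end at the same leaf, since teeth point away from the
    root and the outer one has a single leaf. Its base would be an interior vertex with [Delta] 0,
    against the positivity of the total of the inner tooth. *)
Lemma nbr_leaf_unique w y w' y' : tooth_nb w y -> tooth_nb w' y' ->
  w' \in nbr w y -> False.
Proof.
move=> t t' w'n; have [v' Gv' [[vn' sub' e1' _] [c' _ wN' _ Dv']]] := tooth_nbP
  t'.
have [v Gv [[vn sub e1 mid] [c _ wN _ Dv]]] := tooth_nbP t.
have [[_ _ vw' _ _] [Dle DS _]] := Gamma_facts Gv'.
have wy := child_adj c; have wy' := child_adj c'.
have ww' : w' != w by move: w'n; rewrite mem_nbr => /andP[_ /branch_neq].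
have v'n : v' \in nbr w y.
  move: vn'; rewrite !mem_nbr => /andP[-> vb'] /=.
  move: w'n; rewrite mem_nbr => /andP[_ w'b].
  case/andP: c' => _ rb'; case/andP: c => _ rb.
  (* Otherwise the path from the root to [v'], which passes through [w'], would stay on the root
     side of the edge [wy]. *)
  apply: contraT; rewrite -branchC // => v'b.
  have := gamma_bridge wy' rb' vb' => gE.
  have w'g : w' \in gamma (root T) v' by rewrite gE mem_cat mem_gammar.
  have yw : adj y w by rewrite adj_sym.
  have := branch_convex yw rb v'b w'g.
  by rewrite branchC // w'b.
have v'v : v' = v.
  by apply/eqP; apply: contraT => nv; have [] := mid v' v'n nv; rewrite e1'.
have [_ D0] : epsN w' = 2%N /\ Delta w' = 0.
  by apply: mid => //; rewrite -v'v eq_sym.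
by move: DS; rewrite D0 addr0 ltNge Dle.
Qed.

Lemma tooth_nb_skel w y : tooth_nb w y -> w \in skel T.
Proof.
move=> t; apply: contraT => wS; have [w' [y' [t' wn]]] := notin_skel
  (tooth_nb_calN t) wS.
by case: (nbr_leaf_unique t' t wn).
Qed.

Lemma tooth_nb_disjoint w y w' y' x : tooth_nb w y -> tooth_nb w' y' ->
  x \in nbr w y ->
  x \in nbr w' y' -> w = w' /\ y = y'.
Proof.
move=> t t' xn xn'; have wS := tooth_nb_skel t; have wS' := tooth_nb_skel t'.
have wy := tooth_nb_adj t; have wy' := tooth_nb_adj t'.
move: (xn) (xn'); rewrite !mem_nbr => /andP[xN xb] /andP[_ xb'].
have [E|neq] := eqVneq [set w; y] [set w'; y'].
  have: w \in [set w'; y'] by rewrite -E set21.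
  rewrite in_set2 => /orP[/eqP ww'|/eqP wy'E].
    by move/eqP: E; rewrite -ww' set2_eq_adj // => /eqP ->.
  by have := skel_notin wS t'; rewrite wy'E tooth_nb_self.
have wb := skel_notin_branch wS t'.
have yb : y \in branch y' w' by apply: branch_adj wy _ wb;
  rewrite 1?adj_sym // (setUC [set y']).
have yw' : adj w' y' by [].
(* The path from [y] to [x] enters the second tooth through [w'], which would put the skeleton
   vertex [w'] inside the first tooth. *)
have gE := gamma_bridge yw' yb xb'.
have : w' \in gamma y x by rewrite gE mem_cat mem_gammar.
move=> /(branch_convex wy (branch_self wy) xb) w'b.
by have := skel_notin wS' t; rewrite mem_nbr (skel_calN wS') w'b.
Qed.

Lemma skel_convex x y w : x \in skel T -> y \in skel T -> w \in gamma x y ->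
  w \in skel T.
Proof.
move=> xS yS wg; apply: contraT => wS.
have wN := calN_convex (skel_calN xS) (skel_calN yS) wg.
have [a [b [t]]] := notin_skel wN wS; rewrite mem_nbr wN /=.
have ba : adj b a by rewrite adj_sym tooth_nb_adj.
have := branch_convex ba (skel_notin_branch xS t) (skel_notin_branch yS t) wg.
by rewrite (branchC _ (tooth_nb_adj t)) => /negPf ->.
Qed.

Lemma Vbar_cover x : x \in calN T -> exists2 w, w \in skel T & x \in Vbar w.
Proof.
move=> xN; have [xS|xS] := boolP (x \in skel T).
  by exists x; rewrite // mem_Vbar eqxx.
have [w [y [t xn]]] := notin_skel xN xS; exists w; first exact: tooth_nb_skel t.
by rewrite mem_Vbar; apply/orP; right; apply/existsP; exists y; rewrite t.
Qed.

Lemma Vbar_unique x w w' : w \in skel T -> w' \in skel T -> x \in Vbar w ->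
  x \in Vbar w' -> w = w'.
Proof.
move=> wS wS'; rewrite !mem_Vbar.
case/predU1P=> [->|/existsP[y /andP[t xn]]].
  by case/predU1P=> [//|/existsP[y /andP[t]]]; rewrite (negPf (skel_notin wS t)).
case/predU1P=> [xw|/existsP[y' /andP[t' xn']]].
  by move: xn; rewrite xw (negPf (skel_notin wS' t)).
by have [] := tooth_nb_disjoint t t' xn xn'.
Qed.

Lemma Vbar_calN w x : w \in skel T -> x \in Vbar w -> x \in calN T.
Proof.
move=> wS; rewrite mem_Vbar => /predU1P[->|/existsP[y /andP[_]]].
  exact: skel_calN.
by rewrite mem_nbr => /andP[].
Qed.

(** Teeth are pairwise disjoint and meet no skeleton vertex, so the sets [Vbar w] partition
    [calN]. *)
Lemma DeltaS_calN : DeltaS (calN T) = \sum_(w in skel T) DeltaS (Vbar w).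
Proof.
rewrite /DeltaS (exchange_big_dep (mem (calN T))) /=; last exact: Vbar_calN.
apply: eq_bigr => x xN; have [w wS xw] := Vbar_cover xN.
rewrite (big_pred1 w) // => w' /=; apply/andP/eqP => [[wS' xw']|->//].
exact: Vbar_unique wS' wS xw' xw.
Qed.

Lemma DeltaS_Vbar w : w \in calN T ->
  DeltaS (Vbar w) = Delta w + \sum_(y | tooth_nb w y) (1 - char_num w [set w; y]).
Proof.
move=> wN; rewrite /DeltaS (big_cells_branch _ w) /= mem_Vbar eqxx /=;
  congr (_ + _).
rewrite [LHS](bigID (tooth_nb w)) /= [X in _ + X]big1 ?addr0.
  apply: eq_big => [y|y /andP[_ t]].
    rewrite mem_nbs; have [t|] := boolP (tooth_nb w y); rewrite ?andbF //.
    by rewrite tooth_nb_adj.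
  rewrite -tooth_nb_DeltaS //; apply: eq_bigl => x;
    rewrite mem_nbr mem_Vbar andbC.
  have [xb|] := boolP (x \in branch w y); rewrite ?andbF // !andbT.
  rewrite (negPf (branch_neq xb)) /=; apply/existsP/idP => [[y']|xN].
    by rewrite mem_nbr => /and3P[].
  by exists y; rewrite t mem_nbr xN.
move=> y /andP[_ nt]; apply: big_pred0 => x; apply/negbTE; apply: contraNN nt.
move=> /andP[xb]; rewrite mem_Vbar (negPf (branch_neq xb)) => /existsP[y'
  /andP[t]].
by rewrite mem_nbr => /andP[_ xb']; rewrite (branch_disj xb xb').
Qed.

Lemma Omega_skel x : x \in Omega T -> x \in skel T.
Proof.
rewrite in_setD => /andP[xV]; rewrite in_set => /and3P[xN /eqP e1 _].
apply: contraT => xS; have [w [y [t xn]]] := notin_skel xN xS.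
have [v Gv [[vn _ _ mid] _]] := tooth_nbP t.
have xv : x = v by apply/eqP; apply: contraT => nv; have [] := mid x xn nv;
  rewrite e1.
case/negP: xV; apply/bigcupP; exists w.
  by rewrite Wset_tooth_nb; apply/existsP; exists y.
by rewrite mem_Vset xv.
Qed.

(** The starting vertex of a path in Gamma lies in a tooth and thus off the skeleton, so [x] is in
    no [Vset]. *)
Lemma mem_Omega x : x \in skel T -> epsN x = 1%N -> Delta x <= 0 -> x \in Omega T.
Proof.
move=> xS e1 D0; rewrite in_setD; apply/andP; split; last first.
  by rewrite in_set (skel_calN xS) e1 D0.
apply/bigcupP => -[w wW]; rewrite mem_Vset => Gx.
have t := Gamma_tooth_nb Gx.
have [[xN _ xw _ _] _] := Gamma_facts Gx.
by have := skel_notin xS t; rewrite mem_nbr xN mem_branch.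
Qed.

Lemma toothP v y : adj v y -> tooth (v, [set v; y]) -> tooth_nb v y.
Proof.
move=> vy /andP[_ /existsP[x H]].
have /andP[Gx] : Gamma (gamma x v) &&
  ([set v; y] == [set v; nth (root T) (gamma x v) (size (gamma x v)).-2]) by [].
have [[_ _ xv _ _] _] := Gamma_facts Gx.
have [p gE [_ _ lp]] := gamma_prop x (toward x v).
rewrite (gamma_rcons xv) gE size_rcons /= -rcons_cons.
rewrite nth_rcons /= ltnSn nth_last /= lp set2_eq_adj // => /eqP ->.
by apply/existsP; exists x; rewrite Gx eqxx.
Qed.

(** * Combs in the skeleton rooted at [z] *)

Section Rooted.
Variable z : cell T.
Hypothesis zS : z \in skel T.

Definition up u : cell T := toward z u.

Definition phi u : cell T * {set cell T} := (u, edge_to z u).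

Lemma edge_toE u : edge_to z u = [set u; up u].
Proof. by []. Qed.

Lemma up_adj u : u != z -> adj u (up u).
Proof. exact: toward_adj. Qed.

Lemma up_z : up z = z.
Proof. exact: toward_id. Qed.

Lemma z_up u : u != z -> z \in branch u (up u).
Proof. by move=> uz; apply: mem_branch; rewrite eq_sym. Qed.

Lemma gamma_up u : u != z -> gamma u z = u :: gamma (up u) z.
Proof. by move=> uz; have [_ -> _] := gamma_toward uz. Qed.

Lemma gamma_upN u : u != z -> u \notin gamma (up u) z.
Proof. by move=> uz; have [_ _] := gamma_toward uz. Qed.

Lemma up_skel u : u \in skel T -> up u \in skel T.
Proof.
move=> uS; have [->|uz] := eqVneq u z; first by rewrite up_z.
by apply: skel_convex uS zS _; rewrite gamma_up // inE mem_gammal orbT.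
Qed.

Lemma mem_gamma_branch u v : v != z ->
  (v \in gamma u z) = (u \in branch (up v) v).
Proof.
move=> vz; have va := up_adj vz; rewrite branchC //; apply/idP/idP => [vg|ub].
  apply/negP => ub; have := branch_convex va ub (z_up vz) vg.
  by rewrite inE eqxx.
rewrite (gamma_bridge va _ (z_up vz)) ?mem_cat ?mem_gammar //.
by rewrite branchC.
Qed.

Lemma gamma_anc_branch u v : u != z -> v != u -> v \in gamma u z ->
  v \in branch u (up u).
Proof.
move=> uz vu; rewrite gamma_up // inE (negPf vu) /=.
exact: branch_convex (up_adj uz) (branch_self (up_adj uz)) (z_up uz).
Qed.

Lemma gamma_anti u v : u \in gamma v z -> v \in gamma u z -> u = v.
Proof.
move=> uv vu; have [uz|uz] := eqVneq u z.
  by move: vu; rewrite uz gamma_id inE => /eqP.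
apply/eqP; apply: contraT => nuv; rewrite mem_gamma_branch // in uv.
have := gamma_anc_branch uz _ vu; rewrite eq_sym => /(_ nuv).
by move: uv; rewrite (branchC v (up_adj uz)) => /negPf ->.
Qed.

(** On [calO z] the order is that of ancestors in the tree rooted at [z]: the larger element is the
    one farther from [z]. *)
Lemma prec_phi u v : u != z -> v != z ->
  prec (phi v) (phi u) = (v != u) && (v \in gamma u z).
Proof.
move=> uz vz; rewrite /prec /= !edge_toE !gamma_edgesE ?up_adj //.
have self x : (x \in branch x (up x)) = false by rewrite inE eqxx.
rewrite !self mem_gamma_branch // (branchC u (up_adj vz)).
have [->|vu] := eqVneq v u; first by rewrite self.
case: (boolP (u \in branch v (up v))) => [|ub] /=; first by rewrite !andbF.
by rewrite gamma_anc_branch // mem_gamma_branch // (branchC u (up_adj vz)).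
Qed.

Lemma preceq_phi u v : u != z -> v != z ->
  preceq (phi v) (phi u) = (v \in gamma u z).
Proof.
move=> uz vz; rewrite /preceq prec_phi //.
have [->|vu] := eqVneq v u; first by rewrite eqxx mem_gammal.
by rewrite /= xpair_eqE (negPf vu).
Qed.

(* Wrapping the condition keeps unification from comparing its instances by
   computation. *)
Variant fork_ok v x : Prop := ForkOk of
  (epsN v == 2%N) && (Rnum v [set edge_to z v] < 1)
  || [&& epsN v == 3%N, Rnum v [set edge_to z v] == 0
       & [exists g in edgesN_at v,
            [&& g != [set v; x], g != edge_to z v & tooth (v, g)]]].

Definition link u : Prop := up u != z /\ fork_ok (up u) u.

Lemma edgesN_atP v g : g \in edgesN_at v ->
  exists2 y, y \in nbsN v & g = [set v; y].
Proof.
rewrite in_setI incidentE => /andP[gN /imsetP[y]]; rewrite mem_nbs => vy gE.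
exists y => //; rewrite mem_nbsN vy andbT; move: gN;
  rewrite in_set => /andP[_ /subsetP].
by apply; rewrite gE set22.
Qed.

Lemma mem_edgesN_at v y : v \in calN T -> y \in nbsN v -> [set v;
  y] \in edgesN_at v.
Proof.
rewrite mem_nbsN => vN /andP[yN vy]; rewrite in_setI edgeN // in_set set21 andbT.
exact: vy.
Qed.

(** The comb condition at [v] depends on [u] only through the direction in which [u] is seen. This
    makes combs decomposable into single steps. *)
Lemma fork_okP v u : u != v ->
  reflect (fork_ok v (toward u v))
  [|| (epsN v == 2%N) && (Rnum v [set edge_to z v] < 1)
       | [&& epsN v == 3%N, Rnum v [set edge_to z v] == 0
           & [exists g in edgesN_at v,
                [&& g \notin gamma_edges u v, g != edge_to z v & tooth (v, g)]]]].
Proof.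
move=> uv; rewrite (_ : [exists g in edgesN_at v, _] = [exists g in edgesN_at v,
    [&& g != [set v; toward u v], g != edge_to z v & tooth (v, g)]]).
  by apply: (iffP idP) => [|[]].
apply: eq_existsb => g; case gE: (g \in edgesN_at v) => //=; congr (_ && _).
have [y yn ->] := edgesN_atP gE; move: yn; rewrite mem_nbsN => /andP[_ vy].
rewrite gamma_edgesE // [v \in branch _ _]inE eqxx /= set2_eq_adj // inE uv /=.
by rewrite (eq_sym y); case: (toward u v == y).
Qed.

(* The elements of [P] between two elements of [calO z]. *)
Lemma between_phi u v q : u \in skel T -> u != z -> v != z -> v \in gamma u z ->
  (q \in Ppairs T) && (prec q (phi u) && preceq (phi v) q) =
  [&& q == phi q.1, q.1 \in gamma u z, q.1 != u & v \in gamma q.1 z].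
Proof.
case: q => w f uS uz vz vu; apply/idP/idP => /=.
  case/and3P; rewrite inE /= => wP.
  have [y yn fE] := edgesN_atP wP; move: yn; rewrite mem_nbsN => /andP[yN wy].
  rewrite {1}/prec /= edge_toE fE !gamma_edgesE ?up_adj //.
  have -> : (u \in branch u (up u)) = false by rewrite inE eqxx.
  have -> : (w \in branch w y) = false by rewrite inE eqxx.
  case: (boolP (w \in branch u (up u))) => //= wb.
  case: (boolP (u \in branch w y)) => // ub _.
  rewrite (branch_neq wb) /=; case/orP.
    rewrite xpair_eqE => /andP[/eqP <- /eqP <-]; rewrite edge_toE.
    by rewrite /phi edge_toE eqxx vu mem_gammal.
  rewrite /prec /= edge_toE !gamma_edgesE ?up_adj //.
  have -> : (w \in branch w y) = false by rewrite inE eqxx.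
  have -> : (v \in branch v (up v)) = false by rewrite inE eqxx.
  case: (boolP (v \in branch w y)) => //= vb.
  case: (boolP (w \in branch v (up v))) => // wv _.
  have vw : v \in gamma w z by rewrite mem_gamma_branch //
    (branchC w (up_adj vz)).
  have wz : w != z by apply: contraNneq vz => wz; move: vw;
    rewrite wz gamma_id inE.
  have yE : y = up w.
    by apply: branch_disj vb (gamma_anc_branch wz (branch_neq vb) vw).
  rewrite vw andbT {1}yE /phi edge_toE eqxx /= mem_gamma_branch //
    (branchC u (up_adj wz)).
  by rewrite -yE.
case/and4P => /eqP -> /= wg wu vw.
have wS := skel_convex uS zS wg.
have wz : w != z by apply: contraNneq vz => wz; move: vw; rewrite wz gamma_id inE.
rewrite prec_phi // wu wg preceq_phi // vw !andbT inE /= edge_toE.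
by rewrite mem_edgesN_at ?skel_calN // mem_nbsN up_adj // skel_calN // up_skel.
Qed.

Lemma comb_phi u v : u \in skel T -> u != z -> v != z ->
  reflect (v \in gamma u z /\ forall w, w \in gamma u z -> w != u ->
     v \in gamma w z -> fork_ok w (toward u w))
    (comb (phi u) (phi v)).
Proof.
move=> uS uz vz; rewrite /comb preceq_phi //.
case: (boolP (v \in gamma u z)) => [vg|_] /=; last by constructor; case.
apply: (iffP forall_inP) => [H|[_ H] q qP].
  split=> // w wg wu vw.
  have := between_phi (phi w) uS uz vz vg.
  rewrite eqxx /= wg wu vw /= => /andP[qP /(implyP (H _ qP))].
  by move/fork_okP; apply; rewrite eq_sym.
apply/implyP => btw; have := between_phi q uS uz vz vg; rewrite qP btw.
move=> /esym/and4P[/eqP -> wg wu vw].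
by apply/fork_okP; [rewrite eq_sym | apply: H].
Qed.

Lemma comb_refl u : u \in skel T -> u != z -> comb (phi u) (phi u).
Proof.
move=> uS uz; apply/comb_phi => //; split; first exact: mem_gammal.
by move=> w wu nwu uw; case/eqP: nwu; apply: gamma_anti.
Qed.

Lemma toward_anc u w : u != z -> w \in gamma (up u) z -> w != up u ->
  toward u w = toward (up u) w.
Proof.
move=> uz wg wu; have upz : up u != z.
  by apply: contraNneq wu => E; move: wg; rewrite E gamma_id inE.
have wu' : w != u by apply: contraTneq wg => ->; exact: gamma_upN.
have ua := up_adj uz.
have wb : w \in branch u (up u).
  by apply: gamma_anc_branch; rewrite // gamma_up // inE wg orbT.
have ub : u \in branch w (toward (up u) w).
  have wt : adj w (toward (up u) w) by apply: toward_adj.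
  apply: branch_adj wt _ _ (_ : up u \in _) => //; first by rewrite adj_sym.
    apply: contraNneq wu => E.
    have : w \in [set up u; u] by rewrite E set21.
    by rewrite in_set2 (negPf wu') orbF.
  by apply: mem_branch; rewrite eq_sym.
by rewrite (toward_branch ub).
Qed.

Lemma toward_up u : u != z -> toward u (up u) = u.
Proof.
by move=> uz; apply: toward_branch; apply: branch_self; rewrite adj_sym up_adj.
Qed.

Lemma comb_step u v : u \in skel T -> u != z -> v != z -> u != v ->
  comb (phi u) (phi v) <-> link u /\ comb (phi (up u)) (phi v).
Proof.
move=> uS uz vz uv; have upS := up_skel uS; split.
  move=> /(comb_phi uS uz vz)[vg H].
  have vg' : v \in gamma (up u) z by move: vg;
    rewrite gamma_up // inE eq_sym (negPf uv).
  have upz : up u != z.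
    by apply: contraNneq vz => E; move: vg'; rewrite E gamma_id inE.
  split.
    split=> //; rewrite -{2}(toward_up uz); apply: H => //.
      by rewrite gamma_up // inE mem_gammal orbT.
    by rewrite eq_sym (adj_neq (up_adj uz)).
  apply/comb_phi => //; split=> // w wg wu vw.
  rewrite -toward_anc //; apply: H => //;
    first by rewrite gamma_up // inE wg orbT.
  by apply: contraTneq wg => ->; exact: gamma_upN.
move=> [[upz ok] /(comb_phi upS upz vz)[vg H]].
apply/comb_phi => //; split=> [|w]; first by rewrite gamma_up // inE vg orbT.
rewrite gamma_up // inE => /orP[/eqP ->|wg]; first by rewrite eqxx.
have [->|wu] := eqVneq w (up u); first by rewrite toward_up.
by move=> _ vw; rewrite toward_anc //; apply: H.
Qed.

Lemma comb_iter u v : u \in skel T -> u != z -> v != z ->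
  comb (phi u) (phi v) <->
  exists2 k, v = iter k up u & forall i, (i < k)%N -> link (iter i up u).
Proof.
move=> uS uz vz; split.
  have [n] := ubnP (size (gamma u z)); elim: n u uS uz => // n IH u uS uz.
  rewrite ltnS => le_n; have [->|uv] := eqVneq u v; first by exists 0%N.
  move=> /(comb_step uS uz vz uv)[lu cb]; have [upz _] := lu.
  have [|k -> H] := IH (up u) (up_skel uS) upz _ cb;
    first by rewrite gamma_up // in le_n.
  exists k.+1; first by rewrite iterSr.
  by case=> [|i]; rewrite ?ltnS //= -iterS iterSr; apply: H.
case=> k; elim: k u uS uz => [|k IH] u uS uz vE H; first by rewrite vE comb_refl.
have lu := H 0%N isT; have [upz _] := lu.
have cb : comb (phi (up u)) (phi v).
  apply: IH => //; first exact: up_skel.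
    by rewrite vE iterSr.
  by move=> i ik; rewrite -iterSr; apply: H.
apply/comb_step => //; apply/eqP => uv.
have [vg _] := comb_phi (up_skel uS) upz vz cb.
by move: vg; rewrite -uv (negPf (gamma_upN uz)).
Qed.

Lemma up_neq u : u != z -> up u != z -> up (up u) != u.
Proof.
move=> uz upz; apply/eqP => E; have := z_up upz; rewrite E.
by rewrite (branchC z (up_adj uz)) z_up.
Qed.

Lemma skel_not_tooth_nb w y : y \in skel T -> ~~ tooth_nb w y.
Proof. by move=> yS; apply/negP => t; have := skel_notin yS t;
  rewrite tooth_nb_self. Qed.

Lemma up_nbsN u : u \in skel T -> u != z -> up u \in nbsN u.
Proof. by move=> uS uz; rewrite mem_nbsN up_adj // skel_calN // up_skel. Qed.

Lemma nbsN_up u : u \in skel T -> u != z -> u \in nbsN (up u).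
Proof. by move=> uS uz; rewrite mem_nbsN adj_sym up_adj // skel_calN. Qed.

Lemma sub_nbsN_card v (S : {set cell T}) : S \subset nbsN v -> epsN v = #|S| ->
  nbsN v = S.
Proof. by move=> sub e; apply/esym/eqP; rewrite eqEcard sub -epsNE e /=. Qed.

(** Lists all neighbours of [up u] in [calN]: apart from [u], the next ancestor and possibly one
    tooth, there are none. *)
Variant link_spec u : Prop :=
  | LinkPass of epsN (up u) = 2%N & Rnum (up u) [set edge_to z (up u)] < 1
      & nbsN (up u) = [set u; up (up u)]
  | LinkFork t of epsN (up u) = 3%N & Rnum (up u) [set edge_to z (up u)] = 0
      & nbsN (up u) = [set t; u; up (up u)] & tooth_nb (up u) t.

Lemma linkP u : u \in skel T -> u != z -> link u -> link_spec u.
Proof.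
move=> uS uz [upz [ok]]; have vS := up_skel uS; have nu := up_neq uz upz.
have un := nbsN_up uS uz; have vn := up_nbsN vS upz.
case/orP: ok => [/andP[/eqP e2 R1]|/and3P[/eqP e3 /eqP R0E' /exists_inP[g gv]]].
  apply: LinkPass => //; apply: sub_nbsN_card.
    by rewrite subUset !sub1set un vn.
  by rewrite e2 cards2 eq_sym nu.
have [t tn ->] := edgesN_atP gv; move: (tn); rewrite mem_nbsN => /andP[_ vt].
rewrite edge_toE !set2_eq_adj // => /and3P[tu tup /(toothP vt) tt].
apply: (LinkFork (t := t)) => //; apply: sub_nbsN_card.
  by rewrite !subUset !sub1set tn un vn.
by rewrite e3 -setUA cardsU1 in_set2 negb_or tu tup /= cards2 eq_sym nu.
Qed.

(** In both cases the teeth of [up u] are exactly those listed by [linkP], as [u] and [up (up u)]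
    lie in the skeleton and start no tooth. *)
Lemma link_step u : u \in skel T -> u != z -> link u ->
  [/\ DeltaS (Vbar (up u)) = char_num (up u) [set up u;
    up (up u)] - char_num u [set u; up u],
      0 <= DeltaS (Vbar (up u))
    & DeltaS (nbr u (up u)) = DeltaS (Vbar (up u)) + DeltaS (nbr (up u) (up (up
      u)))].
Proof.
move=> uS uz lu; have [upz _] := lu; have vS := up_skel uS; have wS := up_skel vS.
have uN := skel_calN uS; have vN := skel_calN vS; have uv := up_adj uz.
have nu := up_neq uz upz; have vn := up_nbsN vS upz; have un := nbsN_up uS uz.
have vt y : tooth_nb (up u) y -> y \in nbsN (up u) /\ y \notin skel T.
  by move=> t; split; [exact: tooth_nb_nbsN | apply: contraTN t;
    exact: skel_not_tooth_nb].
rewrite DeltaS_Vbar //; case: (linkP uS uz lu) => [e2 R1 nE|t e3 RE nE tt].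
  rewrite big1 ?addr0; last first.
    move=> y /vt[]; rewrite nE in_set2 => /orP[] /eqP ->; by rewrite ?uS ?wS.
  split; first exact: chr_pass.
    exact: Delta_eps2_ge0.
  by rewrite DeltaS_nbr // (nbsN_set2 uN uv e2 vn nu) big_set1.
have tn := tooth_nb_nbsN tt.
have [_ tS] := vt t tt.
have tu : t != u by apply: contraNneq tS => ->.
have tw : up (up u) != t by apply: contraNneq tS => <-.
rewrite (big_pred1 t); last first.
  move=> y /=; apply/idP/eqP => [/vt[]|-> //].
  rewrite nE -setUA in_setU1 in_set2 => /or3P[] /eqP -> //; by rewrite ?uS ?wS.
have [E le] := chr_fork uN vN uv e3 vn tn nu tu tw RE.
split; first exact: E.
  by rewrite E subr_ge0.
rewrite DeltaS_nbr // (_ : nbsN (up u) :\ u = [set t; up (up u)]).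
  by rewrite big_setU1 ?in_set1 1?eq_sym //= big_set1 (tooth_nb_DeltaS tt) addrA.
rewrite nE; apply/setP => y; rewrite in_setD1 -setUA in_setU1 !in_set2.
have [->|_] := eqVneq y u; last by [].
by rewrite eq_sym (negPf tu) eq_sym (negPf nu).
Qed.

(** The neighbour of [up u] in [calN] besides [u] and the next ancestor can only start a tooth, so
    it is not in the skeleton. *)
Lemma up_inj u v : u \in skel T -> v \in skel T -> u != z -> v != z ->
  link u -> link v -> up u = up v -> u = v.
Proof.
move=> uS vS uz vz lu lv E; have [upz _] := lu; have vS' := up_skel vS.
have vn := nbsN_up vS vz; have wS := up_skel (up_skel uS).
have nu : v != up (up u) by rewrite E eq_sym up_neq // -E.
rewrite -E in vn; case: (linkP uS uz lu) => [e2 _ nE|t _ _ nE tt].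
  by move: vn; rewrite nE in_set2 (negPf nu) orbF => /eqP.
move: vn; rewrite nE -setUA in_setU1 in_set2 (negPf nu) orbF => /orP[] /eqP // vt.
by have := skel_not_tooth_nb (up u) vS; rewrite vt tt.
Qed.

(** * Chains of links and the classes of the comb relation *)

Definition chain u k := forall i, (i < k)%N -> link (iter i up u).

Definition inO u := (u \in skel T) && (u != z).

Lemma inOP u : inO u -> u \in skel T /\ u != z.
Proof. by case/andP. Qed.

Lemma mem_calO p : (p \in calO z) = (p == phi p.1) && inO p.1.
Proof.
apply/imsetP/andP => [[u]|[/eqP pE uO]].
  by rewrite in_setD1 => /andP[uz uS] ->; rewrite /inO uS uz eqxx.
by exists p.1; rewrite // in_setD1 andbC.
Qed.

Lemma mem_calO_phi u : (phi u \in calO z) = inO u.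
Proof. by rewrite mem_calO eqxx. Qed.

Lemma chain_inO u k i : inO u -> chain u k -> (i <= k)%N -> inO (iter i up u).
Proof.
move=> uO ch; elim: i => // i IH ik; have /inOP[xS xz] := IH (ltnW ik).
by have [upz _] := ch i ik; rewrite iterS /inO up_skel.
Qed.

Lemma chainD u k l : chain u k -> chain (iter k up u) l -> chain u (k + l)%N.
Proof.
move=> c1 c2 i ikl; have [ik|ki] := ltnP i k; first exact: c1.
by rewrite -(subnK ki) iterD; apply: c2; rewrite ltn_subLR.
Qed.

Lemma chain_le u k l : (l <= k)%N -> chain u k -> chain u l.
Proof. by move=> lk c i il; apply: c; exact: leq_trans lk. Qed.

Lemma chain_suffix u k l : (l <= k)%N -> chain u k ->
  chain (iter l up u) (k - l)%N.
Proof. by move=> lk c i il; rewrite -iterD; apply: c; rewrite -ltn_subRL;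
  lia. Qed.

(** Two chains with the same end are traced back together by injectivity of [up] on links, until the
    shorter one is exhausted. *)
Lemma chain_merge u w k l : inO u -> inO w -> chain u k -> chain w l ->
  iter k up u = iter l up w -> (k <= l)%N -> u = iter (l - k)%N up w.
Proof.
move=> uO wO; elim: k l => [|k IH] l ck cl E kl; first by rewrite subn0.
case: l cl E kl => // l cl E kl; rewrite subSS.
apply: (IH l) => //; [exact: chain_le ck|exact: chain_le cl|].
have /inOP[aS az] := chain_inO uO ck (leqnSn k).
have /inOP[bS bz] := chain_inO wO cl (leqnSn l).
exact: up_inj (ck k (leqnn _)) (cl l (leqnn _)) E.
Qed.

Lemma comb_chain u v : inO u -> inO v ->
  comb (phi u) (phi v) <-> exists2 k, v = iter k up u & chain u k.
Proof. by move=> /inOP[uS uz] /inOP[_ vz]; exact: comb_iter. Qed.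

Lemma csim_chain u v : inO u -> inO v ->
  csim (phi u) (phi v) <->
  (exists2 k, v = iter k up u & chain u k) \/ (exists2 k, u = iter k up v &
    chain v k).
Proof.
move=> uO vO; split.
  by case/orP => /comb_chain H; [left|right]; apply: H.
by case=> H; apply/orP; [left|right]; apply/comb_chain.
Qed.

Lemma csim_trans u v w : inO u -> inO v -> inO w ->
  csim (phi u) (phi v) -> csim (phi v) (phi w) -> csim (phi u) (phi w).
Proof.
move=> uO vO wO /(csim_chain uO vO) uv /(csim_chain vO wO) vw.
apply/csim_chain => //; case: uv vw => [[k vE ck]|[k uE ck]] [[l wE cl]|[l vE'
  cl]].
- left; exists (k + l)%N; first by rewrite addnC iterD -vE.
  by apply: chainD => //; rewrite -vE.
- have [kl|/ltnW lk] := leqP k l.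
    right; exists (l - k)%N; last exact: chain_le (leq_subr _ _) cl.
    by apply: chain_merge ck cl _ kl; rewrite // -vE.
  left; exists (k - l)%N; last exact: chain_le (leq_subr _ _) ck.
  by apply: chain_merge cl ck _ lk; rewrite // -vE.
- have [kl|/ltnW lk] := leqP k l.
    left; exists (l - k)%N; first by rewrite uE -iterD subnK.
    by rewrite uE; apply: chain_suffix.
  right; exists (k - l)%N; first by rewrite wE -iterD subnK.
  by rewrite wE; apply: chain_suffix.
right; exists (l + k)%N; first by rewrite addnC iterD -vE'.
by apply: chainD => //; rewrite -vE'.
Qed.

Lemma csim_equiv : {in calO z & &, equivalence_rel (@csim T)}.
Proof.
move=> p q r; rewrite !mem_calO => /andP[/eqP -> pO] /andP[/eqP ->
  qO] /andP[/eqP -> rO].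
split; first by apply/csim_chain => //; left; exists 0%N.
move=> pq; have qp : csim (phi q.1) (phi p.1) by rewrite /csim orbC; exact: pq.
by apply/idP/idP; [exact: csim_trans qO pO rO qp | exact: csim_trans pO qO rO pq].
Qed.

Lemma calObar_partition : partition (calObar z) (calO z).
Proof. exact: equivalence_partitionP csim_equiv. Qed.

Definition depth u := size (gamma u z).

Lemma depth_up u : u != z -> depth u = (depth (up u)).+1.
Proof. by move=> uz; rewrite /depth gamma_up. Qed.

Lemma depth_chain u k i : inO u -> chain u k -> (i <= k)%N ->
  (depth (iter i up u) + i)%N = depth u.
Proof.
move=> uO ch; elim: i => [|i IH] ik; first by rewrite addn0.
have /inOP[_ xz] := chain_inO uO ch (ltnW ik).
by rewrite -(IH (ltnW ik)) (depth_up xz) addSnnS.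
Qed.

Lemma chain_gamma u k i : inO u -> chain u k -> (i <= k)%N ->
  iter i up u \in gamma u z.
Proof.
move=> uO ch ik.
have /inOP[uS uz] := uO; have /inOP[vS vz] := chain_inO uO ch ik.
have : comb (phi u) (phi (iter i up u)).
  by apply/comb_chain; rewrite /inO ?uS ?uz ?vS //; exists i => //;
    exact: chain_le ch.
by case/comb_phi.
Qed.

(** The element of maximal depth is the top of the chain, and every other one is reached from it by
    links. The last clause, that no link arrives at [u], is kept for the lower bound at the top. *)
Lemma calObar_chain C : C \in calObar z -> exists u k,
  [/\ inO u, chain u k, C = [set phi (iter i up u) | i : 'I_k.+1],
      greatest C = phi u & least C = phi (iter k up u)] /\
  (forall x, inO x -> link x -> up x != u).
Proof.
move=> CO; have /and3P[/eqP cov triv n0] := calObar_partition.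
have CS p : p \in C -> p \in calO z.
  by move=> pC; rewrite -cov; apply/bigcupP; exists C.
have /set0Pn[p0 p0C] : C != set0 by apply: contraNneq n0 => <-.
have CE p : p \in C -> forall q, (q \in C) = (q \in calO z) && csim p q.
  move=> pC q; have pO := CS p pC.
  have CE' : C = pblock (calObar z) p by rewrite (def_pblock triv CO pC).
  apply/idP/andP => [qC|[qO pq]].
    split; first exact: CS.
    rewrite -(pblock_equivalence_partition csim_equiv pO (CS q qC)).
    by rewrite -CE'.
  rewrite CE' (pblock_equivalence_partition csim_equiv pO) //.
have CE1 p : p \in C -> p = phi p.1 /\ inO p.1.
  by move=> /CS; rewrite mem_calO => /andP[/eqP].
have [u [uO uC umax]] : exists u, [/\ inO u, phi u \in C &
    forall x, phi x \in C -> (depth x <= depth u)%N].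
  have [p pC pmax] := @arg_maxnP _ p0 (mem C) (fun p => depth p.1) p0C.
  have [pE pO] := CE1 _ pC; exists p.1; split; [exact: pO | by rewrite -pE|].
  by move=> x /pmax.
have [v [vO vC vmin]] : exists v, [/\ inO v, phi v \in C &
    forall x, phi x \in C -> (depth v <= depth x)%N].
  have [p pC pmin] := @arg_minnP _ p0 (mem C) (fun p => depth p.1) p0C.
  have [pE pO] := CE1 _ pC; exists p.1; split; [exact: pO | by rewrite -pE|].
  by move=> x /pmin.
have below x : phi x \in C -> exists2 i, x = iter i up u & chain u i.
  move=> xC; have [_ xO] := CE1 _ xC; have := xC; rewrite (CE _ uC) => /andP[_].
  move=> /(csim_chain uO xO)[//|[i uE ci]].
  have dE := depth_chain xO ci (leqnn i); rewrite -uE in dE.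
  have i0 : i = 0%N.
    by have := umax _ xC; rewrite -dE -[leqRHS]addn0 leq_add2l leqn0 => /eqP.
  by exists 0%N; rewrite // uE i0.
have [k vE ck] := below v vC.
have inC i : (i <= k)%N -> phi (iter i up u) \in C.
  move=> ik; have iO := chain_inO uO ck ik.
  rewrite (CE _ uC) mem_calO_phi iO; apply/(csim_chain uO iO); left.
  by exists i; last exact: chain_le ck.
have CkE : C = [set phi (iter i up u) | i : 'I_k.+1].
  apply/setP => q; apply/idP/imsetP => [qC|[i _ ->]]; last by apply: inC;
    rewrite -ltnS.
  have [qE qO] := CE1 _ qC; have [i xE ci] : exists2 i, q.1 = iter i up u &
    chain u i.
    by apply: below; rewrite -qE.
  have ik : (i <= k)%N.
    have dx := depth_chain uO ci (leqnn i);
      have dv := depth_chain uO ck (leqnn k).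
    rewrite -xE in dx; rewrite -vE in dv.
    by rewrite -(leq_add2l (depth q.1)) dx -dv leq_add2r vmin // -qE.
  by exists (Ordinal (ik : (i < k.+1)%N)); rewrite //= -xE.
have preq i j : (i <= j <= k)%N -> preceq (phi (iter j up u)) (phi (iter i up u)).
  move=> /andP[ij jk]; have ik := leq_trans ij jk.
  have iO := chain_inO uO ck ik; have /inOP[_ iz] := iO.
  have /inOP[_ jz] := chain_inO uO ck jk.
  rewrite preceq_phi // -(subnK ij) iterD.
  by apply: chain_gamma iO (chain_suffix ik ck) _; apply: leq_sub2r.
have anti a b : inO a -> inO b -> preceq (phi a) (phi b) ->
  preceq (phi b) (phi a) -> a = b.
  move=> /inOP[_ az] /inOP[_ bz]; rewrite !preceq_phi //; exact: gamma_anti.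
exists u, k; split; first split => //.
- rewrite /greatest; case: pickP => [p /andP[pC /forall_inP pg]|/(_ (phi u))] /=.
    move: (pC); rewrite CkE => /imsetP[i _ pE];
      have ik : (i <= k)%N by rewrite -ltnS.
    have E : iter i up u = u.
      apply: anti => //; first exact: chain_inO uO ck ik.
        by have := preq 0%N i; rewrite ik; apply.
      by rewrite -pE; apply: pg; apply: (inC 0%N).
    by rewrite pE E.
  rewrite (inC 0%N) //= => /negP[]; apply/forall_inP => q;
    rewrite CkE => /imsetP[i _ ->].
  by apply: (preq 0%N); rewrite leq0n -ltnS ltn_ord.
- rewrite /least; case: pickP => [p /andP[pC /forall_inP pg]|/(_ (phi v))] /=.
    move: (pC); rewrite CkE => /imsetP[i _ pE];
      have ik : (i <= k)%N by rewrite -ltnS.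
    have E : iter k up u = iter i up u.
      apply: anti; try exact: chain_inO uO ck _.
        by apply: preq; rewrite ik leqnn.
      by rewrite -pE; apply: pg; apply: inC.
    by rewrite pE E.
  rewrite vE inC //= => /negP[]; apply/forall_inP => q;
    rewrite CkE => /imsetP[i _ ->].
  by apply: preq; rewrite leqnn andbT -ltnS ltn_ord.
move=> x xO lx; apply/eqP => xu.
(* Such an [x] would belong to [C] and lie one step deeper than [u]. *)
have c1 : chain x 1 by case.
have xC : phi x \in C.
  by rewrite (CE _ uC) mem_calO_phi xO; apply/(csim_chain uO xO); right;
    exists 1%N.
have dx := depth_chain xO c1 (leqnn 1);
  rewrite -[iter 1 up x]/(up x) xu addn1 in dx.
by have := umax _ xC; rewrite -dx ltnn.
Qed.

(** * Telescoping along a class *)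

Lemma chain_sub u k : inO u -> chain u k ->
  nbr (iter k up u) (up (iter k up u)) \subset nbr u (up u).
Proof.
move=> uO; elim: k => // k IH ck;
  have := chain_inO uO ck (leqnSn k) => /inOP[xS xz].
have [upz _] := ck k (leqnn _).
apply: subset_trans (IH (chain_le (leqnSn k) ck)); rewrite iterS.
apply/subsetP => y; rewrite !mem_nbr => /andP[-> /=].
by apply: branch_sub; rewrite ?up_adj ?up_neq.
Qed.

(** The growth of the side sums and that of the characteristic numbers are expressed by one and the
    same sum, whose terms are nonnegative. *)
Lemma chain_sum u k : inO u -> chain u k -> let v := iter k up u in
  [/\ DeltaS (nbr u (up u)) - DeltaS (nbr v (up v)) =
        \sum_(i < k) DeltaS (Vbar (iter i.+1 up u)),
      char_num v [set v; up v] - char_num u [set u; up u] =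
        \sum_(i < k) DeltaS (Vbar (iter i.+1 up u))
    & 0 <= \sum_(i < k) DeltaS (Vbar (iter i.+1 up u))].
Proof.
move=> uO; elim: k => [|k IH] ck /=; first by rewrite big_ord0 !subrr.
have := chain_inO uO ck (leqnSn k) => /inOP[xS xz].
have [E1 E2 ge0] := IH (chain_le (leqnSn k) ck).
have [D1 D0 D2] := link_step xS xz (ck k (leqnn _)).
rewrite !big_ord_recr /= -{1}E1 -E2 D2 D1; split; [ring | ring |].
by rewrite E2 -D1 addr_ge0.
Qed.

Lemma Vbar_disjoint u : inO u -> [disjoint Vbar u & nbr u (up u)].
Proof.
move=> /inOP[uS uz]; rewrite disjoint_subset; apply/subsetP => x.
rewrite mem_Vbar => xV; change (x \notin nbr u (up u)); move: xV.
case/predU1P=> [->|/existsP[y /andP[t]]];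
  first by rewrite mem_nbr [u \in branch _ _]inE eqxx andbF.
rewrite !mem_nbr => /andP[_ xb]; apply/negP => /andP[_ xb'].
by have := skel_not_tooth_nb u (up_skel uS); rewrite -(branch_disj xb xb') t.
Qed.

Lemma calN_at_up u : u != z -> calN_at u (edge_to z u) = nbr u (up u).
Proof. by move=> uz; rewrite edge_toE calN_atE // up_adj. Qed.

Lemma DeltaS_setD (A B : {set cell T}) : B \subset A ->
  DeltaS (A :\: B) = DeltaS A - DeltaS B.
Proof.
move=> /setIidPr BA; rewrite /DeltaS [in RHS](big_setID B) /= BA.
by ring.
Qed.

Lemma DeltaS_setU (A B : {set cell T}) : [disjoint A & B] ->
  DeltaS (A :|: B) = DeltaS A + DeltaS B.
Proof. exact: big_disjointU. Qed.

Section Class.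
Variables (C : {set cell T * {set cell T}}) (u : cell T) (k : nat).
Hypotheses (uO : inO u) (ck : chain u k).
Hypothesis CE : C = [set phi (iter i up u) | i : 'I_k.+1].
Hypotheses (gC : greatest C = phi u) (lC : least C = phi (iter k up u)).
Let v := iter k up u.

Lemma Yset_chain : Yset C = Vbar u :|: (nbr u (up u) :\: nbr v (up v)).
Proof.
have /inOP[_ uz] := uO; have /inOP[_ vz] := chain_inO uO ck (leqnn k).
by rewrite /Yset /u_of gC lC !calN_at_up.
Qed.

Lemma DeltaS_Yset : DeltaS (Yset C) =
  DeltaS (Vbar u) + (DeltaS (nbr u (up u)) - DeltaS (nbr v (up v))).
Proof.
rewrite Yset_chain DeltaS_setU ?DeltaS_setD ?chain_sub //.
by apply: disjointWr (Vbar_disjoint uO); apply: subsetDl.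
Qed.

Lemma DeltaS_Yset_cdot : DeltaS (Yset C) = DeltaS (Vbar (u_of C)) + cdot C.
Proof.
rewrite DeltaS_Yset /u_of /cdot gC lC; congr (_ + _).
by have [-> <- _] := chain_sum uO ck.
Qed.

Lemma cdot_ge0 : 0 <= cdot C.
Proof. by rewrite /cdot gC lC; have [_ <-] := chain_sum uO ck. Qed.

(** The term of index 0 is [Vbar u]; the other elements of the class account for the difference of
    the two sides. *)
Lemma DeltaS_Yset_sum : DeltaS (Yset C) = \sum_(p in C) DeltaS (Vbar p.1).
Proof.
rewrite DeltaS_Yset CE big_imset /= => [|i j _ _ [E _]]; last first.
  apply/val_inj/eqP => /=.
  have di := depth_chain uO ck (i := i); have dj := depth_chain uO ck (i := j).
  rewrite -(eqn_add2l (depth (iter i up u))) di; last by rewrite -ltnS.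
  by rewrite E dj // -ltnS.
rewrite (eq_bigl predT) // big_ord_recl /=; congr (_ + _).
by have [-> _ _] := chain_sum uO ck.
Qed.

End Class.

Lemma DeltaS_calN_classes :
  DeltaS (calN T) = DeltaS (Vbar z) + \sum_(C in calObar z) DeltaS (Yset C).
Proof.
rewrite DeltaS_calN (big_setD1 z) //=; congr (_ + _).
transitivity (\sum_(p in calO z) DeltaS (Vbar p.1)).
  by rewrite big_imset //= => u w _ _ [].
rewrite (set_partition_big _ calObar_partition) /=; apply: eq_bigr => C CO.
have [u [k [[uO ck CE gC lC] _]]] := calObar_chain CO.
by rewrite (DeltaS_Yset_sum uO ck CE gC lC).
Qed.

(** * The lower bound at the top of a class *)

Section Bound.
Hypotheses (hOmega : (#|Omega T| <= 1)%N) (hz : z \in In_set T).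

Lemma Omega_z x : x \in Omega T -> x = z.
Proof.
move=> xO; have On0 : Omega T != set0 by apply/set0Pn; exists x.
move: hz; rewrite /In_set On0 => zO.
by move/card_le1_eqP: hOmega; apply.
Qed.

Lemma calN_child_exists u : u \in calN T -> (2 <= epsN u)%N ->
  exists2 y, child u y & y \in calN T.
Proof.
rewrite epsNE => uN /card_gt1P[a [b []]]; rewrite !mem_nbsN.
move=> /andP[aN ua] /andP[bN ub] ab.
have [ca|] := boolP (child u a); first by exists a.
rewrite adj_child // negbK => pa.
have [cb|] := boolP (child u b); first by exists b.
by rewrite adj_child // negbK => /(child_parent pa) E; rewrite E eqxx in ab.
Qed.

(** The neighbour [up u] is in the skeleton and hence starts no tooth. *)
Lemma card_tooth_nb u : inO u -> (#|[set y | tooth_nb u y]| < epsN u)%N.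
Proof.
move=> /inOP[uS uz]; rewrite epsNE (cardsD1 (up u) (nbsN u)) up_nbsN //= ltnS.
apply: subset_leq_card; apply/subsetP => y; rewrite in_set => t.
rewrite in_setD1 tooth_nb_nbsN // andbT; apply: contraTneq t => ->.
by apply: skel_not_tooth_nb; apply: up_skel.
Qed.

Lemma rat_int_ge1 (x : rat) : (exists k : int, x = k%:~R) -> 0 < x -> 1 <= x.
Proof. by case=> k ->; rewrite ltr0z ler1z gtz0_ge1. Qed.

(** Here [e] is epsilon, [t] the number of teeth and [s] their total. The worst case is t = e - 1,
    where the expression is at least (e - 3)N/2 + 1; N >= 2 then gives e - 2. *)
Lemma fork_arith (e t N r s : rat) : 3 <= e -> t + 1 <= e -> 2 <= N -> 0 <= r ->
  t * (1 - N / 2) <= s ->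
  1 <= (e - 2) * (N - 1) + r + s /\ e - 2 <= (e - 2) * (N - 1) + r + s.
Proof.
move=> e3 te N2 r0 ts.
have p1 : 0 <= (e - 1 - t) * (N / 2 - 1) by apply: mulr_ge0; lra.
have p2 : 0 <= (e - 3) * (N - 2) by apply: mulr_ge0; lra.
split; lra.
Qed.

(** For epsilon at least 3 this is [fork_arith]. Otherwise the maximum is 1 and integrality reduces
    the claim to positivity, which comes from the definition of Gamma if there is a tooth, from
    [Omega] at a leaf, and from maximality of the class in the remaining case. *)
Lemma DeltaS_Vbar_lower u : inO u -> (forall x, inO x -> link x -> up x != u) ->
  Num.max 1 ((epsN u)%:R - 2) <= DeltaS (Vbar u).
Proof.
move=> uO umax; have /inOP[uS uz] := uO; have uN := skel_calN uS.
have te := card_tooth_nb uO; have up_in := up_nbsN uS uz.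
rewrite DeltaS_Vbar // ge_max.
have N0 := Nmultr_gt0 uN; have R00 := R0_ge0 uN.
have [e3|e_le2] := leqP 3 (epsN u).
  have [y cy yN] := calN_child_exists uN (ltnW e3).
  have N2 : 2 <= (Nmult u)%:~R :> rat by rewrite (ler_int _ 2) (Nmult_child_ge2
    cy yN).
  have low : (#|[set y | tooth_nb u y]|)%:R * (1 - (Nmult u)%:~R / 2) <=
      \sum_(y | tooth_nb u y) (1 - char_num u [set u; y]).
    rewrite mulr_natl -sumr_const; under eq_bigl do rewrite in_set.
    apply: ler_sum => t tt; have := tooth_nb_nbsN tt;
      rewrite mem_nbsN => /andP[tN _].
    have := chr_child_half (tooth_nb_child tt) tN; lra.
  rewrite DeltaE //.
  have e3r : 3 <= (epsN u)%:R :> rat by rewrite (ler_nat _ 3).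
  have ter : (#|[set y | tooth_nb u y]|)%:R + 1 <= (epsN u)%:R :> rat by
    rewrite natr1 ler_nat.
  have NR : 0 <= (Nmult u)%:~R * R0 u by rewrite mulr_ge0 // ltW.
  by apply/andP; apply: fork_arith low.
have max1 : 1 <= Delta u + \sum_(y | tooth_nb u y) (1 - char_num u [set u; y]) ->
    (1 <= Delta u + \sum_(y | tooth_nb u y) (1 - char_num u [set u; y])) &&
    ((epsN u)%:R - 2 <= Delta u + \sum_(y | tooth_nb u y) (1 - char_num u [set
      u; y])).
  move=> le1; rewrite le1 /=; apply: le_trans le1.
  have : (epsN u)%:R <= 2 :> rat by rewrite (ler_nat _ _ 2) -ltnS.
  lra.
apply: max1; have [/existsP[y ty]|/existsPn no] := boolP [exists y, tooth_nb u y].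
  rewrite (big_pred1 y); last first.
    move=> y'; apply/idP/eqP => [t'|-> //]; apply/eqP.
    have /card_le1_eqP H : (#|[set y | tooth_nb u y]| <= 1)%N.
      by rewrite -ltnS; apply: leq_trans te _; rewrite -ltnS.
    by apply/eqP; apply: H; rewrite in_set.
  have [v Gv [_ [_ _ _ _ Dv]]] := tooth_nbP ty; rewrite -Dv.
  have [[vN _ _ _ _] [_ D0 _]] := Gamma_facts Gv.
  apply: rat_int_ge1; last by rewrite addrC.
  have [a ->] := Delta_int uN; have [b ->] := Delta_int vN.
  by exists (a + b); rewrite intrD.
rewrite big_pred0 ?addr0; last by move=> y; apply/negbTE.
apply: rat_int_ge1; first exact: Delta_int.
have [e1|en1] := eqVneq (epsN u) 1%N.
  rewrite ltNge; apply/negP => D0.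
  by case/eqP: uz; apply: Omega_z; apply: mem_Omega.
have e2 : epsN u = 2%N.
  have : (0 < epsN u)%N by rewrite epsNE; apply/card_gt0P; exists (up u).
  by move: e_le2 en1; case: (epsN u) => [|[|[|]]].
have [y yE] : exists y, nbsN u :\ up u = [set y].
  by apply/cards1P; move: e2; rewrite epsNE (cardsD1 (up u)) up_in => /eqP;
    rewrite eqSS.
have : y \in nbsN u :\ up u by rewrite yE set11.
rewrite in_setD1 => /andP[yu yn]; move: (yn); rewrite mem_nbsN => /andP[yN uy].
(* Off the skeleton, [y] would lie in a tooth. Since [u] does not, the edge [yu] would be the base
   edge of that tooth, and [u] would carry a tooth after all. *)
have yS : y \in skel T.
  apply: contraT => yS; have [w [t [wt yn']]] := notin_skel yN yS.
  have wta := tooth_nb_adj wt; have uwt := skel_notin_branch uS wt.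
  have [E|neq] := eqVneq [set y; u] [set w; t].
    have uE : u = w.
      have : u \in [set w; t] by rewrite -E set22.
      rewrite in_set2 => /orP[] /eqP // ut.
      by have := skel_not_tooth_nb w uS; rewrite ut wt.
    by have := no t; rewrite uE wt.
  move: yn'; rewrite mem_nbr yN /= (branch_adjE wta _ neq) 1?adj_sym //.
  by move=> ub; move: uwt; rewrite (branchC u wta) ub.
have upy : up y = u.
  apply: toward_branch; rewrite (branchC z uy); apply/negP => zy.
  by move: yu; rewrite (branch_disj zy (z_up uz)) eqxx.
have yz : y != z.
  apply: contraNneq yu => yz; apply/eqP.
  by apply: (branch_disj (branch_self uy)); rewrite yz; exact: z_up.
rewrite DeltaE // e2 subrr mul0r add0r;
  rewrite lt0r (mulr_ge0 (ltW N0) R00) andbT.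
apply/negP => /eqP/eqP; rewrite mulf_eq0 gt_eqF //= => /eqP R00'.
have yO : inO y by rewrite /inO yS yz.
have := umax y yO; rewrite upy eqxx => H; suff /H : link y by [].
(* If [Delta u] were 0, then [R0 u = 0] and [Rnum] would be 1 - 1/M < 1, so [y] would be linked to
   [u]. *)
split; rewrite upy //; constructor;
  rewrite e2 eqxx /= Rnum_set1 R00' add0r edge_toE.
have [m m1 [-> _]] := Mnum_int (up_adj uz) uN (skel_calN (up_skel uS)).
by rewrite gtrBl div1r invr_gt0 ltr0z (lt_le_trans ltr01).
Qed.

(** * The surroundings of the base point [z] *)

Lemma skel_nb_exists : (1 < #|skel T|)%N -> exists2 y, y \in skel T & adj z y.
Proof.
move=> hS; have /card_gt0P[u] : (0 < #|skel T :\ z|)%N.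
  by move: hS; rewrite (cardsD1 z) zS.
rewrite in_setD1 => /andP[uz uS]; have zu : z != u by rewrite eq_sym.
exists (toward u z); last exact: toward_adj.
apply: skel_convex zS uS _; have [_ -> _] := gamma_toward zu.
by rewrite inE mem_gammal orbT.
Qed.

Lemma not_tooth_nb_edge w : w \in nbsN z -> ~~ tooth_nb z w ->
  [set z; w] \in [set e in edgesN_at z |
    ~~ [exists x, exists w, Gamma (gamma x w) && (e \in gamma_edges x w)]].
Proof.
move=> wn nt; have zw : adj z w by move: wn; rewrite mem_nbsN => /andP[].
rewrite in_set mem_edgesN_at ?skel_calN //=;
  apply/existsP => -[x /existsP[w0 /andP[Gx eg]]].
have zg : z \in gamma x w0 by apply: path_edges_sub eg (set21 _ _).
have [E|zw0] := eqVneq z w0; last first.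
  by have := skel_notin zS (Gamma_tooth_nb Gx); rewrite (Gamma_nbr Gx zg zw0).
move: Gx eg; rewrite -{}E => Gx;
  rewrite gamma_edgesE // [z \in branch _ _]inE eqxx /=.
case: (boolP (x \in branch z w)) => // xb _.
by have := Gamma_tooth_nb Gx; rewrite (toward_branch xb) (negPf nt).
Qed.

(** If [Omega] is nonempty, [z] is a leaf of [calN]. Otherwise each such neighbour gives an edge
    counted by [delta_star z], which is at most 1. *)
Lemma nbsN_not_tooth_nb_unique a b : a \in nbsN z -> b \in nbsN z ->
  ~~ tooth_nb z a -> ~~ tooth_nb z b -> a = b.
Proof.
move=> an bn na nb; move: hz; rewrite /In_set; case: ifP => _.
  rewrite in_setD => /andP[_]; rewrite in_set => /and3P[_ /eqP e1 _].
  have /card_le1_eqP H : (#|nbsN z| <= 1)%N by rewrite -epsNE e1.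
  exact: H.
rewrite in_set => /andP[_ /card_le1_eqP H].
have := H _ _ (not_tooth_nb_edge an na) (not_tooth_nb_edge bn nb).
have [za zb] : adj z a /\ adj z b by move: an bn;
  rewrite !mem_nbsN => /andP[_ ->] /andP[_ ->].
by move/eqP; rewrite set2_eq_adj // => /eqP ->.
Qed.

Section SkelNeighbour.
Hypothesis hS : (1 < #|skel T|)%N.

Lemma zprimeP : [/\ inO (zprime z), up (zprime z) = z, zprime z \in nbsN z &
  forall y, y \in nbsN z -> y != zprime z -> tooth_nb z y].
Proof.
rewrite /zprime; case: pickP => [y /andP[yS zy]|no] /=; last first.
  by have [y yS zy] := skel_nb_exists hS; have := no y; rewrite yS zy.
have yn : y \in nbsN z by rewrite mem_nbsN skel_calN.
split=> //.
- by rewrite /inO yS eq_sym (adj_neq zy).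
- by apply: toward_branch; apply: branch_self; rewrite adj_sym.
move=> w wn; apply: contraNT => nt; apply/eqP.
by apply: nbsN_not_tooth_nb_unique => //; exact: skel_not_tooth_nb.
Qed.

(** Every other neighbour of [z] in [calN] starts a tooth, so nothing but the teeth of [z] hangs on
    this side of the edge. *)
Lemma nbr_zprime : nbr (zprime z) z = Vbar z.
Proof.
have [zO upz zn tz] := zprimeP; have zN := skel_calN zS; have /inOP[z'S _] := zO.
have zz : adj z (zprime z) by move: zn; rewrite mem_nbsN => /andP[].
apply/setP => x; rewrite mem_nbr mem_Vbar (branchC x zz).
have [->|xz] /= := eqVneq x z; first by rewrite zN inE eqxx.
have zx : z != x by rewrite eq_sym.
apply/andP/existsP => [[xN xb]|[y /andP[t]]].
  have xn : x \in nbr z (toward x z) by rewrite mem_nbr xN mem_branch.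
  exists (toward x z); rewrite xn andbT; apply: tz.
    by rewrite mem_nbsN toward_adj // (calN_branch zN (toward_adj zx) xn).
  by apply: contraNneq xb => <-; exact: mem_branch.
rewrite mem_nbr => /andP[-> xb]; split=> //; apply/negP => xb'.
by have := skel_not_tooth_nb z z'S; rewrite -(branch_disj xb xb') t.
Qed.

(** No chain continues past z', because [up (zprime z)] is [z] and links stop before [z]; hence z'
    is the least element of its class. *)
Lemma C0_chain : exists u k, [/\ inO u, chain u k, greatest (C0 z) = phi u,
  least (C0 z) = phi (iter k up u) & iter k up u = zprime z] /\
  C0 z \in calObar z.
Proof.
have [zO upz zn tz] := zprimeP; have /and3P[/eqP cov _ _] := calObar_partition.
have pO : phi (zprime z) \in cover (calObar z) by rewrite cov mem_calO_phi.
have CO : C0 z \in calObar z by apply: pblock_mem pO.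
have [u [k [[uO ck CE gC lC] _]]] := calObar_chain CO.
exists u, k; split=> //; split=> //.
have : phi (zprime z) \in C0 z by rewrite /C0 mem_pblock.
rewrite CE => /imsetP[i _ [E _]]; have := ltn_ord i; rewrite ltnS leq_eqVlt.
case/orP=> [/eqP <- //|ik]; have [] := ck i ik.
by rewrite -E upz eqxx.
Qed.

Lemma DeltaS_C0 : DeltaS (Vbar z) + DeltaS (Yset (C0 z)) =
  DeltaS (Vbar (u0 z) :|: calN_at (u0 z) (edge_to z (u0 z))).
Proof.
have [u [k [[uO ck gC lC zE] _]]] := C0_chain; have /inOP[_ uz] := uO.
have [_ upz _ _] := zprimeP.
rewrite (DeltaS_Yset uO ck gC lC) zE upz nbr_zprime /u0 /u_of gC calN_at_up //.
by rewrite DeltaS_setU ?Vbar_disjoint //; ring.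
Qed.

End SkelNeighbour.

End Bound.

End Rooted.

Lemma In_set_skel z : z \in In_set T -> z \in skel T.
Proof.
by rewrite /In_set; case: ifP => _;
  [exact: Omega_skel | rewrite in_set => /andP[]].
Qed.

End Newton.

Theorem theorem6p18 (T : decorated_tree)
    (hN : newton_tree T) (hmc : minimally_complete T)
    (hS : (1 < #|skel T|)%N) (hOmega : (#|Omega T| <= 1)%N)
    (z : cell T) (hz : z \in In_set T) :
  (forall C : {set cell T * {set cell T}}, C \in calObar z ->
     [/\ DeltaS (Yset C) = DeltaS (Vbar (u_of C)) + cdot C,
         DeltaS (Vbar (u_of C)) >= Num.max 1 ((epsN (u_of C))%:R - 2)
       & 0 <= cdot C])
  /\
  (DeltaS (calN T) = DeltaS (Vbar z) + \sum_(C in calObar z) DeltaS (Yset C)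
   /\
   DeltaS (Vbar z) + \sum_(C in calObar z) DeltaS (Yset C)
   = DeltaS (Vbar (u0 z) :|: calN_at (u0 z) (edge_to z (u0 z)))
     + \sum_(C in calObar z :\ C0 z) DeltaS (Yset C)).
Proof.
have zS := In_set_skel hN hmc hz; split=> [C CO|].
  have [u [k [[uO ck CE gC lC] umax]]] := calObar_chain hN hmc zS CO.
  split.
  - exact: (DeltaS_Yset_cdot hN hmc zS uO ck gC lC).
  - by rewrite /u_of gC; exact: (DeltaS_Vbar_lower hN hmc zS hOmega hz uO umax).
  - exact: (cdot_ge0 hN hmc zS uO ck gC lC).
split; first exact: DeltaS_calN_classes.
have [_ [_ [_ CO]]] := C0_chain hN hmc zS hz hS.
by rewrite (big_setD1 (C0 z)) //= addrA (DeltaS_C0 hN hmc zS hz hS).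
Qed.
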